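(* Let $n\ge 0$ be an integer and $w\in\mathbb{C}$ with $\Re w>0$. Then $$\zeta_H'(-n,w)=(-1)^nn!\left(\int_0^{+\infty}\frac{1}{t^n}\left(\frac{1}{1-e^{-t}}-\sum_{k=-1}^{n}b_kt^k\right)\frac{e^{-wt}\,dt}{t}+\hat{\mathbf r}_n(w)-b_n(w)H_n\right),$$ and $\zeta_H'(-n,w)$ is an exponential period over the field $\mathbb{Q}(t,e^{-t},w,e^{-wt})$.
   Context: $\zeta_H(s,w)$ is the Hurwitz zeta function, $\zeta_H(s,w)=\sum_{k\ge 0}(k+w)^{-s}$ for $\Re s>1$, $\Re w>0$, extended meromorphically to $s\in\mathbb{C}$, and $\zeta_H'(s,w)=\frac{\partial}{\partial s}\zeta_H(s,w)$. $H_\ell=1+\frac12+\cdots+\frac1\ell$, $H_0=0$; $\log$ is the principal branch. The rational numbers $b_k$ ($k\ge-1$) are defined by $\frac{1}{1-e^{-t}}=\sum_{k\ge -1}b_kt^k$, and the modified Bernoulli polynomials $b_k(w)$ by $\frac{e^{-wt}}{1-e^{-t}}=\frac1t+\sum_{k\ge0}b_k(w)t^k$. Moreover $$\hat{\mathbf r}_n(w)=\sum_{\ell=1}^{n+1}b_{n-\ell}\frac{(-1)^\ell}{\ell!}w^\ell H_\ell+\left(\sum_{\ell=0}^{n+1}b_{n-\ell}\frac{(-1)^{\ell+1}}{\ell!}w^\ell\right)\log w.$$ For a fixed complex number $w$, $\mathbb{Q}(t,e^{-t},w,e^{-wt})$ is the field of meromorphic functions of $t$ generated over $\mathbb{Q}$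 by $t$, $e^{-t}$, the constant $w$ and $e^{-wt}$. A complex number is an exponential period over a field $\mathbb{F}$ of meromorphic functions of $t$ if it equals a convergent integral $\int_0^{+\infty}f(t)\,dt$ with $f\in\mathbb{F}$. *)

(* Defs.v *)
From Stdlib Require Export Reals ZArith QArith Qreals List ClassicalEpsilon.
From Coquelicot Require Export Coquelicot.
Open Scope C_scope.

Definition Cexp (z : C) : C :=
  (exp (Re z) * cos (Im z), exp (Re z) * sin (Im z))%R.

(* Principal argument, in (-PI, PI], for z <> 0. *)
Definition Arg (z : C) : R :=
  if Rle_dec 0 (Im z) then acos (Re z / Cmod z) else (- acos (Re z / Cmod z))%R.

Definition Clog (z : C) : C := (ln (Cmod z), Arg z).

Definition Cpower (z s : C) : C := Cexp (s * Clog z).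

(* f(s) = sum_{k >= -N} a_k (s - s0)^k on a punctured neighbourhood of s0, for
   some N, with a_k = 0 for k < -N; such an [a] is unique when it exists. *)
Definition laurent_expansion (f : C -> C) (s0 : C) (a : Z -> C) : Prop :=
  exists N : nat,
    (forall k : Z, (k < - Z.of_nat N)%Z -> a k = RtoC 0) /\
    locally' s0 (fun s : C =>
      is_series
        (fun j : nat =>
           a (Z.of_nat j - Z.of_nat N)%Z * ((s - s0) ^ j / (s - s0) ^ N))
        (f s)).

Definition laurent_coeff (f : C -> C) (s0 : C) : Z -> C :=
  epsilon (inhabits (fun _ : Z => RtoC 0)) (laurent_expansion f s0).

(* The value of the total function [f] is unconstrained at a pole; elsewhere it
   must be the regular value. *)
Definition meromorphic (f : C -> C) : Prop :=
  forall s0 : C, exists a : Z -> C,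
    laurent_expansion f s0 a /\
    ((forall k : Z, (k < 0)%Z -> a k = RtoC 0) -> f s0 = a 0%Z).

Definition hurwitz_continuation (w : C) (zeta : C -> C) : Prop :=
  meromorphic zeta /\
  forall s : C, (1 < Re s)%R ->
    is_series (fun k : nat => Cpower (INR k + w) (- s)) (zeta s).

(* For Re w > 0 the continuation exists, and it is unique except for its
   (irrelevant) value at the pole s = 1. *)
Definition hurwitz_zeta (s w : C) : C :=
  epsilon (inhabits (fun _ : C => RtoC 0)) (hurwitz_continuation w) s.

Definition hurwitz_zeta' (s w : C) : C :=
  C_derive (fun s' : C => hurwitz_zeta s' w) s.

Definition harmonic (l : nat) : R := sum_n_m (fun k : nat => (/ INR k)%R) 1 l.

Definition b_coeff (k : Z) : C := laurent_coeff (fun t : C => 1 / (1 - Cexp (- t))) 0 k.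

Definition b_poly (k : Z) (w : C) : C :=
  laurent_coeff (fun t : C => Cexp (- (w * t)) / (1 - Cexp (- t))) 0 k.

Definition r_hat (n : nat) (w : C) : C :=
  sum_n_m (fun l : nat =>
      b_coeff (Z.of_nat n - Z.of_nat l)
      * (RtoC (-1) ^ l / INR (fact l)) * w ^ l * harmonic l) 1 (n + 1)
  + sum_n_m (fun l : nat =>
      b_coeff (Z.of_nat n - Z.of_nat l)
      * (RtoC (-1) ^ (l + 1) / INR (fact l)) * w ^ l) 0 (n + 1)
    * Clog w.

(* sum_{k=-1}^{n} b_k t^k *)
Definition b_partial_sum (n : nat) (t : C) : C :=
  sum_n (fun j : nat => b_coeff (Z.of_nat j - 1) * (t ^ j / t)) (n + 1).

(* The field generated over Q by the functions satisfying [gens].  A meromorphic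
   function is represented by total functions that agree with it off a closed
   discrete set, which affects no integral below.  As [/ 0 = 0] the inverse
   needs no side condition: a function representing zero is sent to one
   representing zero. *)
Inductive generated_field (gens : (C -> C) -> Prop) : (C -> C) -> Prop :=
| gen_rat (q : Q) : generated_field gens (fun _ => RtoC (Q2R q))
| gen_in (f : C -> C) : gens f -> generated_field gens f
| gen_add (f g : C -> C) :
    generated_field gens f -> generated_field gens g ->
    generated_field gens (fun t => f t + g t)
| gen_opp (f : C -> C) :
    generated_field gens f -> generated_field gens (fun t => - f t)
| gen_mul (f g : C -> C) :
    generated_field gens f -> generated_field gens g ->
    generated_field gens (fun t => f t * g t)
| gen_inv (f : C -> C) :
    generated_field gens f -> generated_field gens (fun t => / f t).

(* Q(t, e^{-t}, w, e^{-wt}) *)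
Definition Q_t_w (w : C) : (C -> C) -> Prop :=
  generated_field (fun g =>
    In g ((fun t => t) :: (fun t => Cexp (- t)) ::
          (fun _ => w) :: (fun t => Cexp (- (w * t))) :: nil)).

(* Improper Riemann integrals over (0, +oo) of complex-valued functions. *)
Definition is_Cint_0_infty (f : R -> C) (z : C) : Prop :=
  is_RInt_gen (V := C_R_CompleteNormedModule) f
    (at_right 0) (Rbar_locally p_infty) z.

Definition Cint_0_infty (f : R -> C) : C :=
  RInt_gen (V := C_R_CompleteNormedModule) f
    (at_right 0) (Rbar_locally p_infty).

Definition exponential_period (F : (C -> C) -> Prop) (z : C) : Prop :=
  exists f : C -> C, F f /\ is_Cint_0_infty (fun t : R => f (RtoC t)) z.

Definition integrand (n : nat) (w : C) (t : R) : C :=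
  1 / RtoC t ^ n * (1 / (1 - Cexp (- t)) - b_partial_sum n t)
  * (Cexp (- (w * t)) / t).

(* Main.v *)
(* With beta_j = b_(j-1), the Euler-Maclaurin sums H_N(s,x) = sum_(j<N) beta_j (s)_j x^(-s-j) make
   the remainder s x^(-s-1) - H_N(s,x) + H_N(s,x+1) of order x^(-s-N); summing it over x = w, w+1, ...
   continues s zeta(s+1,w) to an entire function of s, and Cauchy estimates for the summands show that
   the series may be differentiated termwise.  Near s = -n-1 the s-derivative of the remainder equals,
   up to a factor (-1)^(n+1) (n+1)! and telescoping terms that vanish at infinity, I(x) - I(x+1), where
   I(x) is the integral of the theorem with w = x.  This is checked by evaluating the integral
   of t^(-l-1) e^(-at), regularized at 0, by parts down to Frullani's integral for log a.  As
   I(w+k) -> 0, the whole sum telescopes to I(w).  The period representation then writes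
   log w as Frullani's integral and 1 as the integral of e^(-t). *)

Require Import Defs.
From Stdlib Require Import Lra Lia Psatz FunctionalExtensionality.

Local Open Scope C_scope.

(** * Complex sums, series and derivatives *)

(** The complex analysis rests on power series alone: a function is entire when its Taylor series at
    each point converges everywhere, and no contour integral occurs. The factor s in s zeta(s+1, w)
    removes the pole; the value 1 at s = 0 is its residue. As [hurwitz_zeta] is an [epsilon] choice,
    known only by its defining property, an identity theorem for meromorphic functions must precede
    any formula for it. The obstacle is a mismatch of orders. Termwise differentiation needs a
    remainder summable on a whole disc, hence an order N with Re s + N >= 3, which means n + 4 at s
    = -n-1; but the closed form of the remainder belongs to order n + 2. The two extra terms have
    (s)_j = 0 there, so their derivatives carry no logarithm, tend to 0 at infinity and telescope
    away. The integrals of single terms t^(-l-1) e^(-at) diverge at 0; subtracting the polar part,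
    with the residue carried by e^(-t)/t, makes them converge, and these corrections cancel in I(x)
    - I(x+1). *)

Lemma C_ext (x y : C) : Re x = Re y -> Im x = Im y -> x = y.
Proof. destruct x, y; simpl; intros; subst; reflexivity. Qed.

Lemma Re_plus (x y : C) : Re (x + y) = (Re x + Re y)%R. Proof. reflexivity. Qed.
Lemma Im_plus (x y : C) : Im (x + y) = (Im x + Im y)%R. Proof. reflexivity. Qed.
Lemma Re_opp (x : C) : Re (- x) = (- Re x)%R. Proof. reflexivity. Qed.
Lemma Im_opp (x : C) : Im (- x) = (- Im x)%R. Proof. reflexivity. Qed.
Lemma Re_minus (x y : C) : Re (x - y) = (Re x - Re y)%R. Proof. reflexivity. Qed.
Lemma Im_minus (x y : C) : Im (x - y) = (Im x - Im y)%R. Proof. reflexivity. Qed.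

Lemma Rabs_Im_le_Cmod (x : C) : (Rabs (Im x) <= Cmod x)%R.
Proof.
  eapply Rle_trans; [ | apply Rmax_Cmod ]. apply Rmax_r.
Qed.

Lemma Cmod_le_Rabs (x : C) : (Cmod x <= Rabs (Re x) + Rabs (Im x))%R.
Proof.
  replace x with (RtoC (Re x) + Ci * RtoC (Im x)) at 1.
  - eapply Rle_trans; [ apply Cmod_triangle | ].
    rewrite Cmod_mult, Cmod_Ci, !Cmod_R. lra.
  - apply C_ext; unfold Re, Im; simpl; ring.
Qed.

Lemma Cmod_minus_sym (x y : C) : Cmod (x - y) = Cmod (y - x).
Proof. rewrite <- Cmod_opp. f_equal. ring. Qed.

Lemma Cmod_triangle_minus (x y : C) : (Cmod x - Cmod y <= Cmod (x - y))%R.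
Proof.
  assert (H := Cmod_triangle (x - y) y). replace (x - y + y) with x in H by ring. lra.
Qed.

Lemma Cmod_minus_le (x y : C) : (Cmod (x - y) <= Cmod x + Cmod y)%R.
Proof. unfold Cminus. rewrite <- (Cmod_opp y). apply Cmod_triangle. Qed.

Lemma Cmod_eq_0_small (x : C) : (forall eps, (0 < eps)%R -> (Cmod x <= eps)%R) -> x = 0.
Proof.
  intros H. apply Cmod_eq_0. apply Rle_antisym; [ | apply Cmod_ge_0 ].
  apply Rnot_lt_le. intros Hc. specialize (H (Cmod x / 2)%R). lra.
Qed.

Lemma Cminus_eq_0 (x y : C) : x - y = 0 -> x = y.
Proof. intros E. replace x with (x - y + y) by ring. rewrite E. ring. Qed.

Lemma Cminus_neq_0 (x y : C) : x <> y -> x - y <> 0.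
Proof. intros H E. exact (H (Cminus_eq_0 x y E)). Qed.

Lemma Cmod_RtoC_pos (t : R) : (0 <= t)%R -> Cmod (RtoC t) = t.
Proof. intros Ht. rewrite Cmod_R. apply Rabs_pos_eq, Ht. Qed.

Lemma RtoC_neq_0 (t : R) : (0 < t)%R -> RtoC t <> 0.
Proof. intros Ht E. apply RtoC_inj in E. lra. Qed.

Lemma locally_Cmod (x : C) (P : C -> Prop) :
  locally x P <-> exists d, (0 < d)%R /\ forall y, (Cmod (y - x) < d)%R -> P y.
Proof.
  split.
  - intros H. apply (locally_norm_le_locally (V := C_NormedModule)) in H.
    destruct H as [d Hd]. exists d. split; [ apply cond_pos | ].
    intros y Hy. apply Hd. exact Hy.
  - intros [d [Hd H]]. apply (locally_le_locally_norm (V := C_NormedModule)).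
    exists (mkposreal d Hd). intros y Hy. apply H. exact Hy.
Qed.

Lemma locally'_Cmod (x : C) (P : C -> Prop) :
  locally' x P <->
  exists d, (0 < d)%R /\ forall y, (Cmod (y - x) < d)%R -> y <> x -> P y.
Proof.
  unfold locally', within. rewrite locally_Cmod. reflexivity.
Qed.

(* [n] terms, unlike [sum_n u n], which has [n + 1] *)
Fixpoint csum (u : nat -> C) (n : nat) : C :=
  match n with O => 0 | S m => csum u m + u m end.

Lemma csum_sum_n (u : nat -> C) (n : nat) : sum_n u n = csum u (S n).
Proof.
  induction n as [ | n IH ].
  - rewrite sum_O. simpl. ring.
  - rewrite sum_Sn, IH. reflexivity.
Qed.

Lemma csum_ext (u v : nat -> C) (n : nat) :
  (forall k, (k < n)%nat -> u k = v k) -> csum u n = csum v n.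
Proof.
  induction n as [ | n IH ]; intros H; simpl; [ reflexivity | ].
  rewrite IH, H; auto.
Qed.

Lemma csum_plus (u v : nat -> C) (n : nat) :
  csum (fun k => u k + v k) n = csum u n + csum v n.
Proof. induction n as [ | n IH ]; simpl; [ | rewrite IH ]; ring. Qed.

Lemma csum_minus (u v : nat -> C) (n : nat) :
  csum (fun k => u k - v k) n = csum u n - csum v n.
Proof. induction n as [ | n IH ]; simpl; [ | rewrite IH ]; ring. Qed.

Lemma csum_mult_l (a : C) (u : nat -> C) (n : nat) :
  csum (fun k => a * u k) n = a * csum u n.
Proof. induction n as [ | n IH ]; simpl; [ | rewrite IH ]; ring. Qed.

Lemma csum_mult_r (a : C) (u : nat -> C) (n : nat) :
  csum (fun k => u k * a) n = csum u n * a.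
Proof. induction n as [ | n IH ]; simpl; [ | rewrite IH ]; ring. Qed.

Lemma csum_zero (u : nat -> C) (n : nat) :
  (forall k, (k < n)%nat -> u k = 0) -> csum u n = 0.
Proof.
  induction n as [ | n IH ]; intros H; simpl; [ reflexivity | ].
  rewrite IH, H; auto. ring.
Qed.

Lemma csum_shift (u : nat -> C) (n : nat) :
  csum u (S n) = u O + csum (fun k => u (S k)) n.
Proof. induction n as [ | n IH ]; [ simpl; ring | ]. simpl in *. rewrite IH. ring. Qed.

Lemma csum_split (u : nat -> C) (n m : nat) :
  csum u (n + m) = csum u n + csum (fun k => u (n + k)%nat) m.
Proof.
  induction m as [ | m IH ].
  - rewrite Nat.add_0_r. simpl. ring.
  - rewrite Nat.add_succ_r. simpl. rewrite IH. ring.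
Qed.

Lemma csum_rev (u : nat -> C) (n : nat) :
  csum u n = csum (fun k => u (n - 1 - k)%nat) n.
Proof.
  induction n as [ | n IH ]; [ reflexivity | ].
  rewrite (csum_shift (fun k => u (S n - 1 - k)%nat)).
  simpl csum at 1. rewrite IH. replace (S n - 1 - 0)%nat with n by lia.
  rewrite Cplus_comm. f_equal. apply csum_ext. intros k Hk. f_equal. lia.
Qed.

Lemma csum_telescope (u : nat -> C) (n : nat) :
  csum (fun k => u k - u (S k)) n = u O - u n.
Proof. induction n as [ | n IH ]; simpl; [ | rewrite IH ]; ring. Qed.

Lemma csum_exchange (u : nat -> nat -> C) (n m : nat) :
  csum (fun i => csum (fun j => u i j) m) n = csum (fun j => csum (fun i => u i j) n) m.
Proof.
  induction n as [ | n IH ]; simpl.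
  - symmetry. apply csum_zero. reflexivity.
  - rewrite IH, <- csum_plus. reflexivity.
Qed.

Lemma csum_single (u : nat -> C) (n i : nat) :
  (i < n)%nat -> (forall k, (k < n)%nat -> k <> i -> u k = 0) -> csum u n = u i.
Proof.
  induction n as [ | n IH ]; intros Hi H; [ lia | ]. simpl.
  destruct (Nat.eq_dec i n) as [ -> | Hne ].
  - rewrite csum_zero; [ ring | ]. intros k Hk. apply H; lia.
  - rewrite IH; [ | lia | ]. 2: intros k Hk; apply H; lia.
    rewrite (H n); [ ring | lia | lia ].
Qed.

Lemma Cmod_csum_const (u : nat -> C) (n : nat) (B : R) :
  (forall k, (k < n)%nat -> (Cmod (u k) <= B)%R) -> (Cmod (csum u n) <= INR n * B)%R.
Proof.
  induction n as [ | n IH ]; intros H.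
  - simpl. rewrite Cmod_0. lra.
  - rewrite S_INR. simpl. eapply Rle_trans; [ apply Cmod_triangle | ].
    assert (H1 := H n (Nat.lt_succ_diag_r n)). assert (H2 := IH (fun k Hk => H k (Nat.lt_lt_succ_r _ _ Hk))).
    lra.
Qed.

Lemma is_series_Cmod (u : nat -> C) (l : C) :
  is_series u l <->
  forall eps, (0 < eps)%R -> exists N, forall n, (N <= n)%nat -> (Cmod (csum u n - l) < eps)%R.
Proof.
  unfold is_series.
  rewrite (filterlim_locally_ball_norm (U := C_NormedModule)).
  split.
  - intros H eps Heps. destruct (H (mkposreal eps Heps)) as [N HN].
    exists (S N). intros n Hn. destruct n as [ | n ]; [ lia | ].
    rewrite <- csum_sum_n. apply HN. lia.
  - intros H eps. destruct (H eps (cond_pos eps)) as [N HN].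
    exists N. intros n Hn. unfold ball_norm. rewrite csum_sum_n. apply HN. lia.
Qed.

Lemma is_series_C_unique (u : nat -> C) (l l' : C) :
  is_series u l -> is_series u l' -> l = l'.
Proof.
  intros H H'. rewrite is_series_Cmod in H, H'.
  apply Cminus_eq_0, Cmod_eq_0_small. intros eps Heps.
  destruct (H (eps / 2)%R) as [N HN]; [ lra | ].
  destruct (H' (eps / 2)%R) as [N' HN']; [ lra | ].
  specialize (HN (N + N')%nat ltac:(lia)). specialize (HN' (N + N')%nat ltac:(lia)).
  replace (l - l') with ((csum u (N + N') - l') - (csum u (N + N') - l)) by ring.
  eapply Rle_trans; [ apply Cmod_minus_le | ]. lra.
Qed.

Lemma is_series_Cmod_bound (u : nat -> C) (l : C) (a : nat -> R) (A : R) :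
  is_series u l -> is_series a A -> (forall n, (Cmod (u n) <= a n)%R) -> (Cmod l <= A)%R.
Proof.
  intros Hu Ha Hle.
  assert (Hpart : forall n, (Cmod (csum u (S n)) <= sum_n a n)%R).
  { induction n as [ | n IH ].
    - rewrite sum_O. simpl. rewrite Cplus_0_l. apply Hle.
    - rewrite sum_Sn. change (csum u (S (S n))) with (csum u (S n) + u (S n)).
      eapply Rle_trans; [ apply Cmod_triangle | ].
      apply Rplus_le_compat; [ exact IH | apply Hle ]. }
  apply Rnot_lt_le. intros Hc. rewrite is_series_Cmod in Hu.
  destruct (Hu ((Cmod l - A) / 2)%R) as [N HN]; [ lra | ].
  assert (Ha' : is_lim_seq (sum_n a) A) by exact Ha.
  rewrite <- is_lim_seq_spec in Ha'.
  destruct (Ha' (mkposreal ((Cmod l - A) / 2) ltac:(lra))) as [M HM]. simpl in HM.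
  specialize (HN (S (N + M)) ltac:(lia)). specialize (HM (N + M)%nat ltac:(lia)).
  specialize (Hpart (N + M)%nat). apply Rabs_def2 in HM.
  assert (T := Cmod_triangle_minus l (csum u (S (N + M)))).
  rewrite Cmod_minus_sym in T. lra.
Qed.

Lemma ex_series_Cmod (u : nat -> C) (a : nat -> R) :
  (forall n, (Cmod (u n) <= a n)%R) -> ex_series a -> exists l : C, is_series u l.
Proof.
  intros H Ha. destruct (ex_series_le (V := C_CompleteNormedModule) u a) as [l Hl].
  - exact H.
  - exact Ha.
  - exists l. exact Hl.
Qed.

Lemma is_series_Cplus (u v : nat -> C) (a b : C) :
  is_series u a -> is_series v b -> is_series (fun k => u k + v k) (a + b).
Proof. exact (is_series_plus u v a b). Qed.

Lemma is_series_Cminus (u v : nat -> C) (a b : C) :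
  is_series u a -> is_series v b -> is_series (fun k => u k - v k) (a - b).
Proof. exact (is_series_minus u v a b). Qed.

Lemma is_series_Cscal (c : C) (u : nat -> C) (a : C) :
  is_series u a -> is_series (fun k => c * u k) (c * a).
Proof. exact (is_series_scal c u a). Qed.

Lemma is_series_Cext (u v : nat -> C) (l l' : C) :
  (forall n, u n = v n) -> l = l' -> is_series u l -> is_series v l'.
Proof. intros H -> Hu. exact (is_series_ext u v l' H Hu). Qed.

Lemma is_series_finite (u : nat -> C) (n : nat) :
  (forall k, (n <= k)%nat -> u k = 0) -> is_series u (csum u n).
Proof.
  intros H. apply is_series_Cmod. intros eps Heps. exists n. intros m Hm.
  replace m with (n + (m - n))%nat by lia. rewrite csum_split.
  rewrite (csum_zero (fun k => u (n + k)%nat)).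
  - replace (csum u n + 0 - csum u n) with (RtoC 0) by ring. rewrite Cmod_0. exact Heps.
  - intros k _. apply H. lia.
Qed.

Lemma is_series_csum (u : nat -> nat -> C) (l : nat -> C) (n : nat) :
  (forall i, (i < n)%nat -> is_series (fun k => u i k) (l i)) ->
  is_series (fun k => csum (fun i => u i k) n) (csum l n).
Proof.
  induction n as [ | n IH ]; intros H; simpl.
  - apply (is_series_finite (fun _ => RtoC 0) 0). reflexivity.
  - apply is_series_Cplus; [ apply IH; intros; apply H; lia | apply H; lia ].
Qed.

Lemma is_series_shift (u : nat -> C) (l : C) (n : nat) :
  is_series u l -> is_series (fun k => u (n + k)%nat) (l - csum u n).
Proof.
  intros H. rewrite is_series_Cmod in *. intros eps Heps.
  destruct (H eps Heps) as [N HN]. exists N. intros m Hm.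
  specialize (HN (n + m)%nat ltac:(lia)). rewrite csum_split in HN.
  replace (csum (fun k => u (n + k)%nat) m - (l - csum u n))
    with (csum u n + csum (fun k => u (n + k)%nat) m - l) by ring. exact HN.
Qed.

Lemma is_series_unshift (u : nat -> C) (l : C) (n : nat) :
  is_series (fun k => u (n + k)%nat) (l - csum u n) -> is_series u l.
Proof.
  intros H. rewrite is_series_Cmod in *. intros eps Heps.
  destruct (H eps Heps) as [N HN]. exists (n + N)%nat. intros m Hm.
  specialize (HN (m - n)%nat ltac:(lia)).
  replace m with (n + (m - n))%nat by lia. rewrite csum_split.
  replace (csum u n + csum (fun k => u (n + k)%nat) (m - n) - l)
    with (csum (fun k => u (n + k)%nat) (m - n) - (l - csum u n)) by ring. exact HN.
Qed.

Lemma is_series_telescope (g : nat -> C) :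
  (forall eps, (0 < eps)%R -> exists N, forall n, (N <= n)%nat -> (Cmod (g n) < eps)%R) ->
  is_series (fun k => g k - g (S k)) (g O).
Proof.
  intros H. apply is_series_Cmod. intros eps Heps. destruct (H eps Heps) as [N HN].
  exists N. intros n Hn. rewrite csum_telescope.
  replace (g O - g n - g O) with (- g n) by ring. rewrite Cmod_opp. auto.
Qed.

Lemma is_series_terms_bounded (u : nat -> C) (l : C) :
  is_series u l -> exists B, (0 < B)%R /\ forall n, (Cmod (u n) <= B)%R.
Proof.
  intros H. rewrite is_series_Cmod in H. destruct (H 1%R Rlt_0_1) as [N HN].
  assert (Hf : forall m, exists B, (0 < B)%R /\ forall n, (n < m)%nat -> (Cmod (u n) <= B)%R).
  { induction m as [ | m [B [HB IH]] ].
    - exists 1%R. split; [ lra | lia ].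
    - exists (B + Cmod (u m))%R. assert (Hp := Cmod_ge_0 (u m)). split; [ lra | ].
      intros n Hn. destruct (Nat.eq_dec n m) as [ -> | Hne ]; [ lra | ].
      specialize (IH n ltac:(lia)). lra. }
  destruct (Hf N) as [B [HB HBN]]. exists (B + 2)%R. split; [ lra | ].
  intros n. destruct (Nat.lt_ge_cases n N) as [Hlt | Hge].
  - specialize (HBN n Hlt). lra.
  - assert (H1 := HN n Hge). assert (H2 := HN (S n) ltac:(lia)). simpl in H2.
    replace (u n) with ((csum u n + u n - l) - (csum u n - l)) by ring.
    eapply Rle_trans; [ apply Cmod_minus_le | ]. lra.
Qed.

(** Componentwise, so that the real rules of differentiation, the mean value theorem and continuity
    apply to each coordinate. *)
Definition is_Rderive (f : R -> C) (t : R) (l : C) : Prop :=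
  is_derive (fun x => Re (f x)) t (Re l) /\ is_derive (fun x => Im (f x)) t (Im l).

Lemma is_Rderive_const (a : C) (t : R) : is_Rderive (fun _ => a) t 0.
Proof. split; apply (is_derive_const (K := R_AbsRing) (V := R_NormedModule)). Qed.

Lemma is_Rderive_RtoC (f : R -> R) (t l : R) :
  is_derive f t l -> is_Rderive (fun x => RtoC (f x)) t (RtoC l).
Proof.
  intros H. split; [ exact H | ].
  apply (is_derive_const (K := R_AbsRing) (V := R_NormedModule) 0%R).
Qed.

Lemma is_Rderive_id (t : R) : is_Rderive (fun x => RtoC x) t 1.
Proof. apply is_Rderive_RtoC. apply (is_derive_id (K := R_AbsRing)). Qed.

Lemma is_Rderive_plus (f g : R -> C) (t : R) (a b : C) :
  is_Rderive f t a -> is_Rderive g t b -> is_Rderive (fun x => f x + g x) t (a + b).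
Proof.
  intros [H1 H2] [H3 H4]. split.
  - exact (is_derive_plus _ _ t _ _ H1 H3).
  - exact (is_derive_plus _ _ t _ _ H2 H4).
Qed.

Lemma is_Rderive_minus (f g : R -> C) (t : R) (a b : C) :
  is_Rderive f t a -> is_Rderive g t b -> is_Rderive (fun x => f x - g x) t (a - b).
Proof.
  intros [H1 H2] [H3 H4]. split.
  - exact (is_derive_minus _ _ t _ _ H1 H3).
  - exact (is_derive_minus _ _ t _ _ H2 H4).
Qed.

Lemma is_Rderive_eq (f : R -> C) (t : R) (a b : C) :
  a = b -> is_Rderive f t a -> is_Rderive f t b.
Proof. intros ->; auto. Qed.

Lemma is_Rderive_ext (f g : R -> C) (t : R) (a : C) :
  (forall x, f x = g x) -> is_Rderive f t a -> is_Rderive g t a.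
Proof.
  intros H [H1 H2]. split.
  - refine (is_derive_ext _ _ _ _ _ H1). intros x. rewrite H. reflexivity.
  - refine (is_derive_ext _ _ _ _ _ H2). intros x. rewrite H. reflexivity.
Qed.

Lemma is_Rderive_mult (f g : R -> C) (t : R) (a b : C) :
  is_Rderive f t a -> is_Rderive g t b ->
  is_Rderive (fun x => f x * g x) t (a * g t + f t * b).
Proof.
  intros [H1 H2] [H3 H4].
  assert (M := fun u v a b Hu Hv => is_derive_mult (K := R_AbsRing) u v t a b Hu Hv Rmult_comm).
  split.
  - replace (Re (a * g t + f t * b)) with
      ((Re a * Re (g t) + Re (f t) * Re b) - (Im a * Im (g t) + Im (f t) * Im b))%R
      by (unfold Re, Im; simpl; ring).
    exact (is_derive_minus _ _ t _ _ (M _ _ _ _ H1 H3) (M _ _ _ _ H2 H4)).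
  - replace (Im (a * g t + f t * b)) with
      ((Re a * Im (g t) + Re (f t) * Im b) + (Im a * Re (g t) + Im (f t) * Re b))%R
      by (unfold Re, Im; simpl; ring).
    exact (is_derive_plus _ _ t _ _ (M _ _ _ _ H1 H4) (M _ _ _ _ H2 H3)).
Qed.

Lemma is_Rderive_scal (c : C) (f : R -> C) (t : R) (a : C) :
  is_Rderive f t a -> is_Rderive (fun x => c * f x) t (c * a).
Proof.
  intros H. eapply is_Rderive_eq; [ | exact (is_Rderive_mult _ _ t _ _ (is_Rderive_const c t) H) ].
  cbv beta. ring.
Qed.

Lemma is_Rderive_csum (f : nat -> R -> C) (t : R) (a : nat -> C) (n : nat) :
  (forall k, (k < n)%nat -> is_Rderive (f k) t (a k)) ->
  is_Rderive (fun x => csum (fun k => f k x) n) t (csum a n).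
Proof.
  induction n as [ | n IH ]; intros H; simpl.
  - apply is_Rderive_const.
  - apply is_Rderive_plus; [ apply IH; intros; apply H; lia | apply H; lia ].
Qed.

Lemma is_Rderive_pow (f : R -> C) (t : R) (a : C) (n : nat) :
  is_Rderive f t a -> is_Rderive (fun x => f x ^ S n) t (INR (S n) * f t ^ n * a).
Proof.
  intros H. induction n as [ | n IH ].
  - apply (is_Rderive_ext f); [ intros; simpl; ring | ].
    refine (is_Rderive_eq _ _ _ _ _ H). simpl. ring.
  - apply (is_Rderive_ext (fun x => f x * f x ^ S n)); [ reflexivity | ].
    refine (is_Rderive_eq _ _ _ _ _ (is_Rderive_mult _ _ _ _ _ H IH)).
    rewrite (S_INR (S n)), RtoC_plus, !Cpow_S. ring.
Qed.

(** The squared modulus enters the derivative of both the inverse and the logarithm. *)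
Lemma is_derive_norm2 (u v : R -> R) (t a b : R) :
  is_derive u t a -> is_derive v t b ->
  is_derive (fun x => u x ^ 2 + v x ^ 2)%R t (2 * (a * u t + b * v t))%R.
Proof.
  intros Hu Hv. auto_derive.
  - repeat split; [ exists a; exact Hu | exists b; exact Hv ].
  - replace (Derive (fun x : R => u x) t) with a by (symmetry; apply is_derive_unique, Hu).
    replace (Derive (fun x : R => v x) t) with b by (symmetry; apply is_derive_unique, Hv). ring.
Qed.

Lemma is_Rderive_inv (f : R -> C) (t : R) (a : C) :
  is_Rderive f t a -> f t <> 0 -> is_Rderive (fun x => / f x) t (- a / (f t * f t)).
Proof.
  intros [H1 H2] Hne. apply Cmod_gt_0 in Hne.
  assert (Hn : (Re (f t) ^ 2 + Im (f t) ^ 2)%R <> 0%R).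
  { rewrite <- Cmod2_alt. apply Rgt_not_eq, pow_lt, Hne. }
  assert (HD := is_derive_norm2 _ _ t _ _ H1 H2).
  assert (Hq := fun u l Hu => is_derive_div u _ t l _ Hu HD Hn).
  split.
  - assert (H := Hq (fun x => Re (f x)) (Re a) H1).
    match type of H with is_derive _ _ ?l => replace (Re (- a / (f t * f t))) with l end; [ exact H | ].
    unfold Cdiv, Cinv, Cmult, Copp, Re, Im in *; cbn [fst snd]; field. simpl in Hn |- *.
    repeat split; intros E; apply Hn; nra.
  - assert (H := Hq (fun x => - Im (f x))%R (- Im a)%R (is_derive_opp _ _ _ H2)).
    match type of H with is_derive _ _ ?l => replace (Im (- a / (f t * f t))) with l end; [ exact H | ].
    unfold Cdiv, Cinv, Cmult, Copp, Re, Im in *; cbn [fst snd]; field. simpl in Hn |- *.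
    repeat split; intros E; apply Hn; nra.
Qed.

Lemma real_MVT_bound (f df : R -> R) (a b M : R) :
  (a <= b)%R -> (forall t, (a <= t <= b)%R -> is_derive f t (df t)) ->
  (forall t, (a <= t <= b)%R -> (Rabs (df t) <= M)%R) ->
  (Rabs (f b - f a) <= M * (b - a))%R.
Proof.
  intros Hab Hd HM.
  destruct (MVT_gen f a b df) as [c [Hc E]].
  - intros x. rewrite Rmin_left, Rmax_right by lra. intros Hx. apply Hd. lra.
  - intros x. rewrite Rmin_left, Rmax_right by lra. intros Hx.
    apply continuity_pt_filterlim. apply (ex_derive_continuous (V := R_NormedModule)).
    exists (df x). apply Hd. lra.
  - rewrite Rmin_left, Rmax_right in Hc by lra.
    rewrite E, Rabs_mult, (Rabs_pos_eq (b - a)) by lra.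
    apply Rmult_le_compat_r; [ lra | auto ].
Qed.

(** The mean value theorem fails for complex values; applying it to the real and the imaginary part
    separately costs the factor 2. *)
Lemma is_Rderive_bound (f df : R -> C) (a b M : R) :
  (a <= b)%R -> (forall t, (a <= t <= b)%R -> is_Rderive f t (df t)) ->
  (forall t, (a <= t <= b)%R -> (Cmod (df t) <= M)%R) ->
  (Cmod (f b - f a) <= 2 * M * (b - a))%R.
Proof.
  intros Hab Hd HM.
  eapply Rle_trans; [ apply Cmod_le_Rabs | ].
  rewrite Re_minus, Im_minus.
  assert (H1 := real_MVT_bound (fun t => Re (f t)) (fun t => Re (df t)) a b M Hab
    (fun t Ht => proj1 (Hd t Ht))
    (fun t Ht => Rle_trans _ _ _ (re_le_Cmod (df t)) (HM t Ht))).
  assert (H2 := real_MVT_bound (fun t => Im (f t)) (fun t => Im (df t)) a b M Hab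
    (fun t Ht => proj2 (Hd t Ht))
    (fun t Ht => Rle_trans _ _ _ (Rabs_Im_le_Cmod (df t)) (HM t Ht))).
  simpl in H1, H2. lra.
Qed.

(** * Complex exponential, logarithm and powers *)

Lemma exp_le_compat (x y : R) : (x <= y)%R -> (exp x <= exp y)%R.
Proof. intros [H | ->]; [ left; apply exp_increasing; exact H | right; reflexivity ]. Qed.

Lemma exp_opp_le_inv (x : R) : (0 < x)%R -> (exp (- x) <= / x)%R.
Proof.
  intros Hx. rewrite exp_Ropp. apply Rinv_le_contravar; [ exact Hx | ].
  assert (P := exp_ineq1 x ltac:(lra)). lra.
Qed.

Lemma Cexp_plus (x y : C) : Cexp (x + y) = Cexp x * Cexp y.
Proof.
  unfold Cexp. rewrite Re_plus, Im_plus, exp_plus, cos_plus, sin_plus.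
  apply C_ext; unfold Re, Im; simpl; ring.
Qed.

Lemma Cexp_RtoC (x : R) : Cexp (RtoC x) = RtoC (exp x).
Proof.
  unfold Cexp. simpl. rewrite cos_0, sin_0. apply C_ext; unfold Re, Im; simpl; ring.
Qed.

Lemma Cexp_0 : Cexp 0 = 1.
Proof. rewrite Cexp_RtoC, exp_0. reflexivity. Qed.

Lemma Cmod_Cexp (x : C) : Cmod (Cexp x) = exp (Re x).
Proof.
  unfold Cexp, Cmod. cbn [fst snd].
  replace ((exp (Re x) * cos (Im x)) ^ 2 + (exp (Re x) * sin (Im x)) ^ 2)%R
    with (exp (Re x) ^ 2)%R.
  - apply sqrt_pow2. left. apply exp_pos.
  - assert (H := sin2_cos2 (Im x)). unfold Rsqr in H.
    replace (exp (Re x) ^ 2)%R with (exp (Re x) ^ 2 * (sin (Im x) * sin (Im x) + cos (Im x) * cos (Im x)))%R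
      by (rewrite H; ring). ring.
Qed.

Lemma Cmod_Cexp_lin (a : C) (t : R) : Cmod (Cexp (- (a * RtoC t))) = exp (- (Re a * t)).
Proof. rewrite Cmod_Cexp. f_equal. unfold Re; simpl; ring. Qed.

Lemma Cexp_pow (x : C) (n : nat) : Cexp (INR n * x) = Cexp x ^ n.
Proof.
  induction n as [ | n IH ].
  - simpl. replace (0 * x) with (RtoC 0) by ring. apply Cexp_0.
  - rewrite S_INR, RtoC_plus, Cpow_S, <- IH, <- Cexp_plus. f_equal. ring.
Qed.

Lemma is_Rderive_Cexp (f : R -> C) (t : R) (a : C) :
  is_Rderive f t a -> is_Rderive (fun x => Cexp (f x)) t (a * Cexp (f t)).
Proof.
  intros [H1 H2].
  apply (is_Rderive_ext
    (fun x => RtoC (exp (Re (f x))) * (RtoC (cos (Im (f x))) + Ci * RtoC (sin (Im (f x)))))).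
  { intros x. unfold Cexp. apply C_ext; unfold Re, Im; simpl; ring. }
  assert (E1 : is_derive (fun x => exp (Re (f x))) t (Re a * exp (Re (f t)))%R).
  { apply (is_derive_comp exp (fun x => Re (f x))); [ apply is_derive_exp | exact H1 ]. }
  assert (E2 : is_derive (fun x => cos (Im (f x))) t (Im a * - sin (Im (f t)))%R).
  { apply (is_derive_comp cos (fun x => Im (f x))); [ apply is_derive_cos | exact H2 ]. }
  assert (E3 : is_derive (fun x => sin (Im (f x))) t (Im a * cos (Im (f t)))%R).
  { apply (is_derive_comp sin (fun x => Im (f x))); [ apply is_derive_sin | exact H2 ]. }
  eapply is_Rderive_eq; [ | apply is_Rderive_mult;
    [ apply is_Rderive_RtoC; exact E1
    | apply is_Rderive_plus;
      [ apply is_Rderive_RtoC; exact E2 | apply is_Rderive_scal, is_Rderive_RtoC; exact E3 ] ] ].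
  unfold Cexp. apply C_ext; unfold Re, Im; simpl; ring.
Qed.

Lemma exp_opp_lt_1 (x : R) : (0 < x)%R -> (exp (- x) < 1)%R.
Proof. intros Hx. rewrite <- exp_0. apply exp_increasing. lra. Qed.

Lemma Rpow_fact_small (a : R) : (0 <= a)%R ->
  forall eps, (0 < eps)%R -> exists N, forall n, (N <= n)%nat -> (a ^ n / INR (fact n) < eps)%R.
Proof.
  intros Ha eps Heps.
  destruct (cv_speed_pow_fact a eps Heps) as [N HN].
  exists N. intros n Hn. specialize (HN n Hn). unfold Rdist in HN.
  rewrite Rminus_0_r in HN. apply Rabs_def2 in HN. lra.
Qed.

Lemma INR_fact_C_neq_0 (n : nat) : RtoC (INR (fact n)) <> 0.
Proof. apply RtoC_neq_0, INR_fact_lt_0. Qed.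

Lemma INR_S_C_neq_0 (n : nat) : RtoC (INR (S n)) <> 0.
Proof. apply RtoC_neq_0, lt_0_INR, Nat.lt_0_succ. Qed.

Lemma RtoC_INR_fact_S (n : nat) : RtoC (INR (fact (S n))) = INR (S n) * INR (fact n).
Proof. rewrite <- RtoC_mult, <- mult_INR. reflexivity. Qed.

(* The Taylor polynomial of [exp] at [t z], evaluated at [z], has a telescoping derivative in [t];
   it runs from the partial sum of the exponential series at [t = 0] to [exp z] at [t = 1]. *)
Lemma Cexp_series (z : C) : is_series (fun j => / INR (fact j) * z ^ j) (Cexp z).
Proof.
  set (y := fun t : R => z * RtoC (1 - t)).
  set (g := fun n t => csum (fun j => / INR (fact j) * y t ^ j * Cexp (RtoC t * z)) n).
  set (dg := fun n t => / INR (fact n) * (z * y t ^ n) * Cexp (RtoC t * z)).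
  assert (Hexp : forall t, is_Rderive (fun t => Cexp (RtoC t * z)) t (z * Cexp (RtoC t * z))).
  { intros t. apply is_Rderive_Cexp.
    eapply is_Rderive_eq; [ | exact (is_Rderive_mult _ _ t _ _ (is_Rderive_id t) (is_Rderive_const z t)) ].
    cbv beta. ring. }
  assert (Hy : forall t, is_Rderive y t (z * RtoC (-1))).
  { intros t. apply is_Rderive_scal, is_Rderive_RtoC. auto_derive; [ trivial | ring ]. }
  assert (Hg : forall n t, is_Rderive (g (S n)) t (dg n t)).
  { induction n as [ | n IH ]; intros t.
    - unfold g, dg. apply (is_Rderive_ext (fun t => Cexp (RtoC t * z))).
      { intros x. simpl. field. }
      eapply is_Rderive_eq; [ | apply Hexp ]. simpl. field.
    - apply (is_Rderive_ext (fun t => g (S n) t + / INR (fact (S n)) * y t ^ S n * Cexp (RtoC t * z)));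
        [ reflexivity | ].
      eapply is_Rderive_eq; [ | apply is_Rderive_plus; [ apply IH
        | apply is_Rderive_mult; [ apply is_Rderive_scal, is_Rderive_pow, Hy | apply Hexp ] ] ].
      unfold dg. rewrite RtoC_INR_fact_S, !Cpow_S.
      field. split; [ apply INR_fact_C_neq_0 | apply INR_S_C_neq_0 ]. }
  apply is_series_Cmod. intros eps Heps. assert (Hz := Cmod_ge_0 z).
  set (K := (2 * Cmod z * exp (Cmod z))%R).
  assert (HK : (0 <= K)%R) by (unfold K; assert (H2 := exp_pos (Cmod z)); apply Rmult_le_pos; lra).
  destruct (Rpow_fact_small (Cmod z) Hz (eps / (K + 1))%R) as [N HN].
  { apply Rdiv_lt_0_compat; lra. }
  exists (S N). intros n Hn. destruct n as [ | n ]; [ lia | ]. specialize (HN n ltac:(lia)).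
  assert (F := Rinv_0_lt_compat _ (INR_fact_lt_0 n)).
  assert (B := is_Rderive_bound (g (S n)) (dg n) 0 1
    (/ INR (fact n) * (Cmod z * Cmod z ^ n) * exp (Cmod z))%R Rle_0_1 (fun t _ => Hg n t)).
  replace (g (S n) 1%R) with (Cexp z) in B.
  (* At t = 1 the base [y] is 0, so only the constant term survives. *)
  2: { unfold g, y. rewrite csum_shift, Rminus_diag, csum_zero.
    - simpl. replace (1 * z) with z by ring. field.
    - intros k _. rewrite !Cpow_S. ring. }
  replace (g (S n) 0%R) with (csum (fun j => / INR (fact j) * z ^ j) (S n)) in B.
  2: { unfold g, y. apply csum_ext. intros k _. rewrite Rminus_0_r, Cmult_1_r.
    replace (0 * z) with (RtoC 0) by ring. rewrite Cexp_0. ring. }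
  rewrite Cmod_minus_sym. eapply Rle_lt_trans; [ apply B | ].
  - intros t Ht. unfold dg, y. rewrite !Cmod_mult, Cmod_pow, Cmod_mult, Cmod_Cexp.
    rewrite Cmod_inv, !Cmod_RtoC_pos by (first [ apply pos_INR | apply INR_fact_C_neq_0 | lra ]).
    apply Rmult_le_compat; [ | left; apply exp_pos | | ].
    + repeat apply Rmult_le_pos; try lra. apply pow_le, Rmult_le_pos; lra.
    + apply Rmult_le_compat_l; [ lra | ]. apply Rmult_le_compat_l; [ exact Hz | ].
      apply pow_incr. split; [ apply Rmult_le_pos | ]; nra.
    + apply exp_le_compat. replace (Re (RtoC t * z)) with (t * Re z)%R by (unfold Re; simpl; ring).
      assert (H1 := Rle_trans _ _ _ (Rle_abs (Re z)) (re_le_Cmod z)). nra.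
  - replace (2 * (/ INR (fact n) * (Cmod z * Cmod z ^ n) * exp (Cmod z)) * (1 - 0))%R
      with (K * (Cmod z ^ n / INR (fact n)))%R by (unfold K; field; apply INR_fact_neq_0).
    apply Rle_lt_trans with (K * (eps / (K + 1)))%R.
    + apply Rmult_le_compat_l; lra.
    + replace (K * (eps / (K + 1)))%R with (eps - eps / (K + 1))%R by (field; lra).
      assert (0 < eps / (K + 1))%R by (apply Rdiv_lt_0_compat; lra). lra.
Qed.

Lemma Cmod_pos_of_Re (z : C) : (0 < Re z)%R -> (0 < Cmod z)%R.
Proof.
  intros H. eapply Rlt_le_trans; [ exact H | ].
  eapply Rle_trans; [ apply Rle_abs | apply re_le_Cmod ].
Qed.

Lemma neq_0_of_Re (z : C) : (0 < Re z)%R -> z <> 0.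
Proof. intros H. apply Cmod_gt_0, Cmod_pos_of_Re, H. Qed.

Lemma Cmod_sqr (z : C) : (Cmod z ^ 2 = Re z ^ 2 + Im z ^ 2)%R.
Proof. apply Cmod2_alt. Qed.

Lemma Cmod_eq_Re_sqrt (z : C) : (0 < Re z)%R ->
  (sqrt (1 + (Im z / Re z)²) = Cmod z / Re z)%R.
Proof.
  intros H. apply sqrt_lem_1.
  - assert (H1 := Rle_0_sqr (Im z / Re z)). lra.
  - apply Rdiv_le_0_compat; [ apply Cmod_ge_0 | exact H ].
  - replace (Cmod z / Re z * (Cmod z / Re z))%R with (Cmod z ^ 2 / Re z ^ 2)%R by (field; lra).
    rewrite Cmod_sqr. unfold Rsqr. field. lra.
Qed.

(** On the right half-plane the two branches of [Arg] merge into a single smooth formula; all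
    logarithms below are taken there. *)
Lemma Arg_atan (z : C) : (0 < Re z)%R -> Arg z = atan (Im z / Re z).
Proof.
  intros H. assert (Hm := Cmod_pos_of_Re z H).
  assert (Hb := atan_bound (Im z / Re z)). assert (Hpi := PI_RGT_0).
  assert (Hcos : (Re z / Cmod z = cos (atan (Im z / Re z)))%R).
  { rewrite cos_atan, Cmod_eq_Re_sqrt by exact H. field. split; lra. }
  unfold Arg. rewrite Hcos.
  destruct (Rle_dec 0 (Im z)) as [Hi | Hi].
  - apply acos_cos. split; [ | lra ].
    rewrite <- atan_0. assert (Hq : (0 <= Im z / Re z)%R) by (apply Rdiv_le_0_compat; lra).
    destruct Hq as [Hq | <-]; [ left; apply atan_increasing; exact Hq | right; reflexivity ].
  - rewrite <- cos_neg, acos_cos; [ ring | ].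
    rewrite <- atan_opp. split.
    + rewrite <- atan_0. left. apply atan_increasing.
      replace (- (Im z / Re z))%R with ((- Im z) / Re z)%R by (field; lra).
      apply Rdiv_lt_0_compat; lra.
    + assert (Hb' := atan_bound (- (Im z / Re z))). lra.
Qed.

(** The true bound is pi/2; the round constant 2 follows from pi <= 4. *)
Lemma Rabs_Arg (z : C) : (0 < Re z)%R -> (Rabs (Arg z) <= 2)%R.
Proof.
  intros H. rewrite Arg_atan by exact H.
  assert (Hb := atan_bound (Im z / Re z)). assert (Hpi := PI_4).
  apply Rabs_le. lra.
Qed.

Lemma Cexp_Clog (z : C) : (0 < Re z)%R -> Cexp (Clog z) = z.
Proof.
  intros H. assert (Hm := Cmod_pos_of_Re z H).
  unfold Cexp, Clog. cbn [Re Im fst snd]. rewrite Arg_atan, exp_ln by assumption.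
  rewrite cos_atan, sin_atan, Cmod_eq_Re_sqrt by exact H.
  apply C_ext; unfold Re, Im; cbn [fst snd]; unfold Re, Im in H; field; lra.
Qed.

Lemma Clog_1 : Clog 1 = 0.
Proof.
  unfold Clog. rewrite Arg_atan by (simpl; lra). rewrite Cmod_1, ln_1.
  simpl. unfold Rdiv. rewrite Rmult_0_l, atan_0. reflexivity.
Qed.

Lemma is_Rderive_Clog (f : R -> C) (t : R) (a : C) :
  is_Rderive f t a -> (0 < Re (f t))%R -> is_Rderive (fun x => Clog (f x)) t (a / f t).
Proof.
  intros [H1 H2] Hp.
  (* Both formulas used below hold only where the real part is positive, so that this condition is
     needed on a neighbourhood of [t]. *)
  assert (Hloc : locally t (fun x => 0 < Re (f x))%R).
  { assert (Hc := ex_derive_continuous (K := R_AbsRing) (V := R_NormedModule)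
      (fun x => Re (f x)) t (ex_intro _ _ H1)).
    apply (Hc (fun y => 0 < y)%R). apply (open_gt 0 (Re (f t)) Hp). }
  assert (Hm := Cmod_pos_of_Re _ Hp). assert (Hsq := Cmod_sqr (f t)).
  assert (Hpos : (0 < Re (f t) ^ 2 + Im (f t) ^ 2)%R) by (rewrite <- Hsq; apply pow_lt, Hm).
  assert (Hne := Rgt_not_eq _ _ Hpos).
  assert (Ea : a / f t = ((Re a * Re (f t) + Im a * Im (f t)) / (Re (f t) ^ 2 + Im (f t) ^ 2),
     (Im a * Re (f t) - Re a * Im (f t)) / (Re (f t) ^ 2 + Im (f t) ^ 2))%R).
  { apply C_ext; unfold Cdiv, Cinv, Cmult, Re, Im in *; cbn [fst snd]; field; exact Hne. }
  rewrite Ea. split.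
  (* Writing ln |f| as half of ln |f|^2 avoids differentiating the square root. *)
  - apply is_derive_ext_loc with (f := fun x => (/ 2 * ln (Re (f x) ^ 2 + Im (f x) ^ 2))%R).
    + revert Hloc. apply filter_imp. intros x Hx. unfold Clog. cbn [Re fst].
      rewrite <- Cmod_sqr, ln_pow by (apply Cmod_pos_of_Re, Hx). simpl. field.
    + assert (HD := is_derive_scal _ t (/ 2) _ (is_derive_comp ln _ t _ _
        (is_derive_ln _ Hpos) (is_derive_norm2 _ _ t _ _ H1 H2))).
      match type of HD with is_derive _ _ ?l =>
        match goal with |- is_derive _ _ ?r => replace r with l; [ exact HD | ] end end.
      unfold scal; simpl. unfold mult; simpl. simpl in Hpos. field. lra.
  - apply is_derive_ext_loc with (f := fun x => atan (Im (f x) / Re (f x))).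
    + revert Hloc. apply filter_imp. intros x Hx. unfold Clog. cbn [Im snd].
      symmetry. apply Arg_atan, Hx.
    + set (u := fun x => Re (f x)) in *. set (v := fun x => Im (f x)) in *.
      apply is_derive_ext with (f := fun x => atan (v x / u x)%R); [ reflexivity | ].
      assert (Hu : u t <> 0%R) by (unfold u; lra).
      assert (D : is_derive (fun x => (v x / u x)%R) t
        ((Im a * u t - v t * Re a) / (u t) ^ 2)%R).
      { apply (is_derive_div v u t (Im a) (Re a) H2 H1 Hu). }
      assert (DA := is_derive_comp atan (fun x => (v x / u x)%R) t _ _ (is_derive_atan _) D).
      cbn [Im snd].
      replace ((Im a * Re (f t) - Re a * Im (f t)) / (Re (f t) ^ 2 + Im (f t) ^ 2))%R
        with (scal ((Im a * u t - v t * Re a) / u t ^ 2) (/ (1 + (v t / u t)²)))%R.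
      * exact DA.
      * unfold scal; simpl. unfold mult; simpl. unfold u, v, Rsqr.
        simpl in Hne. field. repeat split; try exact Hne; try exact Hu; try lra.
        all: intro; apply Hne; lra.
Qed.

Lemma Cpower_plus (z s u : C) : Cpower z (s + u) = Cpower z s * Cpower z u.
Proof. unfold Cpower. rewrite <- Cexp_plus. f_equal. ring. Qed.

Lemma Cpower_0 (z : C) : Cpower z 0 = 1.
Proof. unfold Cpower. replace (0 * Clog z) with (RtoC 0) by ring. apply Cexp_0. Qed.

Lemma Cpower_INR (z : C) (n : nat) : (0 < Re z)%R -> Cpower z (INR n) = z ^ n.
Proof. intros H. unfold Cpower. rewrite Cexp_pow, Cexp_Clog by exact H. reflexivity. Qed.

Lemma Cpower_minus_1 (z s : C) : (0 < Re z)%R -> Cpower z (s - 1) = Cpower z s / z.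
Proof.
  intros H. assert (E := Cpower_plus z (s - 1) 1).
  replace (s - 1 + 1) with s in E by ring.
  rewrite E. change (RtoC 1) with (RtoC (INR 1)). rewrite (Cpower_INR z 1 H).
  field. apply neq_0_of_Re, H.
Qed.

Lemma is_Rderive_Cpower (f : R -> C) (t : R) (a s : C) :
  is_Rderive f t a -> (0 < Re (f t))%R ->
  is_Rderive (fun x => Cpower (f x) s) t (s * Cpower (f t) (s - 1) * a).
Proof.
  intros H Hp. unfold Cpower at 1.
  eapply is_Rderive_eq;
    [ | apply is_Rderive_Cexp, is_Rderive_scal, is_Rderive_Clog; [ exact H | exact Hp ] ].
  rewrite Cpower_minus_1 by exact Hp. unfold Cpower. field. apply neq_0_of_Re, Hp.
Qed.

(** The modulus is exp(Re s ln|z| - Im s Arg z), and the argument is bounded by 2. *)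
Lemma Cmod_Cpower_le (z s : C) : (0 < Re z)%R ->
  (Cmod (Cpower z s) <= exp (Re s * ln (Cmod z)) * exp (2 * Rabs (Im s)))%R.
Proof.
  intros H. unfold Cpower. rewrite Cmod_Cexp, <- exp_plus.
  assert (L : (Re (s * Clog z) <= Re s * ln (Cmod z) + 2 * Rabs (Im s))%R).
  { replace (Re (s * Clog z)) with (Re s * ln (Cmod z) - Im s * Arg z)%R
      by (unfold Re, Im; simpl; ring).
    assert (HA := Rabs_Arg z H).
    assert (HB : (Rabs (Im s * Arg z) <= 2 * Rabs (Im s))%R).
    { rewrite Rabs_mult. assert (P := Rabs_pos (Im s)). nra. }
    apply Rabs_le_between in HB. lra. }
  apply exp_le_compat, L.
Qed.

(** * Power series over C *)

Definition is_Cpseries (c : nat -> C) (h v : C) : Prop :=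
  is_series (fun j => c j * h ^ j)%C v.

Lemma is_Cpseries_ext (c d : nat -> C) (h v w : C) :
  (forall j, c j = d j) -> v = w -> is_Cpseries c h v -> is_Cpseries d h w.
Proof.
  intros H E. apply is_series_Cext; [ | exact E ]. intros j. rewrite H. reflexivity.
Qed.

Lemma is_Cpseries_bounded (c : nat -> C) (h v : C) :
  is_Cpseries c h v -> exists B, (0 < B)%R /\ forall j, (Cmod (c j) * Cmod h ^ j <= B)%R.
Proof.
  intros H. destruct (is_series_terms_bounded _ _ H) as [B [HB Hj]].
  exists B. split; [ exact HB | ]. intros j. rewrite <- Cmod_pow, <- Cmod_mult. apply Hj.
Qed.

Lemma is_Cpseries_0 (c : nat -> C) (v : C) : is_Cpseries c 0 v -> v = c O.
Proof.
  intros H. refine (is_series_C_unique _ _ _ H _).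
  refine (is_series_Cext _ _ _ _ (fun n => eq_refl) _ (is_series_finite _ 1 _)).
  - simpl. ring.
  - intros [ | k ] Hk; [ lia | ]. rewrite Cpow_S. ring.
Qed.

Lemma is_series_geom_scal (B q : R) : (0 <= q < 1)%R ->
  is_series (fun k => (B * q ^ k)%R) (B * / (1 - q))%R.
Proof.
  intros Hq. apply (is_series_scal (V := R_NormedModule) B).
  apply is_series_geom. rewrite Rabs_pos_eq; lra.
Qed.

(** Geometric tail with ratio at most 1/2, whence the factor 2. This estimate underlies uniqueness
    of coefficients, differentiability, the Cauchy estimates and the bounds of integrands near 0. *)
Lemma is_Cpseries_remainder (c : nat -> C) (r B : R) (h v : C) (J : nat) :
  (0 < r)%R -> (forall j, (Cmod (c j) * r ^ j <= B)%R) -> (Cmod h <= r / 2)%R ->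
  is_Cpseries c h v ->
  (Cmod (v - csum (fun j => c j * h ^ j)%C J) <= 2 * B * (Cmod h / r) ^ J)%R.
Proof.
  intros Hr HB Hh Hv. set (q := (Cmod h / r)%R).
  assert (Hq : (0 <= q <= / 2)%R).
  { unfold q. split; [ apply Rdiv_le_0_compat; [ apply Cmod_ge_0 | exact Hr ] | ].
    apply Rle_div_l; lra. }
  assert (HqJ := pow_le q J (proj1 Hq)).
  assert (HB0 : (0 <= B)%R).
  { specialize (HB O). simpl in HB. assert (P := Cmod_ge_0 (c O)). lra. }
  assert (G := is_series_geom_scal (B * q ^ J) q ltac:(lra)).
  assert (Hs := is_series_shift _ _ J Hv).
  eapply Rle_trans; [ refine (is_series_Cmod_bound _ _ _ _ Hs G _) | ].
  - intros k. rewrite Cmod_mult, Cmod_pow.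
    replace (B * q ^ J * q ^ k)%R with (B * q ^ (J + k))%R by (rewrite pow_add; ring).
    replace (Cmod h) with (r * q)%R by (unfold q; field; lra).
    rewrite Rpow_mult_distr, <- Rmult_assoc.
    apply Rmult_le_compat_r; [ apply pow_le; lra | apply HB ].
  - rewrite (Rmult_comm 2 B), Rmult_assoc, Rmult_assoc.
    apply Rmult_le_compat_l; [ exact HB0 | ]. rewrite Rmult_comm.
    apply Rmult_le_compat_r; [ exact HqJ | ].
    rewrite <- (Rinv_inv 2). apply Rinv_le_contravar; lra.
Qed.

(** If all coefficients before c_j vanish, then at a zero h of g the remainder estimate gives |c_j|
    |h|^j <= 2B (|h|/r)^(j+1), and h may be taken arbitrarily small. The point h = 0 is excluded
    throughout so that the lemma applies to punctured neighbourhoods, as for Laurent expansions. *)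
Lemma is_Cpseries_coeffs_zero (c : nat -> C) (g : C -> C) (d : R) :
  (0 < d)%R ->
  (forall h, (Cmod h < d)%R -> h <> 0 -> is_Cpseries c h (g h)) ->
  (forall e, (0 < e)%R -> exists h, (Cmod h < e)%R /\ h <> 0 /\ g h = 0) ->
  forall j, c j = 0.
Proof.
  intros Hd Hs Hz.
  assert (Hd2 : Cmod (RtoC (d / 2)) = (d / 2)%R) by (apply Cmod_RtoC_pos; lra).
  assert (H0 := Hs (RtoC (d / 2))). rewrite Hd2 in H0.
  destruct (is_Cpseries_bounded _ _ _ (H0 ltac:(lra)
    ltac:(apply RtoC_neq_0; lra))) as [B [HB HBj]].
  rewrite Hd2 in HBj. set (r := (d / 2)%R) in *.
  assert (Hr : (0 < r)%R) by (unfold r; lra).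
  intros j. induction j as [ j IH ] using (well_founded_induction lt_wf).
  apply Cmod_eq_0_small. intros eps Heps.
  assert (HrS := pow_lt r (S j) Hr).
  assert (HC : (0 < eps * r ^ S j / (2 * B))%R).
  { apply Rdiv_lt_0_compat; [ apply Rmult_lt_0_compat; assumption | lra ]. }
  (* The first bound admits the remainder estimate; the second makes 2B |h| / r^(j+1) smaller than
     [eps]. *)
  destruct (Hz (Rmin (r / 2) (eps * r ^ S j / (2 * B)))%R) as [h [Hh [Hh0 Hg]]].
  { apply Rmin_glb_lt; lra. }
  destruct (Rmin_Rgt_l _ _ _ Hh) as [Hh1 Hh2].
  assert (T := is_Cpseries_remainder c r B h (g h) (S j) Hr HBj ltac:(lra)
    (Hs h ltac:(unfold r in *; lra) Hh0)).
  rewrite Hg in T. simpl csum in T. rewrite csum_zero in T.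
  2: { intros k Hk. rewrite IH by exact Hk. ring. }
  replace (0 - (0 + c j * h ^ j)) with (- (c j * h ^ j)) in T by ring.
  rewrite Cmod_opp, Cmod_mult, Cmod_pow in T.
  assert (Hhp : (0 < Cmod h)%R) by (apply Cmod_gt_0; exact Hh0).
  assert (Hhj := pow_lt _ j Hhp).
  apply Rmult_le_reg_r with (Cmod h ^ j)%R; [ exact Hhj | ].
  eapply Rle_trans; [ exact T | ].
  replace ((Cmod h / r) ^ S j)%R with (Cmod h * Cmod h ^ j / r ^ S j)%R.
  2: { unfold Rdiv. rewrite Rpow_mult_distr, pow_inv. simpl. ring. }
  replace (2 * B * (Cmod h * Cmod h ^ j / r ^ S j))%R
    with ((2 * B * Cmod h / r ^ S j) * Cmod h ^ j)%R by (field; lra).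
  apply Rmult_le_compat_r; [ lra | ].
  replace eps with (2 * B * (eps * r ^ S j / (2 * B)) / r ^ S j)%R by (field; lra).
  apply Rmult_le_compat_r; [ left; apply Rinv_0_lt_compat; exact HrS | ].
  apply Rmult_le_compat_l; lra.
Qed.

Lemma is_Cpseries_minus (c d : nat -> C) (h v w : C) :
  is_Cpseries c h v -> is_Cpseries d h w -> is_Cpseries (fun j => c j - d j) h (v - w).
Proof.
  intros H1 H2. refine (is_series_Cext _ _ _ _ _ eq_refl (is_series_Cminus _ _ _ _ H1 H2)).
  intros j. cbv beta. ring.
Qed.

Lemma is_Cpseries_plus (c d : nat -> C) (h v w : C) :
  is_Cpseries c h v -> is_Cpseries d h w -> is_Cpseries (fun j => c j + d j) h (v + w).
Proof.
  intros H1 H2. refine (is_series_Cext _ _ _ _ _ eq_refl (is_series_Cplus _ _ _ _ H1 H2)).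
  intros j. cbv beta. ring.
Qed.

Lemma is_Cpseries_coeffs_unique (c d : nat -> C) (g : C -> C) (r : R) :
  (0 < r)%R ->
  (forall h, (Cmod h < r)%R -> h <> 0 -> is_Cpseries c h (g h) /\ is_Cpseries d h (g h)) ->
  forall j, c j = d j.
Proof.
  intros Hr H j.
  apply Cminus_eq_0.
  refine (is_Cpseries_coeffs_zero (fun j => c j - d j) (fun h => g h - g h) r Hr _ _ j).
  - intros h Hh Hh0. destruct (H h Hh Hh0). apply is_Cpseries_minus; assumption.
  - intros e He. exists (RtoC (e / 2)). split; [ rewrite Cmod_RtoC_pos; lra | ].
    split; [ apply RtoC_neq_0; lra | ring ].
Qed.

(** The remainder of order 2 is at most a constant times |h|^2, which is the defining estimate of
    the derivative. *)
Lemma is_Cpseries_is_derive (f : C -> C) (s0 : C) (c : nat -> C) (r : R) :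
  (0 < r)%R -> (forall h, (Cmod h < r)%R -> is_Cpseries c h (f (s0 + h))) ->
  is_derive (V := C_NormedModule) f s0 (c 1%nat).
Proof.
  intros Hr H.
  assert (H0 : f s0 = c O).
  { apply is_Cpseries_0. replace (f s0) with (f (s0 + 0)) by (f_equal; ring).
    apply H. rewrite Cmod_0. exact Hr. }
  assert (Hr2 : Cmod (RtoC (r / 2)) = (r / 2)%R) by (apply Cmod_RtoC_pos; lra).
  destruct (is_Cpseries_bounded _ _ _ (H (RtoC (r / 2)) ltac:(rewrite Hr2; lra)))
    as [B [HB HBj]].
  rewrite Hr2 in HBj.
  assert (Hrr : (0 < r / 2)%R) by lra. set (q := (r / 2)%R) in *.
  split; [ apply is_linear_scal_l | ].
  intros x Hx.
  assert (Ex : s0 = x) by (apply (is_filter_lim_locally_unique (V := AbsRing_NormedModule C_AbsRing)); exact Hx).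
  subst x. intros eps. assert (He := cond_pos eps).
  assert (Hq2 : (0 < q ^ 2)%R) by (apply pow_lt; exact Hrr).
  assert (Hdelta : (0 < Rmin (q / 2) (eps * q ^ 2 / (2 * B)))%R).
  { apply Rmin_glb_lt; [ lra | ]. apply Rdiv_lt_0_compat; [ apply Rmult_lt_0_compat; lra | lra ]. }
  exists (mkposreal _ Hdelta). 
  cut (forall y : C, (Cmod (y - s0) < Rmin (q / 2) (eps * q ^ 2 / (2 * B)))%R ->
    (Cmod (f y - f s0 - (y - s0) * c 1%nat) <= eps * Cmod (y - s0))%R).
  { intros K y Hy. exact (K y Hy). }
  intros y Hy.
  destruct (Rmin_Rgt_l _ _ _ Hy) as [Hy1 Hy2].
  assert (Hyr : (Cmod (y - s0) < r)%R) by (unfold q in *; lra).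
  assert (T := is_Cpseries_remainder c q B (y - s0) (f (s0 + (y - s0))) 2 Hrr HBj ltac:(lra) (H _ Hyr)).
  replace (s0 + (y - s0)) with y in T by ring.
  replace (f y - f s0 - (y - s0) * c 1%nat) with (f y - csum (fun j => c j * (y - s0) ^ j) 2)
    by (rewrite H0; simpl; ring).
  eapply Rle_trans; [ exact T | ].
  assert (Hp := Cmod_ge_0 (y - s0)). set (m := Cmod (y - s0)) in *.
  replace (2 * B * (m / q) ^ 2)%R with (2 * B / q ^ 2 * m * m)%R by (field; lra).
  apply Rmult_le_compat_r; [ exact Hp | ].
  replace (pos eps) with (2 * B / q ^ 2 * (eps * q ^ 2 / (2 * B)))%R by (field; lra).
  apply Rmult_le_compat_l; [ | lra ]. apply Rdiv_le_0_compat; lra.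
Qed.

Lemma Re_csum (u : nat -> C) (n : nat) : Re (csum u (S n)) = sum_f_R0 (fun k => Re (u k)) n.
Proof.
  induction n as [ | n IH ]; [ cbn [csum sum_f_R0]; f_equal; apply Cplus_0_l | ].
  change (csum u (S (S n))) with (csum u (S n) + u (S n)).
  rewrite Re_plus, IH. reflexivity.
Qed.

Lemma Im_csum (u : nat -> C) (n : nat) : Im (csum u (S n)) = sum_f_R0 (fun k => Im (u k)) n.
Proof.
  induction n as [ | n IH ]; [ cbn [csum sum_f_R0]; f_equal; apply Cplus_0_l | ].
  change (csum u (S (S n))) with (csum u (S n) + u (S n)).
  rewrite Im_plus, IH. reflexivity.
Qed.

Lemma is_series_C_components (u : nat -> C) (l : C) :
  is_series u l <->
  is_series (fun k => Re (u k)) (Re l) /\ is_series (fun k => Im (u k)) (Im l).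
Proof.
  rewrite is_series_Cmod, !is_series_Reals. unfold infinite_sum, Rdist. split.
  - intros H. split; intros eps Heps; destruct (H eps Heps) as [N HN]; exists N; intros n Hn;
      specialize (HN (S n) ltac:(lia)).
    + rewrite <- Re_csum, <- Re_minus. eapply Rle_lt_trans; [ apply re_le_Cmod | exact HN ].
    + rewrite <- Im_csum, <- Im_minus. eapply Rle_lt_trans; [ apply Rabs_Im_le_Cmod | exact HN ].
  - intros [H1 H2] eps Heps.
    destruct (H1 (eps / 2)%R ltac:(lra)) as [N1 HN1].
    destruct (H2 (eps / 2)%R ltac:(lra)) as [N2 HN2].
    exists (S (N1 + N2)). intros [ | n ] Hn; [ lia | ].
    specialize (HN1 n ltac:(lia)). specialize (HN2 n ltac:(lia)).
    rewrite <- Re_csum, <- Re_minus in HN1. rewrite <- Im_csum, <- Im_minus in HN2.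
    eapply Rle_lt_trans; [ apply Cmod_le_Rabs | ]. lra.
Qed.

(** The real Cauchy product theorem is applied to the four products of real and imaginary parts;
    their absolute convergence is inherited from the moduli. *)
Lemma is_series_Cmult (u v : nat -> C) (a b : C) :
  is_series u a -> is_series v b ->
  ex_series (fun n => Cmod (u n)) -> ex_series (fun n => Cmod (v n)) ->
  is_series (fun n => csum (fun k => u k * v (n - k)%nat) (S n)) (a * b).
Proof.
  intros Hu Hv Au Av.
  destruct (proj1 (is_series_C_components _ _) Hu) as [Hu1 Hu2].
  destruct (proj1 (is_series_C_components _ _) Hv) as [Hv1 Hv2].
  assert (Abs : forall (phi : C -> R) (w : nat -> C), (forall z, Rabs (phi z) <= Cmod z)%R ->
    ex_series (fun n => Cmod (w n)) -> ex_series (fun n => Rabs (phi (w n)))).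
  { intros phi w Hphi Hw. refine (ex_series_le (V := R_CompleteNormedModule) _ _ _ Hw).
    intros n. unfold norm; simpl. unfold abs; simpl. rewrite Rabs_Rabsolu. apply Hphi. }
  assert (ARe := fun w => Abs Re w re_le_Cmod). assert (AIm := fun w => Abs Im w Rabs_Im_le_Cmod).
  assert (P1 := is_series_mult _ _ _ _ Hu1 Hv1 (ARe _ Au) (ARe _ Av)).
  assert (P2 := is_series_mult _ _ _ _ Hu2 Hv2 (AIm _ Au) (AIm _ Av)).
  assert (P3 := is_series_mult _ _ _ _ Hu1 Hv2 (ARe _ Au) (AIm _ Av)).
  assert (P4 := is_series_mult _ _ _ _ Hu2 Hv1 (AIm _ Au) (ARe _ Av)).
  apply is_series_C_components. split.
  - refine (is_series_ext _ _ _ _ (is_series_minus _ _ _ _ P1 P2)).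
    intros n. rewrite Re_csum.
    change (sum_f_R0 (fun k => Re (u k) * Re (v (n - k)%nat))%R n
      - sum_f_R0 (fun k => Im (u k) * Im (v (n - k)%nat))%R n =
      sum_f_R0 (fun k => Re (u k * v (n - k)%nat)) n)%R.
    rewrite <- minus_sum. apply sum_eq. intros i _. reflexivity.
  - refine (is_series_ext _ _ _ _ (is_series_plus _ _ _ _ P3 P4)).
    intros n. rewrite Im_csum.
    change (sum_f_R0 (fun k => Re (u k) * Im (v (n - k)%nat))%R n
      + sum_f_R0 (fun k => Im (u k) * Re (v (n - k)%nat))%R n =
      sum_f_R0 (fun k => Im (u k * v (n - k)%nat)) n)%R.
    rewrite <- sum_plus. apply sum_eq. intros i _. reflexivity.
Qed.

Lemma Cpseries_abs_conv (c : nat -> C) (r B : R) (h : C) :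
  (forall j, (Cmod (c j) * r ^ j <= B)%R) -> (Cmod h < r)%R ->
  ex_series (fun j => Cmod (c j * h ^ j)).
Proof.
  intros HB Hh. assert (Hp := Cmod_ge_0 h). assert (Hr : (0 < r)%R) by lra.
  assert (Hq : (0 <= Cmod h / r < 1)%R).
  { split; [ apply Rdiv_le_0_compat; lra | ].
    apply Rlt_div_l; lra. }
  assert (G := is_series_geom_scal B _ Hq).
  refine (ex_series_le (V := R_CompleteNormedModule) _ _ _ (ex_intro _ _ G)).
  intros j. unfold norm; simpl. unfold abs; simpl.
  rewrite Rabs_pos_eq by apply Cmod_ge_0. rewrite Cmod_mult, Cmod_pow.
  replace (Cmod h) with (r * (Cmod h / r))%R at 1 by (field; lra).
  rewrite Rpow_mult_distr, <- Rmult_assoc.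
  apply Rmult_le_compat_r; [ apply pow_le; lra | apply HB ].
Qed.

Lemma is_Cpseries_mult (c d : nat -> C) (r B : R) (h v w : C) :
  (forall j, (Cmod (c j) * r ^ j <= B)%R) -> (forall j, (Cmod (d j) * r ^ j <= B)%R) ->
  (Cmod h < r)%R -> is_Cpseries c h v -> is_Cpseries d h w ->
  is_Cpseries (fun n => csum (fun k => c k * d (n - k)%nat) (S n)) h (v * w).
Proof.
  intros Hc Hd Hh Hv Hw.
  refine (is_series_Cext _ _ _ _ _ eq_refl (is_series_Cmult _ _ _ _ Hv Hw
    (Cpseries_abs_conv c r B h Hc Hh) (Cpseries_abs_conv d r B h Hd Hh))).
  intros n. rewrite <- csum_mult_r. apply csum_ext. intros k Hk.
  replace (h ^ n) with (h ^ (k + (n - k))) by (f_equal; lia). rewrite Cpow_add_r. ring.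
Qed.

Lemma is_Cpseries_shift (c : nat -> C) (h v : C) (N : nat) :
  is_Cpseries c h v ->
  is_Cpseries (fun j => if Nat.ltb j N then 0 else c (j - N)%nat) h (h ^ N * v).
Proof.
  intros H. apply is_series_unshift with (n := N).
  refine (is_series_Cext _ _ _ _ _ _ (is_series_Cscal (h ^ N) _ _ H)).
  - intros j. cbv beta. replace (Nat.ltb (N + j) N) with false by (symmetry; apply Nat.ltb_ge; lia).
    replace (N + j - N)%nat with j by lia. rewrite Cpow_add_r. ring.
  - rewrite csum_zero; [ ring | ]. intros k Hk.
    replace (Nat.ltb k N) with true by (symmetry; apply Nat.ltb_lt; lia). ring.
Qed.

(** * Entire functions, Cauchy estimates and termwise differentiation of series *)

(* [f'] is the derivative of [f], read off the Taylor coefficients. *)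
Definition entire (f f' : C -> C) : Prop :=
  forall s0, exists c, c 0%nat = f s0 /\ c 1%nat = f' s0 /\ forall h, is_Cpseries c h (f (s0 + h)).

Lemma entire_bounds (c : nat -> C) (f : C -> C) (r : R) :
  (0 < r)%R -> (forall h, is_Cpseries c h (f h)) ->
  exists B, (0 < B)%R /\ forall j, (Cmod (c j) * r ^ j <= B)%R.
Proof.
  intros Hr H. destruct (is_Cpseries_bounded _ _ _ (H (RtoC r))) as [B HB].
  rewrite Cmod_R, Rabs_pos_eq in HB by lra. exists B. exact HB.
Qed.

Lemma entire_ext (f g f' g' : C -> C) :
  (forall s, f s = g s) -> (forall s, f' s = g' s) -> entire f f' -> entire g g'.
Proof.
  intros H H' Hf s0. destruct (Hf s0) as [c [H0 [H1 Hc]]].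
  exists c. rewrite <- H, <- H'. repeat split; [ assumption.. | ].
  intros h. rewrite <- H. apply Hc.
Qed.

Lemma entire_const (a : C) : entire (fun _ => a) (fun _ => 0).
Proof.
  intros s0. exists (fun j => match j with O => a | _ => 0 end).
  repeat split. intros h.
  refine (is_series_Cext _ _ _ _ (fun n => eq_refl) _ (is_series_finite _ 1 _)).
  - simpl. ring.
  - intros [ | k ] Hk; [ lia | ring ].
Qed.

Lemma entire_id : entire (fun s => s) (fun _ => 1).
Proof.
  intros s0. exists (fun j => match j with O => s0 | 1%nat => 1 | _ => 0 end).
  repeat split. intros h.
  refine (is_series_Cext _ _ _ _ (fun n => eq_refl) _ (is_series_finite _ 2 _)).
  - simpl. ring.
  - intros [ | [ | k ] ] Hk; [ lia | lia | ring ].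
Qed.

Lemma entire_plus (f g f' g' : C -> C) :
  entire f f' -> entire g g' -> entire (fun s => f s + g s) (fun s => f' s + g' s).
Proof.
  intros Hf Hg s0. destruct (Hf s0) as [c [H0 [H1 Hc]]]. destruct (Hg s0) as [d [K0 [K1 Hd]]].
  exists (fun j => c j + d j). rewrite H0, H1, K0, K1. repeat split.
  intros h. apply is_Cpseries_plus; auto.
Qed.

Lemma entire_mult (f g f' g' : C -> C) :
  entire f f' -> entire g g' ->
  entire (fun s => f s * g s) (fun s => f' s * g s + f s * g' s).
Proof.
  intros Hf Hg s0. destruct (Hf s0) as [c [H0 [H1 Hc]]]. destruct (Hg s0) as [d [K0 [K1 Hd]]].
  exists (fun n => csum (fun k => c k * d (n - k)%nat) (S n)).
  split; [ simpl; rewrite H0, K0; ring | ].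
  split; [ simpl; rewrite H0, K0, H1, K1; ring | ].
  (* Both series converge everywhere, so any radius beyond |h| supplies the absolute convergence. *)
  intros h. assert (Hr : (0 < Cmod h + 1)%R) by (assert (P := Cmod_ge_0 h); lra).
  destruct (entire_bounds c (fun h => f (s0 + h)) _ Hr Hc) as [B [HB HBc]].
  destruct (entire_bounds d (fun h => g (s0 + h)) _ Hr Hd) as [B' [HB' HBd]].
  refine (is_Cpseries_mult c d (Cmod h + 1) (B + B') h _ _ _ _ _ (Hc h) (Hd h)); [ | | lra ].
  - intros j. specialize (HBc j). lra.
  - intros j. specialize (HBd j). lra.
Qed.

Lemma entire_scal (a : C) (f f' : C -> C) :
  entire f f' -> entire (fun s => a * f s) (fun s => a * f' s).
Proof.
  intros H. refine (entire_ext _ _ _ _ _ _ (entire_mult _ _ _ _ (entire_const a) H));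
    intros s; cbv beta; ring.
Qed.

Lemma entire_minus (f g f' g' : C -> C) :
  entire f f' -> entire g g' -> entire (fun s => f s - g s) (fun s => f' s - g' s).
Proof.
  intros Hf Hg.
  refine (entire_ext _ _ _ _ _ _ (entire_plus _ _ _ _ Hf (entire_scal (- (1)) _ _ Hg)));
    intros s; cbv beta; ring.
Qed.

Lemma entire_csum (f f' : nat -> C -> C) (n : nat) :
  (forall k, entire (f k) (f' k)) ->
  entire (fun s => csum (fun k => f k s) n) (fun s => csum (fun k => f' k s) n).
Proof.
  intros H. induction n as [ | n IH ]; simpl.
  - apply entire_const.
  - apply entire_plus; auto.
Qed.

Lemma entire_Cexp (a b : C) : entire (fun s => Cexp (a * s + b)) (fun s => a * Cexp (a * s + b)).
Proof.
  intros s0. exists (fun j => Cexp (a * s0 + b) * (/ INR (fact j) * a ^ j)).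
  split; [ simpl; field | ]. split; [ simpl; field | ].
  intros h. replace (Cexp (a * (s0 + h) + b)) with (Cexp (a * s0 + b) * Cexp (a * h))
    by (rewrite <- Cexp_plus; f_equal; ring).
  refine (is_series_Cext _ _ _ _ _ eq_refl (is_series_Cscal _ _ _ (Cexp_series (a * h)))).
  intros j. cbv beta. rewrite Cpow_mult_l. ring.
Qed.

Lemma Cexp_Ci (x : R) : Cexp (Ci * RtoC x) = (cos x, sin x).
Proof.
  unfold Cexp. replace (Re (Ci * RtoC x)) with 0%R by (unfold Re; simpl; ring).
  replace (Im (Ci * RtoC x)) with x by (unfold Im; simpl; ring).
  rewrite exp_0, !Rmult_1_l. reflexivity.
Qed.

(** For z = e^(2 pi i/N), z^d = 1 would give cos(2 pi d/N) = 1, hence sin(pi d/N) = 0, which is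
    impossible for 0 < d < N. *)
Lemma exists_root_of_unity (N : nat) : (0 < N)%nat -> exists z, Cmod z = 1%R /\ z ^ N = 1 /\
  forall d, (0 < d < N)%nat -> z ^ d <> 1.
Proof.
  intros HN. assert (HNp := lt_0_INR N HN). assert (Hpi := PI_RGT_0).
  assert (Hpow : forall d, Cexp (Ci * RtoC (2 * PI / INR N)) ^ d = Cexp (Ci * RtoC (2 * PI * INR d / INR N))).
  { intros d. rewrite <- Cexp_pow. f_equal.
    apply C_ext; unfold Re, Im, Cmult, RtoC, Ci; cbn [fst snd]; field; lra. }
  exists (Cexp (Ci * RtoC (2 * PI / INR N))). repeat split.
  - rewrite Cmod_Cexp, <- exp_0. f_equal. unfold Re; simpl; ring.
  - rewrite Hpow, Cexp_Ci. replace (2 * PI * INR N / INR N)%R with (2 * PI)%R by (field; lra).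
    rewrite cos_2PI, sin_2PI. reflexivity.
  - intros d Hd. rewrite Hpow, Cexp_Ci. intros E. apply (f_equal fst) in E. simpl in E.
    assert (Hd0 := lt_0_INR d (proj1 Hd)). assert (HdN := lt_INR d N (proj2 Hd)).
    assert (Hx : (0 < PI * INR d / INR N < PI)%R).
    { split; [ apply Rdiv_lt_0_compat; [ apply Rmult_lt_0_compat; lra | lra ] | ].
      apply Rlt_div_l; [ lra | ]. apply Rmult_lt_compat_l; lra. }
    replace (2 * PI * INR d / INR N)%R with (2 * (PI * INR d / INR N))%R in E by (field; lra).
    rewrite cos_2a_sin in E. assert (Hs := sin_gt_0 _ (proj1 Hx) (proj2 Hx)). nra.
Qed.

Lemma csum_geom (z : C) (n : nat) : z <> 1 -> csum (fun m => z ^ m) n = (1 - z ^ n) / (1 - z).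
Proof.
  intros Hz. assert (Hz' := Cminus_neq_0 _ _ (not_eq_sym Hz)).
  induction n as [ | n IH ]; simpl; [ | rewrite IH ]; field; exact Hz'.
Qed.

(* Average [f(r w) w^(-j)] over the [N]-th roots of unity [w]. *)
Lemma Cauchy_estimate (c : nat -> C) (f : C -> C) (r M : R) :
  (0 < r)%R -> (forall h, is_Cpseries c h (f h)) ->
  (forall h, (Cmod h <= r)%R -> (Cmod (f h) <= M)%R) ->
  forall j, (Cmod (c j) * r ^ j <= M)%R.
Proof.
  intros Hr Hc HM j.
  (* Bounding the coefficients on the doubled radius makes the truncation error on |h| = r decay
     like (1/2)^N. *)
  destruct (entire_bounds c f (2 * r) ltac:(lra) Hc) as [B [HB HBj]].
  apply Rnot_lt_le. intros Hlt.
  (* If the estimate failed, a truncation error 2B (1/2)^N with (1/2)^N < e would be smaller than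
     the excess |c_j| r^j - M, a contradiction. *)
  set (e := ((Cmod (c j) * r ^ j - M) / (2 * B))%R).
  assert (He : (0 < e)%R) by (apply Rdiv_lt_0_compat; lra).
  destruct (pow_lt_1_zero (/ 2) ltac:(rewrite Rabs_pos_eq; lra) e He) as [N0 HN0].
  (* N must also exceed j, so that the j-th term belongs to the truncated sum. *)
  set (N := S (N0 + j)). specialize (HN0 N ltac:(lia)).
  rewrite Rabs_pos_eq in HN0 by (apply pow_le; lra).
  assert (HNp : (0 < INR N)%R) by (apply lt_0_INR; lia).
  destruct (exists_root_of_unity N ltac:(lia)) as [z [Hz1 [HzN Hzd]]].
  assert (Hz0 : z <> 0) by (apply Cmod_gt_0; lra).
  set (om := fun m : nat => z ^ m).
  assert (Hom : forall m, Cmod (om m) = 1%R) by (intros m; unfold om; rewrite Cmod_pow, Hz1; apply pow1).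
  assert (Hom0 : forall m, om m <> 0) by (intros m; apply Cpow_nz, Hz0).
  set (g := fun m => f (RtoC r * om m) / om m ^ j).
  assert (Hg : forall m, (Cmod (g m - csum (fun i => c i * r ^ i * (om m ^ i / om m ^ j))%C N)
    <= 2 * B * (/ 2) ^ N)%R).
  { intros m.
    assert (Hmod : Cmod (RtoC r * om m) = r) by (rewrite Cmod_mult, Hom, Cmod_RtoC_pos; lra).
    assert (T := is_Cpseries_remainder c (2 * r) B (RtoC r * om m) _ N ltac:(lra) HBj ltac:(lra) (Hc _)).
    rewrite Hmod in T. replace (r / (2 * r))%R with (/ 2)%R in T by (field; lra).
    replace (g m - csum (fun i => c i * r ^ i * (om m ^ i / om m ^ j))%C N)
      with ((f (r * om m) - csum (fun i => c i * (r * om m) ^ i) N) * / om m ^ j).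
    - rewrite Cmod_mult, Cmod_inv by (apply Cpow_nz, Hom0).
      rewrite Cmod_pow, Hom, pow1, Rinv_1, Rmult_1_r. exact T.
    - unfold g. assert (Ho := Cpow_nz _ j (Hom0 m)).
      replace (csum (fun i => c i * r ^ i * (om m ^ i / om m ^ j))%C N)
        with (csum (fun i => c i * (r * om m) ^ i) N * / om m ^ j).
      + field. exact Ho.
      + rewrite <- csum_mult_r. apply csum_ext. intros k _. rewrite Cpow_mult_l. field. exact Ho. }
  (* Orthogonality: for i different from j the sum over m is geometric with ratio z^i/z^j, which is
     not 1 but has N-th power 1, so it vanishes. *)
  assert (HS : csum (fun m => csum (fun i => c i * r ^ i * (om m ^ i / om m ^ j))%C N) N
    = INR N * (c j * r ^ j)).
  { rewrite csum_exchange. rewrite (csum_single _ N j).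
    - rewrite (csum_ext _ (fun m => (c j * r ^ j) * 1)).
      + rewrite csum_mult_l. rewrite Cmult_comm. f_equal. clear.
        induction N as [ | N IH ]; [ reflexivity | ].
        rewrite S_INR, RtoC_plus, <- IH. reflexivity.
      + intros m _. field. apply Cpow_nz, Hom0.
    - unfold N. lia.
    - intros i Hi Hij.
      assert (Hzj := Cpow_nz z j Hz0).
      rewrite (csum_ext _ (fun m => (c i * r ^ i) * (z ^ i / z ^ j) ^ m)).
      + rewrite csum_mult_l, csum_geom.
        * replace ((z ^ i / z ^ j) ^ N) with (RtoC 1); [ unfold Cdiv; ring | ].
          unfold Cdiv. rewrite Cpow_mult_l, Cpow_inv by exact Hzj.
          rewrite <- !Cpow_mult_r, !(Nat.mul_comm _ N), !Cpow_mult_r, HzN, !Cpow_1_l. field.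
        * intros E. assert (Ez : z ^ i = z ^ j).
          { replace (z ^ i) with (z ^ i / z ^ j * z ^ j) by (field; exact Hzj). rewrite E. ring. }
          assert (Hinj : forall a b, (a < b < N)%nat -> z ^ a <> z ^ b).
          { intros a b Hab Eab. apply (Hzd (b - a)%nat ltac:(lia)).
            replace (z ^ (b - a)) with (z ^ (b - a) * z ^ a / z ^ a) by (field; apply Cpow_nz, Hz0).
            rewrite <- Cpow_add_r. replace (b - a + a)%nat with b by lia. rewrite Eab.
            field. apply Cpow_nz, Hz0. }
          destruct (proj1 (Nat.lt_gt_cases i j) Hij) as [H | H].
          -- apply (Hinj i j); [ unfold N; lia | exact Ez ].
          -- apply (Hinj j i); [ lia | symmetry; exact Ez ].
      + intros m _. f_equal. unfold om, Cdiv.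
        rewrite Cpow_mult_l, Cpow_inv by exact Hzj. rewrite <- !Cpow_mult_r.
        rewrite (Nat.mul_comm m i), (Nat.mul_comm m j). reflexivity. }
  assert (B1 : (Cmod (csum g N) <= INR N * M)%R).
  { apply Cmod_csum_const. intros m _. unfold g.
    rewrite Cmod_div by (apply Cpow_nz, Hom0). rewrite Cmod_pow, Hom, pow1.
    unfold Rdiv. rewrite Rinv_1, Rmult_1_r. apply HM.
    rewrite Cmod_mult, Hom, Cmod_RtoC_pos; lra. }
  assert (B2 : (Cmod (csum g N - INR N * (c j * r ^ j)) <= INR N * (2 * B * (/ 2) ^ N))%R).
  { rewrite <- HS, <- csum_minus. apply Cmod_csum_const. intros m _. apply Hg. }
  assert (B3 : (INR N * (Cmod (c j) * r ^ j) <= INR N * M + INR N * (2 * B * (/ 2) ^ N))%R).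
  { assert (T := Cmod_triangle_minus (INR N * (c j * r ^ j)) (csum g N)).
    rewrite Cmod_minus_sym in T. rewrite !Cmod_mult, Cmod_pow, !Cmod_R, !Rabs_pos_eq in T by lra.
    lra. }
  assert (B4 : (Cmod (c j) * r ^ j <= M + 2 * B * (/ 2) ^ N)%R).
  { apply Rmult_le_reg_l with (INR N); lra. }
  assert (B5 : (2 * B * (/ 2) ^ N < 2 * B * e)%R) by (apply Rmult_lt_compat_l; lra).
  replace (2 * B * e)%R with (Cmod (c j) * r ^ j - M)%R in B5 by (unfold e; field; lra).
  lra.
Qed.

Lemma functional_choice {A B : Type} (P : A -> B -> Prop) :
  (forall a, exists b, P a b) -> exists f, forall a, P a (f a).
Proof.
  intros H. exists (fun a => proj1_sig (constructive_indefinite_description _ (H a))).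
  intros a. apply proj2_sig.
Qed.

(** Cauchy estimates give |c_kj| r^j <= A_k. Hence the coefficients can be summed over k, and the
    tails of the individual Taylor series are dominated by a summable sequence, which justifies
    exchanging the two sums. The case j = 1 is termwise differentiation. *)
Lemma Weierstrass_series (f : nat -> C -> C) (c : nat -> nat -> C) (r : R) (A : nat -> R) :
  (0 < r)%R -> (forall k h, is_Cpseries (c k) h (f k h)) ->
  (forall k h, (Cmod h <= r)%R -> (Cmod (f k h) <= A k)%R) -> ex_series A ->
  exists d : nat -> C, (forall j, is_series (fun k => c k j) (d j)) /\
    forall h F : C, (Cmod h < r)%R -> is_series (fun k => f k h) F -> is_Cpseries d h F.
Proof.
  intros Hr Hc HA [SA HSA].
  assert (HCE : forall k j, (Cmod (c k j) * r ^ j <= A k)%R).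
  { intros k. apply (Cauchy_estimate (c k) (f k) r (A k) Hr (Hc k) (HA k)). }
  destruct (functional_choice (fun j (l : C) => is_series (fun k => c k j) l)) as [d Hd].
  { intros j. apply ex_series_Cmod with (a := fun k => (/ r ^ j * A k)%R).
    - intros k. assert (P := pow_lt r j Hr).
      apply Rmult_le_reg_r with (r ^ j)%R; [ exact P | ].
      replace (/ r ^ j * A k * r ^ j)%R with (A k) by (field; lra). apply HCE.
    - exists (/ r ^ j * SA)%R. exact (is_series_scal (V := R_NormedModule) _ _ _ HSA). }
  exists d. split; [ exact Hd | ].
  intros h F Hh HF. assert (Hp := Cmod_ge_0 h).
  set (q := (Cmod h / r)%R).
  assert (Hq : (0 <= q < 1)%R).
  { unfold q. split; [ apply Rdiv_le_0_compat; lra | ].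
    apply Rlt_div_l; lra. }
  assert (HAk : forall k, (0 <= A k)%R).
  { intros k. eapply Rle_trans; [ apply Cmod_ge_0 | apply (HA k 0) ]. rewrite Cmod_0. lra. }
  (* The tail beyond J of the k-th Taylor series is at most A_k q^J/(1-q); summing over k leaves a
     bound that tends to 0 with J. *)
  assert (Hrem : forall J, (Cmod (F - csum (fun j => d j * h ^ j)%C J) <= q ^ J / (1 - q) * SA)%R).
  { intros J.
    assert (S1 : is_series (fun k => f k h - csum (fun j => c k j * h ^ j) J)
      (F - csum (fun j => d j * h ^ j)%C J)).
    { apply is_series_Cminus; [ exact HF | ].
      apply (is_series_csum (fun j k => c k j * h ^ j) (fun j => d j * h ^ j)%C). intros j _.
      refine (is_series_Cext _ _ _ _ _ _ (is_series_Cscal (h ^ j) _ _ (Hd j)));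
        [ intros k; cbv beta | ]; ring. }
    refine (is_series_Cmod_bound _ _ _ _ S1
      (is_series_scal (V := R_NormedModule) (q ^ J / (1 - q))%R _ _ HSA) _).
    intros k. assert (S2 := is_series_shift _ _ J (Hc k h)).
    assert (G := is_series_geom_scal (A k * q ^ J) q Hq).
    change (Cmod (f k h - csum (fun j => c k j * h ^ j)%C J) <= q ^ J / (1 - q) * A k)%R.
    replace (q ^ J / (1 - q) * A k)%R with (A k * q ^ J * / (1 - q))%R by (field; lra).
    refine (is_series_Cmod_bound _ _ _ _ S2 G _).
    intros i. rewrite Cmod_mult, Cmod_pow.
    replace (A k * q ^ J * q ^ i)%R with (A k * q ^ (J + i))%R by (rewrite pow_add; ring).
    replace (Cmod h) with (r * q)%R by (unfold q; field; lra).
    rewrite Rpow_mult_distr, <- Rmult_assoc.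
    apply Rmult_le_compat_r; [ apply pow_le; lra | apply HCE ]. }
  apply is_series_Cmod. intros eps Heps.
  assert (HSA0 : (0 <= SA)%R).
  { assert (Z := is_series_Cmod_bound (fun _ => 0) 0 A SA
      (is_series_finite (fun _ => RtoC 0) 0 (fun _ _ => eq_refl)) HSA).
    rewrite Cmod_0 in Z. apply Z. intros k. rewrite Cmod_0. apply HAk. }
  set (K := (SA / (1 - q) + 1)%R).
  assert (HK : (0 < K)%R).
  { unfold K. assert (0 <= SA / (1 - q))%R by (apply Rdiv_le_0_compat; lra). lra. }
  destruct (pow_lt_1_zero q ltac:(rewrite Rabs_pos_eq; lra) (eps / K)%R) as [N HN].
  { apply Rdiv_lt_0_compat; assumption. }
  exists N. intros n Hn. specialize (HN n Hn).
  assert (Hqn := pow_le q n (proj1 Hq)). rewrite Rabs_pos_eq in HN by exact Hqn.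
  rewrite Cmod_minus_sym. eapply Rle_lt_trans; [ apply Hrem | ].
  apply Rle_lt_trans with (q ^ n * K)%R.
  - unfold K. replace (q ^ n / (1 - q) * SA)%R with (q ^ n * (SA / (1 - q)))%R by (field; lra).
    apply Rmult_le_compat_l; lra.
  - replace eps with (eps / K * K)%R by (field; lra). apply Rmult_lt_compat_r; assumption.
Qed.

(** * Laurent expansions and Bernoulli coefficients *)

(** The exponent M is free above N so that two Laurent expansions with different pole orders can be
    multiplied by the same power and compared as power series. *)
Lemma laurent_Cpseries (f : C -> C) (s0 : C) (a : Z -> C) :
  laurent_expansion f s0 a ->
  exists N : nat, (forall k, (k < - Z.of_nat N)%Z -> a k = 0) /\
    exists d, (0 < d)%R /\ forall M h, (N <= M)%nat -> (Cmod h < d)%R -> h <> 0 ->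
      is_Cpseries (fun j => a (Z.of_nat j - Z.of_nat M)%Z) h (h ^ M * f (s0 + h)).
Proof.
  intros [N [Hz Hl]]. exists N. split; [ exact Hz | ].
  apply locally'_Cmod in Hl. destruct Hl as [d [Hd Hs]].
  exists d. split; [ exact Hd | ]. intros M h HM Hh Hh0.
  assert (HN : is_Cpseries (fun j => a (Z.of_nat j - Z.of_nat N)%Z) h (h ^ N * f (s0 + h))).
  { refine (is_series_Cext _ _ _ _ _ eq_refl (is_series_Cscal (h ^ N) _ _ (Hs (s0 + h) _ _))).
    - intros j. cbv beta. replace (s0 + h - s0) with h by ring. field. apply Cpow_nz, Hh0.
    - replace (s0 + h - s0) with h by ring. exact Hh.
    - intros E. apply Hh0. replace h with (s0 + h - s0) by ring. rewrite E. ring. }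
  refine (is_Cpseries_ext _ _ _ _ _ _ _ (is_Cpseries_shift _ _ _ (M - N) HN)).
  - intros j. destruct (Nat.ltb_spec j (M - N)).
    + symmetry. apply Hz. lia.
    + f_equal. lia.
  - replace (h ^ M) with (h ^ ((M - N) + N)) by (f_equal; lia). rewrite Cpow_add_r. ring.
Qed.

Lemma laurent_expansion_unique (f : C -> C) (s0 : C) (a b : Z -> C) :
  laurent_expansion f s0 a -> laurent_expansion f s0 b -> forall k, a k = b k.
Proof.
  intros Ha Hb k.
  destruct (laurent_Cpseries _ _ _ Ha) as [N [Hza [d [Hd Hsa]]]].
  destruct (laurent_Cpseries _ _ _ Hb) as [N' [Hzb [d' [Hd' Hsb]]]].
  destruct (Z.lt_ge_cases k (- Z.of_nat (N + N'))) as [Hk | Hk].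
  { rewrite Hza, Hzb by lia. reflexivity. }
  assert (E := is_Cpseries_coeffs_unique
    (fun j => a (Z.of_nat j - Z.of_nat (N + N'))%Z) (fun j => b (Z.of_nat j - Z.of_nat (N + N'))%Z)
    (fun h => h ^ (N + N') * f (s0 + h)) (Rmin d d') ltac:(apply Rmin_glb_lt; assumption)).
  specialize (E ltac:(intros h Hh Hh0; split;
    [ apply Hsa; [ lia | eapply Rlt_le_trans; [ exact Hh | apply Rmin_l ] | exact Hh0 ]
    | apply Hsb; [ lia | eapply Rlt_le_trans; [ exact Hh | apply Rmin_r ] | exact Hh0 ] ])
    (Z.to_nat (k + Z.of_nat (N + N')))).
  cbv beta in E. rewrite Z2Nat.id in E by lia.
  replace (k + Z.of_nat (N + N') - Z.of_nat (N + N'))%Z with k in E by lia. exact E.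
Qed.

Lemma laurent_coeff_eq (f : C -> C) (s0 : C) (a : Z -> C) (k : Z) :
  laurent_expansion f s0 a -> laurent_coeff f s0 k = a k.
Proof.
  intros H. apply (laurent_expansion_unique f s0); [ | exact H ].
  unfold laurent_coeff. apply epsilon_spec. exists a. exact H.
Qed.

Definition laurent_of_Cpseries (c : nat -> C) (N : nat) (k : Z) : C :=
  if Z.ltb k (- Z.of_nat N) then 0 else c (Z.to_nat (k + Z.of_nat N)).

Lemma laurent_of_Cpseries_eq (c : nat -> C) (N j : nat) :
  laurent_of_Cpseries c N (Z.of_nat j - Z.of_nat N) = c j.
Proof.
  unfold laurent_of_Cpseries.
  replace (Z.of_nat j - Z.of_nat N <? - Z.of_nat N)%Z with false by (symmetry; apply Z.ltb_ge; lia).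
  f_equal. lia.
Qed.

Lemma laurent_expansion_of_Cpseries (f : C -> C) (s0 : C) (c : nat -> C) (N : nat) (d : R) :
  (0 < d)%R ->
  (forall h, (Cmod h < d)%R -> h <> 0 -> is_Cpseries c h (h ^ N * f (s0 + h))) ->
  laurent_expansion f s0 (laurent_of_Cpseries c N).
Proof.
  intros Hd H. exists N. split.
  - intros k Hk. unfold laurent_of_Cpseries. apply Z.ltb_lt in Hk. rewrite Hk. reflexivity.
  - apply locally'_Cmod. exists d. split; [ exact Hd | ]. intros s Hs Hs0.
    assert (Hh0 := Cminus_neq_0 _ _ Hs0).
    assert (Hp := Cpow_nz _ N Hh0).
    refine (is_series_Cext _ _ _ _ _ _ (is_series_Cscal (/ (s - s0) ^ N) _ _ (H _ Hs Hh0))).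
    + intros j. cbv beta. rewrite laurent_of_Cpseries_eq. field. exact Hp.
    + replace (s0 + (s - s0)) with s by ring. field. exact Hp.
Qed.

(** * Bernoulli coefficients and polynomials by recursion *)

(* Taylor coefficients of (1 - e^(-t)) / t *)
Definition expm1_coeff (j : nat) : C := RtoC (-1) ^ j / INR (fact (S j)).

(* [beta j] is the paper's b_(j-1): the Taylor coefficients of t / (1 - e^(-t)).  [beta_table m]
   holds the values below [m]. *)
Fixpoint beta_table (m : nat) : nat -> C :=
  match m with
  | O => fun _ => 0
  | S p => fun i => if Nat.ltb i p then beta_table p i
      else (if Nat.eqb p 0 then 1 else 0) - csum (fun l => expm1_coeff (p - l) * beta_table p l) p
  end.

Definition beta (j : nat) : C := beta_table (S j) j.

Lemma beta_table_eq (m i : nat) : (i < m)%nat -> beta_table m i = beta i.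
Proof.
  induction m as [ | m IH ]; intros Hi; [ lia | ].
  destruct (Nat.eq_dec i m) as [ -> | Hne ]; [ reflexivity | ].
  simpl. replace (Nat.ltb i m) with true by (symmetry; apply Nat.ltb_lt; lia). apply IH. lia.
Qed.

Lemma beta_eq (m : nat) :
  beta m = (if Nat.eqb m 0 then 1 else 0) - csum (fun l => expm1_coeff (m - l) * beta l) m.
Proof.
  unfold beta at 1. simpl. rewrite Nat.ltb_irrefl.
  rewrite (csum_ext _ (fun l => expm1_coeff (m - l) * beta l)); [ reflexivity | ].
  intros k Hk. rewrite beta_table_eq by exact Hk. reflexivity.
Qed.

Lemma expm1_coeff_0 : expm1_coeff 0 = 1.
Proof. unfold expm1_coeff. simpl. field. Qed.

(** Coefficientwise form of t/(1-e^(-t)) times (1-e^(-t))/t = 1. *)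
Lemma beta_conv (m : nat) :
  csum (fun l => beta l * expm1_coeff (m - l)) (S m) = if Nat.eqb m 0 then 1 else 0.
Proof.
  simpl csum. rewrite (beta_eq m) at 1. rewrite Nat.sub_diag, expm1_coeff_0.
  rewrite (csum_ext (fun l => beta l * expm1_coeff (m - l)) (fun l => expm1_coeff (m - l) * beta l))
    by (intros; ring). ring.
Qed.

Lemma beta_0 : beta 0 = 1.
Proof. rewrite beta_eq. simpl. ring. Qed.

Lemma Cmod_expm1_coeff (j : nat) : (Cmod (expm1_coeff j) <= 1)%R.
Proof.
  unfold expm1_coeff. rewrite Cmod_div by apply INR_fact_C_neq_0.
  rewrite Cmod_pow, !Cmod_R, Rabs_m1, pow1.
  assert (H := INR_fact_lt_0 (S j)). rewrite Rabs_pos_eq by lra.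
  assert (H1 : (1 <= INR (fact (S j)))%R).
  { change 1%R with (INR 1). apply le_INR. apply lt_O_fact. }
  unfold Rdiv. rewrite Rmult_1_l. rewrite <- Rinv_1. apply Rinv_le_contravar; lra.
Qed.

(** The coefficients [expm1_coeff] are at most 1 in modulus, so the recursion is dominated by 1 + 2
    + ... + 2^(k-1) = 2^k - 1. The resulting radius 1/2 is far below the true 2 pi but suffices for
    local expansions. *)
Lemma Cmod_beta (k : nat) : (Cmod (beta k) <= 2 ^ k)%R.
Proof.
  induction k as [ k IH ] using (well_founded_induction lt_wf).
  assert (H : forall m, (m <= k)%nat ->
    (Cmod (csum (fun l => expm1_coeff (k - l) * beta l)%C m) <= 2 ^ m - 1)%R).
  { induction m as [ | m IHm ]; intros Hm.
    - simpl. rewrite Cmod_0. lra.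
    - simpl csum. eapply Rle_trans; [ apply Cmod_triangle | ].
      rewrite Cmod_mult. specialize (IHm ltac:(lia)). specialize (IH m ltac:(lia)).
      assert (H1 := Cmod_expm1_coeff (k - m)). assert (H2 := Cmod_ge_0 (beta m)).
      assert (H3 := Cmod_ge_0 (expm1_coeff (k - m))).
      rewrite <- tech_pow_Rmult. nra. }
  rewrite beta_eq. specialize (H k (Nat.le_refl k)).
  destruct (Nat.eqb_spec k 0) as [ -> | Hk ].
  - simpl. replace (1 - 0) with (RtoC 1) by ring. rewrite Cmod_1. lra.
  - eapply Rle_trans; [ apply Cmod_minus_le | ]. rewrite Cmod_0. lra.
Qed.

Lemma expm1_Cpseries (t : C) : t <> 0 -> is_Cpseries expm1_coeff t ((1 - Cexp (- t)) / t).
Proof.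
  intros Ht.
  refine (is_series_Cext _ _ _ _ _ _ (is_series_Cscal (- / t) _ _
    (is_series_shift _ _ 1 (Cexp_series (- t))))).
  - intros j. cbv beta. unfold expm1_coeff.
    replace (- t) with (RtoC (-1) * t) by ring. change (1 + j)%nat with (S j).
    rewrite Cpow_S, Cpow_mult_l. field. split; [ apply INR_fact_C_neq_0 | exact Ht ].
  - simpl. field. exact Ht.
Qed.

Lemma half_disc_bound (c : nat -> C) :
  (forall k, (Cmod (c k) <= 2 ^ k)%R) -> forall k, (Cmod (c k) * (/ 2) ^ k <= 1)%R.
Proof.
  intros H k. rewrite pow_inv. assert (P : (0 < 2 ^ k)%R) by (apply pow_lt; lra).
  apply Rle_div_l; [ exact P | ]. rewrite Rmult_1_l. apply H.
Qed.

(** The sum v of the [beta] series satisfies v (1-e^(-t))/t = 1 by the Cauchy product. This single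
    identity shows that the denominator is nonzero and identifies v. *)
Lemma beta_Cpseries (t : C) : t <> 0 -> (Cmod t < / 2)%R ->
  1 - Cexp (- t) <> 0 /\ is_Cpseries beta t (t / (1 - Cexp (- t))).
Proof.
  intros Ht Hh.
  assert (Hb := half_disc_bound beta Cmod_beta).
  assert (Ha : forall k, (Cmod (expm1_coeff k) * (/ 2) ^ k <= 1)%R).
  { apply half_disc_bound. intros k. eapply Rle_trans; [ apply Cmod_expm1_coeff | ].
    apply pow_R1_Rle. lra. }
  destruct (ex_series_Cmod (fun j => beta j * t ^ j) (fun j => Cmod (beta j * t ^ j))) as [v Hv].
  { intros n. apply Rle_refl. }
  { exact (Cpseries_abs_conv beta (/ 2) 1 t Hb Hh). }
  assert (Hp := is_Cpseries_mult beta expm1_coeff (/ 2) 1 t v _ Hb Ha Hh Hv (expm1_Cpseries t Ht)).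
  assert (E : v * ((1 - Cexp (- t)) / t) = 1).
  { refine (is_series_C_unique _ _ _ Hp _).
    refine (is_series_Cext _ _ _ _ _ _ (is_series_finite
      (fun m => (if Nat.eqb m 0 then 1 else 0) * t ^ m) 1 _)).
    - intros n. cbv beta. rewrite beta_conv. reflexivity.
    - simpl. ring.
    - intros [ | k ] Hk; [ lia | ]. simpl. ring. }
  assert (Hne : 1 - Cexp (- t) <> 0).
  { intros Z. rewrite Z in E. apply C1_nz. rewrite <- E. field. exact Ht. }
  split; [ exact Hne | ].
  refine (is_Cpseries_ext _ _ _ _ _ (fun j => eq_refl) _ Hv).
  replace v with (v * ((1 - Cexp (- t)) / t) * (t / (1 - Cexp (- t)))) by (field; auto).
  rewrite E. ring.
Qed.

(* [bern m w] is the paper's b_(m-1)(w). *)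
Definition bern (m : nat) (w : C) : C :=
  csum (fun l => / INR (fact l) * (- w) ^ l * beta (m - l)) (S m).

Lemma bern_Cpseries (w : C) : exists d, (0 < d)%R /\
  forall t, (Cmod t < d)%R -> t <> 0 ->
    is_Cpseries (fun m => bern m w) t (Cexp (- (w * t)) * (t / (1 - Cexp (- t)))).
Proof.
  exists (/ 2)%R. split; [ lra | ]. intros t Ht Ht0.
  destruct (entire_bounds (fun l => / INR (fact l) * (- w) ^ l)
    (fun t => Cexp (- (w * t))) (/ 2) ltac:(lra)) as [B [HB HBj]].
  { intros h. replace (- (w * h)) with (- w * h) by ring.
    refine (is_series_Cext _ _ _ _ _ eq_refl (Cexp_series (- w * h))).
    intros n. cbv beta. rewrite Cpow_mult_l. ring. }
  assert (Hb := half_disc_bound beta Cmod_beta).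
  refine (is_Cpseries_mult (fun l => / INR (fact l) * (- w) ^ l) beta (/ 2) (B + 1) t _ _ _ _ Ht
    _ (proj2 (beta_Cpseries t Ht0 Ht))).
  - intros j. specialize (HBj j). lra.
  - intros j. specialize (Hb j). lra.
  - replace (- (w * t)) with (- w * t) by ring.
    refine (is_series_Cext _ _ _ _ _ eq_refl (Cexp_series (- w * t))).
    intros n. cbv beta. rewrite Cpow_mult_l. ring.
Qed.

(* Multiplying the generating function by 1 - e^(-t). *)
Lemma bern_difference (n : nat) (w : C) :
  bern (S n) w - bern (S n) (w + 1) = / INR (fact n) * (- w) ^ n.
Proof.
  destruct (bern_Cpseries w) as [d [Hd H]]. destruct (bern_Cpseries (w + 1)) as [d' [Hd' H']].
  assert (E : forall m, bern m w - bern m (w + 1) =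
    if Nat.ltb m 1 then 0 else / INR (fact (m - 1)) * (- w) ^ (m - 1)).
  { apply (is_Cpseries_coeffs_unique (fun m => bern m w - bern m (w + 1)) _
      (fun t => t ^ 1 * Cexp (- w * t)) (Rmin (Rmin d d') (/ 2)));
      [ repeat apply Rmin_glb_lt; lra | ].
    intros t Ht Ht0.
    destruct (Rmin_Rgt_l _ _ _ Ht) as [H1 H2]. destruct (Rmin_Rgt_l _ _ _ H1) as [H3 H4].
    assert (Hne := proj1 (beta_Cpseries t Ht0 H2)). split.
    - refine (is_Cpseries_ext _ _ _ _ _ (fun j => eq_refl) _
        (is_Cpseries_minus _ _ _ _ _ (H t H3 Ht0) (H' t H4 Ht0))).
      replace (- ((w + 1) * t)) with (- (w * t) + - t) by ring.
      replace (- w * t) with (- (w * t)) by ring.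
      rewrite Cexp_plus. field. exact Hne.
    - apply (is_Cpseries_shift (fun j => / INR (fact j) * (- w) ^ j)).
      refine (is_series_Cext _ _ _ _ _ eq_refl (Cexp_series (- w * t))).
      intros j. cbv beta. rewrite Cpow_mult_l. ring. }
  rewrite E. simpl. rewrite Nat.sub_0_r. reflexivity.
Qed.

(** Uniqueness of Laurent expansions replaces the [epsilon]-chosen coefficients by the recursively
    computed ones. *)
Lemma b_coeff_eq (j : nat) : b_coeff (Z.of_nat j - 1) = beta j.
Proof.
  unfold b_coeff. rewrite (laurent_coeff_eq _ _ (laurent_of_Cpseries beta 1)).
  - apply (laurent_of_Cpseries_eq beta 1).
  - apply laurent_expansion_of_Cpseries with (d := (/ 2)%R); [ lra | ].
    intros h Hh Hh0. destruct (beta_Cpseries h Hh0 Hh) as [Hne Hs].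
    replace (0 + h) with h by ring.
    refine (is_Cpseries_ext _ _ _ _ _ (fun j => eq_refl) _ Hs). simpl. field. exact Hne.
Qed.

Lemma b_poly_eq (n : nat) (w : C) : b_poly (Z.of_nat n) w = bern (S n) w.
Proof.
  unfold b_poly. rewrite (laurent_coeff_eq _ _ (laurent_of_Cpseries (fun m => bern m w) 1)).
  - rewrite <- (laurent_of_Cpseries_eq (fun m => bern m w) 1 (S n)). f_equal. lia.
  - destruct (bern_Cpseries w) as [d [Hd Hs]].
    apply laurent_expansion_of_Cpseries with (d := Rmin d (/ 2)); [ apply Rmin_glb_lt; lra | ].
    intros h Hh Hh0.
    destruct (Rmin_Rgt_l _ _ _ Hh) as [H1 H2].
    destruct (beta_Cpseries h Hh0 H2) as [Hne _].
    replace (0 + h) with h by ring.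
    refine (is_Cpseries_ext _ _ _ _ _ (fun j => eq_refl) _ (Hs h H1 Hh0)). simpl. field. exact Hne.
Qed.

Lemma b_partial_sum_eq (n : nat) (t : C) :
  b_partial_sum n t = csum (fun j => beta j * (t ^ j / t)) (S (S n)).
Proof.
  unfold b_partial_sum. rewrite csum_sum_n. rewrite Nat.add_1_r.
  apply csum_ext. intros k _. rewrite b_coeff_eq. reflexivity.
Qed.

(** * Euler-Maclaurin summation *)

(** The Pochhammer symbol (s)_j. In this section a prime marks the derivative in [s]. *)
Fixpoint rising (s : C) (j : nat) : C :=
  match j with O => 1 | S i => rising s i * (s + INR i) end.

Fixpoint rising' (s : C) (j : nat) : C :=
  match j with O => 0 | S i => rising' s i * (s + INR i) + rising s i end.

Definition em_term (s x : C) (j : nat) : C := beta j * rising s j * Cpower x (- s - INR j).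

Definition em_term' (s x : C) (j : nat) : C :=
  beta j * (rising' s j - rising s j * Clog x) * Cpower x (- s - INR j).

(* Euler-Maclaurin for s zeta(s + 1, x): truncation of the asymptotic expansion at infinity. *)
Definition em_sum (N : nat) (s x : C) : C := csum (em_term s x) N.

Definition em_sum' (N : nat) (s x : C) : C := csum (em_term' s x) N.

Definition em_rem (N : nat) (s x : C) : C :=
  s * Cpower x (- s - 1) - em_sum N s x + em_sum N s (x + 1).

Definition em_rem' (N : nat) (s x : C) : C :=
  (1 - s * Clog x) * Cpower x (- s - 1) - em_sum' N s x + em_sum' N s (x + 1).

Lemma entire_rising (j : nat) : entire (fun s => rising s j) (fun s => rising' s j).
Proof.
  induction j as [ | j IH ]; simpl.
  - apply entire_const.
  - refine (entire_ext _ _ _ _ (fun s => eq_refl) _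
      (entire_mult _ _ _ _ IH (entire_plus _ _ _ _ entire_id (entire_const (INR j))))).
    intros s. cbv beta. ring.
Qed.

Lemma entire_Cpower (x a : C) :
  entire (fun s => Cpower x (- s - a)) (fun s => - Clog x * Cpower x (- s - a)).
Proof.
  refine (entire_ext _ _ _ _ _ _ (entire_Cexp (- Clog x) (- a * Clog x)));
    intros s; cbv beta; unfold Cpower; [ | apply f_equal ]; f_equal; ring.
Qed.

Lemma entire_em_sum (N : nat) (x : C) : entire (fun s => em_sum N s x) (fun s => em_sum' N s x).
Proof.
  apply (entire_csum (fun j s => em_term s x j) (fun j s => em_term' s x j)). intros j.
  refine (entire_ext _ _ _ _ _ _ (entire_scal (beta j) _ _
    (entire_mult _ _ _ _ (entire_rising j) (entire_Cpower x (INR j)))));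
    intros s; cbv beta; unfold em_term, em_term'; ring.
Qed.

Lemma entire_em_rem (N : nat) (x : C) : entire (fun s => em_rem N s x) (fun s => em_rem' N s x).
Proof.
  refine (entire_ext _ _ _ _ _ _ (entire_plus _ _ _ _ (entire_minus _ _ _ _
    (entire_mult _ _ _ _ entire_id (entire_Cpower x 1)) (entire_em_sum N x))
    (entire_em_sum N (x + 1))));
    intros s; cbv beta; unfold em_rem, em_rem'; ring.
Qed.

Lemma bern_0 (m : nat) : bern m 0 = beta m.
Proof.
  unfold bern. rewrite csum_shift, csum_zero.
  - rewrite Nat.sub_0_r. simpl. field.
  - intros k _. rewrite Cpow_S. ring.
Qed.

(** [bern_difference] at w = 0. The exceptional index 1 is what produces the summand s x^(-s-1) of
    the remainder, because (s)_1 = s. *)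
Lemma bern_1 (m : nat) : bern m 1 = beta m - (if Nat.eqb m 1 then 1 else 0).
Proof.
  destruct m as [ | m ].
  - unfold bern. simpl. field.
  - assert (E := bern_difference m 0). rewrite bern_0 in E.
    replace (0 + 1) with (RtoC 1) in E by ring.
    replace (bern (S m) 1) with (beta (S m) - (beta (S m) - bern (S m) 1)) by ring.
    rewrite E. destruct m as [ | m ].
    + simpl. field.
    + rewrite Cpow_S. simpl. ring.
Qed.

(** In the generating function, differentiating e^(ut) in u multiplies by t, which shifts the index
    by one. *)
Lemma is_Rderive_bern (m : nat) (u : R) :
  is_Rderive (fun u => bern (S m) (- RtoC u)) u (bern m (- RtoC u)).
Proof.
  apply (is_Rderive_ext (fun u => beta (S m) +
    csum (fun l => (/ INR (fact (S l)) * beta (m - l)) * RtoC u ^ S l) (S m))).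
  { intros x. unfold bern. rewrite (csum_shift _ (S m)). f_equal.
    - simpl. field.
    - apply csum_ext. intros k _. replace (- - RtoC x) with (RtoC x) by ring.
      replace (S m - S k)%nat with (m - k)%nat by lia. ring. }
  eapply is_Rderive_eq; [ | apply is_Rderive_plus; [ apply is_Rderive_const
    | apply (is_Rderive_csum (fun l u => (/ INR (fact (S l)) * beta (m - l)) * RtoC u ^ S l)
        u (fun l => (/ INR (fact (S l)) * beta (m - l)) * (INR (S l) * RtoC u ^ l * 1))) ] ].
  - rewrite Cplus_0_l. unfold bern. apply csum_ext. intros k _.
    replace (- - RtoC u) with (RtoC u) by ring. rewrite RtoC_INR_fact_S. field.
    split; [ apply INR_fact_C_neq_0 | apply INR_S_C_neq_0 ].
  - intros k _. apply is_Rderive_scal, is_Rderive_pow, is_Rderive_id.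
Qed.

(* Interpolates between the two copies of [em_sum] in [em_rem]; all but one term of its derivative
   cancel because bern_(m+1)(-u) is an antiderivative of bern_m(-u). *)
Definition em_path (N : nat) (s x : C) (u : R) : C :=
  csum (fun j => bern j (- RtoC u) * rising s j * Cpower (x + 1 + RtoC u) (- s - INR j)) N.

Lemma is_Rderive_em_path (M : nat) (s x : C) (u : R) :
  (0 < Re (x + 1 + RtoC u))%R ->
  is_Rderive (em_path (S M) s x) u
    (- bern M (- RtoC u) * rising s (S M) * Cpower (x + 1 + RtoC u) (- s - INR (S M))).
Proof.
  intros Hp.
  assert (Hlin : is_Rderive (fun u => x + 1 + RtoC u) u 1).
  { refine (is_Rderive_eq _ _ _ _ _ (is_Rderive_plus _ _ _ _ _
      (is_Rderive_const (x + 1) u) (is_Rderive_id u))). ring. }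
  assert (Hpow : forall j, is_Rderive (fun u => Cpower (x + 1 + RtoC u) (- s - INR j)) u
    (- (s + INR j) * Cpower (x + 1 + RtoC u) (- s - INR (S j)))).
  { intros j. refine (is_Rderive_eq _ _ _ _ _ (is_Rderive_Cpower _ _ _ (- s - INR j) Hlin Hp)).
    rewrite S_INR, RtoC_plus.
    replace (- s - INR j - 1) with (- s - (INR j + 1)) by ring. ring. }
  induction M as [ | M IH ].
  - apply (is_Rderive_ext (fun u => Cpower (x + 1 + RtoC u) (- s - INR 0))).
    { intros v. unfold em_path, bern. simpl. rewrite beta_0. field. }
    refine (is_Rderive_eq _ _ _ _ _ (Hpow O)).
    unfold bern. simpl csum. rewrite beta_0. simpl. field.
  - refine (is_Rderive_eq _ _ _ _ _ (is_Rderive_plus _ _ _ _ _ IH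
      (is_Rderive_mult _ _ _ _ _ (is_Rderive_mult _ _ _ _ _ (is_Rderive_bern M u)
        (is_Rderive_const (rising s (S M)) u)) (Hpow (S M))))).
    cbv beta. change (rising s (S (S M))) with (rising s (S M) * (s + INR (S M))). ring.
Qed.

(** The endpoints u = 0 and u = -1 correspond to x + 1 and x. The order is at least 2 so that the
    path contains the exceptional term j = 1. *)
Lemma em_rem_path (M : nat) (s x : C) :
  em_rem (S (S M)) s x = em_path (S (S M)) s x 0 - em_path (S (S M)) s x (-1).
Proof.
  assert (E0 : em_path (S (S M)) s x 0 = em_sum (S (S M)) s (x + 1)).
  { apply csum_ext. intros j _. unfold em_term. replace (- RtoC 0) with (RtoC 0) by ring.
    rewrite bern_0. replace (x + 1 + 0) with (x + 1) by ring. reflexivity. }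
  assert (E1 : em_path (S (S M)) s x (-1) = em_sum (S (S M)) s x - s * Cpower x (- s - 1)).
  { unfold em_sum.
    assert (Es : csum (fun j => if Nat.eqb j 1 then s * Cpower x (- s - 1) else 0) (S (S M))
      = s * Cpower x (- s - 1)).
    { rewrite (csum_single _ _ 1); [ reflexivity | lia | ].
      intros k _ Hk. apply Nat.eqb_neq in Hk. rewrite Hk. reflexivity. }
    rewrite <- Es, <- csum_minus. apply csum_ext. intros j _. unfold em_term.
    replace (- RtoC (-1)) with (RtoC 1) by ring. rewrite bern_1.
    replace (x + 1 + RtoC (-1)) with x by ring.
    destruct (Nat.eqb_spec j 1) as [ -> | Hj ]; [ simpl rising; simpl INR | ]; ring. }
  rewrite E0, E1. unfold em_rem. ring.
Qed.

Lemma Cmod_Cpower_opp_le (z s : C) (y : R) : (0 < y)%R -> (y <= Re z)%R -> (0 <= Re s)%R ->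
  (Cmod (Cpower z (- s)) <= exp (- Re s * ln y) * exp (2 * Rabs (Im s)))%R.
Proof.
  intros Hy Hz Hs. eapply Rle_trans; [ apply Cmod_Cpower_le; lra | ].
  rewrite Re_opp, Im_opp, Rabs_Ropp.
  apply Rmult_le_compat_r; [ left; apply exp_pos | ]. apply exp_le_compat.
  assert (L : (ln y <= ln (Cmod z))%R).
  { apply ln_le; [ exact Hy | ]. eapply Rle_trans; [ exact Hz | ].
    eapply Rle_trans; [ apply Rle_abs | apply re_le_Cmod ]. }
  nra.
Qed.

Lemma bern_bounded (m : nat) : exists B, (0 <= B)%R /\
  forall w, (Cmod w <= 1)%R -> (Cmod (bern m w) <= B)%R.
Proof.
  unfold bern. generalize (S m) as n. induction n as [ | n [B [HB IH]] ].
  - exists 0%R. split; [ lra | ]. intros w _. simpl. rewrite Cmod_0. lra.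
  - exists (B + Cmod (/ INR (fact n)) * Cmod (beta (m - n)))%R. split.
    + apply Rplus_le_le_0_compat; [ exact HB | apply Rmult_le_pos; apply Cmod_ge_0 ].
    + intros w Hw. simpl csum. eapply Rle_trans; [ apply Cmod_triangle | ].
      apply Rplus_le_compat; [ apply IH, Hw | ].
      rewrite !Cmod_mult, Cmod_pow, Cmod_opp.
      assert (P := pow_incr (Cmod w) 1 n (conj (Cmod_ge_0 w) Hw)). rewrite pow1 in P.
      apply Rmult_le_compat_r; [ apply Cmod_ge_0 | ].
      rewrite <- (Rmult_1_r (Cmod (/ INR (fact n)))) at 2.
      apply Rmult_le_compat_l; [ apply Cmod_ge_0 | exact P ].
Qed.

Lemma rising_bounded (s0 : C) (N : nat) : exists B, (0 <= B)%R /\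
  forall h, (Cmod h <= 1)%R -> (Cmod (rising (s0 + h) N) <= B)%R.
Proof.
  induction N as [ | N [B [HB IH]] ].
  - exists 1%R. split; [ lra | ]. intros h _. simpl. rewrite Cmod_1. lra.
  - exists (B * (Cmod s0 + 1 + INR N))%R.
    assert (H0 := Cmod_ge_0 s0). assert (HN := pos_INR N). split.
    + apply Rmult_le_pos; lra.
    + intros h Hh. simpl. rewrite Cmod_mult.
      apply Rmult_le_compat; try apply Cmod_ge_0; [ apply IH, Hh | ].
      eapply Rle_trans; [ apply Cmod_triangle | ].
      rewrite Cmod_R, Rabs_pos_eq by exact HN.
      assert (T := Cmod_triangle s0 h). lra.
Qed.

(** Comparison 1/k^2 <= 2 (1/k - 1/(k+1)) with a telescoping series. *)
Lemma ex_series_inv_sqr (a : R) : ex_series (fun k => a * / INR (S k) ^ 2)%R.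
Proof.
  assert (Hpos : forall k, (0 < INR (S k))%R) by (intros k; apply lt_0_INR; lia).
  assert (T : is_series (fun k => RtoC (/ INR (S k)) - RtoC (/ INR (S (S k)))) (RtoC (/ INR 1))).
  { apply (is_series_telescope (fun k => RtoC (/ INR (S k)))).
    intros eps Heps. destruct (archimed_cor1 eps Heps) as [N [HN1 HN2]].
    exists N. intros n Hn. rewrite Cmod_R.
    assert (P := Rinv_0_lt_compat _ (Hpos n)). rewrite Rabs_pos_eq by lra.
    eapply Rle_lt_trans; [ | exact HN1 ]. apply Rinv_le_contravar; [ apply lt_0_INR, HN2 | ].
    apply le_INR. lia. }
  apply is_series_C_components in T. destruct T as [T _].
  apply (ex_series_scal (V := R_NormedModule) a).
  refine (ex_series_le (V := R_CompleteNormedModule) _ _ _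
    (ex_intro _ _ (is_series_scal (V := R_NormedModule) 2%R _ _ T))).
  intros k. unfold norm; simpl norm. unfold abs; cbn [AbsRing.abs R_AbsRing].
  change (Rabs (/ INR (S k) ^ 2) <= 2 * (/ INR (S k) - / INR (S (S k))))%R.
  assert (H1 := Hpos k). rewrite (S_INR (S k)). set (x := INR (S k)) in *.
  assert (H2 : (1 <= x)%R) by (unfold x; change 1%R with (INR 1); apply le_INR; lia).
  assert (H3 : (0 < / x ^ 2)%R) by (apply Rinv_0_lt_compat; nra).
  rewrite Rabs_pos_eq by lra.
  replace (2 * (/ x - / (x + 1)))%R with (/ x ^ 2 * (2 * x / (x + 1)))%R by (field; lra).
  rewrite <- (Rmult_1_r (/ x ^ 2)) at 1. apply Rmult_le_compat_l; [ lra | ].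
  apply Rle_div_r; lra.
Qed.

(** A lower bound proportional to k + 1, valid from k = 0 on; it makes powers of k + w comparable
    with powers of k + 1. *)
Lemma Re_shift_lower (w : C) (k : nat) : (0 < Re w)%R ->
  (0 < Rmin 1 (Re w) * INR (S k) <= Re (INR k + w))%R.
Proof.
  intros Hw. assert (Hm : (0 < Rmin 1 (Re w))%R) by (apply Rmin_glb_lt; lra).
  assert (H1 := Rmin_l 1 (Re w)). assert (H2 := Rmin_r 1 (Re w)).
  assert (Hk := pos_INR k). rewrite S_INR, Re_plus, re_RtoC. split; nra.
Qed.

(** The remainder is an increment of [em_path], so it is bounded by the derivative of that path,
    which is of size (k+1)^(-Re s-N). For |h| <= 1 the exponent Re s + N stays at least 2, hence the
    threshold 3 at the centre. The bound is uniform in h, as the Weierstrass theorem requires. *)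
Lemma em_rem_bound (w s0 : C) (N : nat) :
  (0 < Re w)%R -> (3 <= Re s0 + INR N)%R -> (2 <= N)%nat ->
  exists A, ex_series A /\ forall k h, (Cmod h <= 1)%R ->
    (Cmod (em_rem N (s0 + h) (INR k + w)) <= A k)%R.
Proof.
  intros Hw HN HN2. destruct N as [ | [ | M ] ]; [ lia | lia | ].
  destruct (bern_bounded (S M)) as [B1 [HB1 Hbern]].
  destruct (rising_bounded s0 (S (S M))) as [B2 [HB2 Hris]].
  set (m := Rmin 1 (Re w)).
  (* T is the largest exponent on the disc. Since ln m <= 0, the factor m^(-a) is worst at a = T,
     while the factor from k + 1 needs only a >= 2. *)
  set (T := (Re s0 + INR (S (S M)) + 1)%R) in *.
  set (I0 := (Rabs (Im s0) + 1)%R).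
  exists (fun k => 2 * (B1 * B2 * (exp (- T * ln m) * exp (2 * I0))) * / INR (S k) ^ 2)%R.
  split; [ apply ex_series_inv_sqr | ].
  intros k h Hh. rewrite em_rem_path.
  assert (Hlow := Re_shift_lower w k Hw). fold m in Hlow.
  assert (Hm : (0 < m)%R) by (apply Rmin_glb_lt; lra).
  assert (Hm1 : (m <= 1)%R) by apply Rmin_l.
  assert (Hk : (0 < INR (S k))%R) by (apply lt_0_INR; lia).
  assert (HRe : forall u, (-1 <= u <= 0)%R ->
    (m * INR (S k) <= Re (INR k + w + 1 + RtoC u))%R).
  { intros u Hu. rewrite !(Re_plus (_ + _)), !re_RtoC. lra. }
  eapply Rle_trans.
  - apply is_Rderive_bound with
      (df := fun u => - bern (S M) (- RtoC u) * rising (s0 + h) (S (S M)) *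
        Cpower (INR k + w + 1 + RtoC u) (- (s0 + h) - INR (S (S M))))
      (M := (B1 * B2 * (exp (- T * ln m) * exp (2 * I0) * / INR (S k) ^ 2))%R).
    + lra.
    + intros u Hu. apply is_Rderive_em_path. specialize (HRe u Hu). lra.
    + intros u Hu. rewrite !Cmod_mult, Cmod_opp.
      apply Rmult_le_compat; [ apply Rmult_le_pos; apply Cmod_ge_0 | apply Cmod_ge_0 | | ].
      * apply Rmult_le_compat; try apply Cmod_ge_0; [ | apply Hris, Hh ].
        apply Hbern. rewrite Cmod_opp, Cmod_R. apply Rabs_le. lra.
      * replace (- (s0 + h) - INR (S (S M))) with (- (s0 + h + INR (S (S M)))) by ring.
        assert (Hre := re_le_Cmod h). assert (Him := Rabs_Im_le_Cmod h).
        apply Rabs_le_between in Hre.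
        assert (Hb : (2 <= Re (s0 + h + INR (S (S M))) <= T)%R).
        { rewrite !(Re_plus _ _), re_RtoC. unfold T. lra. }
        eapply Rle_trans; [ apply (Cmod_Cpower_opp_le _ _ (m * INR (S k)) (proj1 Hlow) (HRe u Hu)); lra | ].
        set (a := Re (s0 + h + INR (S (S M)))) in *.
        assert (Hexp : (exp (2 * Rabs (Im (s0 + h + INR (S (S M))))) <= exp (2 * I0))%R).
        { apply exp_le_compat. rewrite !(Im_plus _ _), im_RtoC, Rplus_0_r.
          assert (Tr := Rabs_triang (Im s0) (Im h)). unfold I0. lra. }
        replace (exp (- T * ln m) * exp (2 * I0) * / INR (S k) ^ 2)%R
          with (exp (- T * ln m) * / INR (S k) ^ 2 * exp (2 * I0))%R by ring.
        apply Rmult_le_compat; try (left; apply exp_pos); [ | exact Hexp ].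
        replace (/ INR (S k) ^ 2)%R with (exp (- (2 * ln (INR (S k))))).
        -- rewrite <- exp_plus. apply exp_le_compat. rewrite ln_mult by assumption.
           assert (L1 : (ln m <= 0)%R) by (rewrite <- ln_1; apply ln_le; assumption).
           assert (L2 : (0 <= ln (INR (S k)))%R).
           { rewrite <- ln_1. apply ln_le; [ lra | ]. change 1%R with (INR 1). apply le_INR. lia. }
           nra.
        -- rewrite exp_Ropp. f_equal. replace (2 * ln (INR (S k)))%R with (ln (INR (S k) ^ 2)).
           ++ apply exp_ln. apply pow_lt, Hk.
           ++ rewrite ln_pow by exact Hk. simpl. ring.
  - right. ring.
Qed.

Lemma Cpower_vanishes (w t c : C) :
  (0 < Re w)%R -> (0 < Re t)%R ->
  forall eps, (0 < eps)%R -> exists N, forall n, (N <= n)%nat ->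
    (Cmod (c * Cpower (INR n + w) (- t)) < eps)%R.
Proof.
  intros Hw Ht eps Heps.
  set (B := (Cmod c * exp (2 * Rabs (Im t)) + 1)%R).
  assert (HB : (0 < B)%R).
  { unfold B. assert (P := Rmult_le_pos _ _ (Cmod_ge_0 c) (Rlt_le _ _ (exp_pos (2 * Rabs (Im t))))). lra. }
  set (m := Rmin 1 (Re w)). assert (Hm : (0 < m)%R) by (apply Rmin_glb_lt; lra).
  assert (HBe : (0 < B / eps)%R) by (apply Rdiv_lt_0_compat; assumption).
  (* Once ln y > L, the crude bound exp(-x) <= 1/x at x = Re t ln y is already below eps/B. *)
  set (L := (B / eps / Re t)%R). assert (HL0 : (0 < L)%R) by (apply Rdiv_lt_0_compat; assumption).
  destruct (INR_unbounded (exp L / m)) as [N HN].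
  exists N. intros n Hn.
  assert (Hlow := Re_shift_lower w n Hw). fold m in Hlow. set (y := (m * INR (S n))%R) in *.
  assert (HL : (L < ln y)%R).
  { rewrite <- (ln_exp L). apply ln_increasing; [ apply exp_pos | ].
    apply Rlt_div_l in HN; [ | exact Hm ].
    assert (HnN : (INR N <= INR (S n))%R) by (apply le_INR; lia).
    assert (H := Rmult_le_compat_l m _ _ (Rlt_le _ _ Hm) HnN). unfold y. lra. }
  apply Rmult_lt_compat_l with (r := Re t) in HL; [ | exact Ht ].
  replace (Re t * L)%R with (B / eps)%R in HL by (unfold L; field; lra).
  rewrite Cmod_mult. eapply Rle_lt_trans.
  { apply Rmult_le_compat_l; [ apply Cmod_ge_0 | ].
    apply (Cmod_Cpower_opp_le _ t y (proj1 Hlow) (proj2 Hlow)). lra. }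
  assert (HE := exp_opp_le_inv (Re t * ln y) ltac:(lra)). rewrite <- Ropp_mult_distr_l.
  set (e := exp (- (Re t * ln y))) in *. assert (He : (0 < e)%R) by apply exp_pos.
  assert (Hinv : (/ (Re t * ln y) < eps / B)%R).
  { replace (eps / B)%R with (/ (B / eps))%R by (field; lra). apply Rinv_0_lt_contravar; lra. }
  apply Rle_lt_trans with (B * e)%R; [ unfold B; nra | ].
  replace eps with (B * (eps / B))%R by (field; lra). apply Rmult_lt_compat_l; lra.
Qed.

Lemma em_term_vanishes (w s : C) (j : nat) :
  (0 < Re w)%R -> (0 < Re s + INR j)%R ->
  forall eps, (0 < eps)%R -> exists N, forall n, (N <= n)%nat ->
    (Cmod (em_term s (INR n + w) j) < eps)%R.
Proof.
  intros Hw Hs eps Heps.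
  destruct (Cpower_vanishes w (s + INR j) (beta j * rising s j) Hw Hs eps Heps) as [N HN].
  exists N. intros n Hn. unfold em_term.
  replace (- s - INR j) with (- (s + INR j)) by ring. apply HN, Hn.
Qed.

(* [v] is the value at [s] of the entire function s zeta(s + 1, w). *)
Definition em_value (w : C) (N : nat) (s v : C) : Prop :=
  is_series (fun k => em_rem N s (INR k + w)) (v - em_sum N s w).

Lemma INR_0_plus (w : C) : INR 0 + w = w.
Proof. simpl. ring. Qed.

Lemma INR_S_plus (k : nat) (w : C) : INR (S k) + w = INR k + w + 1.
Proof. rewrite S_INR, RtoC_plus. ring. Qed.

(** Raising the order by one changes the remainders by differences of consecutive values of the new
    term, which telescope because that term tends to 0 when Re s + N > 0. The value therefore does
    not depend on the order. *)
Lemma em_value_step (w s v : C) (N : nat) :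
  (0 < Re w)%R -> (0 < Re s + INR N)%R -> em_value w N s v <-> em_value w (S N) s v.
Proof.
  intros Hw Hs.
  assert (G : is_series (fun k => em_term s (INR k + w) N - em_term s (INR (S k) + w) N)
    (em_term s (INR 0 + w) N)).
  { apply (is_series_telescope (fun k => em_term s (INR k + w) N)).
    apply em_term_vanishes; assumption. }
  rewrite INR_0_plus in G.
  unfold em_value. split; intros H.
  - refine (is_series_Cext _ _ _ _ _ _ (is_series_Cminus _ _ _ _ H G)).
    + intros k. rewrite INR_S_plus. unfold em_rem, em_sum. simpl csum. ring.
    + unfold em_sum. simpl csum. ring.
  - refine (is_series_Cext _ _ _ _ _ _ (is_series_Cplus _ _ _ _ H G)).
    + intros k. rewrite INR_S_plus. unfold em_rem, em_sum. simpl csum. ring.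
    + unfold em_sum. simpl csum. ring.
Qed.

Lemma em_value_steps (w s v : C) (N d : nat) :
  (0 < Re w)%R -> (0 < Re s + INR N)%R -> em_value w N s v <-> em_value w (N + d) s v.
Proof.
  intros Hw Hs. induction d as [ | d IH ].
  - rewrite Nat.add_0_r. reflexivity.
  - rewrite IH, Nat.add_succ_r. apply em_value_step; [ exact Hw | ].
    rewrite plus_INR. assert (P := pos_INR d). lra.
Qed.

Lemma exists_em_order (s : C) : exists N, (2 <= N)%nat /\ (3 <= Re s + INR N)%R.
Proof.
  destruct (INR_unbounded (3 + Rabs (Re s))) as [N HN]. exists N.
  assert (Hr := Rle_abs (- Re s)). rewrite Rabs_Ropp in Hr. assert (Hp := Rabs_pos (Re s)).
  split; [ apply INR_le; simpl; lra | lra ].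
Qed.

(** Convergence is known at one large order N0; the common order N + N0 transfers the value to every
    admissible N. *)
Lemma em_value_exists (w : C) : (0 < Re w)%R ->
  exists Z, forall s N, (0 < Re s + INR N)%R -> em_value w N s (Z s).
Proof.
  intros Hw.
  apply (functional_choice (fun s v => forall N, (0 < Re s + INR N)%R -> em_value w N s v)).
  intros s. destruct (exists_em_order s) as [N0 [HN2 HN0]].
  destruct (em_rem_bound w s N0 Hw HN0 HN2) as [A [HA Hb]].
  destruct (ex_series_Cmod (fun k => em_rem N0 s (INR k + w)) A) as [v Hv]; [ | exact HA | ].
  { intros k. specialize (Hb k 0). rewrite Cmod_0 in Hb. replace (s + 0) with s in Hb by ring.
    apply Hb. lra. }
  exists (v + em_sum N0 s w). intros N HN.
  apply (proj2 (em_value_steps w s (v + em_sum N0 s w) N N0 Hw HN)). rewrite Nat.add_comm.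
  apply (proj1 (em_value_steps w s (v + em_sum N0 s w) N0 N Hw ltac:(lra))).
  unfold em_value. replace (v + em_sum N0 s w - em_sum N0 s w) with v by ring. exact Hv.
Qed.

(** The Weierstrass theorem on the unit disc around s0, where |h| < 1 keeps Re s + N positive. One
    [c] serves all orders, so its derivative coefficient may later be computed at whichever order is
    convenient. *)
Lemma em_value_analytic (w : C) (Z : C -> C) :
  (0 < Re w)%R -> (forall s N, (0 < Re s + INR N)%R -> em_value w N s (Z s)) ->
  forall s0, exists c, (forall h, (Cmod h < 1)%R -> is_Cpseries c h (Z (s0 + h))) /\
    forall N, (2 <= N)%nat -> (3 <= Re s0 + INR N)%R ->
      is_series (fun k => em_rem' N s0 (INR k + w)) (c 1%nat - em_sum' N s0 w).
Proof.
  intros Hw HZ s0.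
  assert (Hone : forall N, (2 <= N)%nat -> (3 <= Re s0 + INR N)%R ->
    exists c, (forall h, (Cmod h < 1)%R -> is_Cpseries c h (Z (s0 + h))) /\
      is_series (fun k => em_rem' N s0 (INR k + w)) (c 1%nat - em_sum' N s0 w)).
  { intros N HN2 HN3.
    destruct (em_rem_bound w s0 N Hw HN3 HN2) as [A [HA Hb]].
    destruct (functional_choice (fun k c => c 1%nat = em_rem' N s0 (INR k + w) /\
      forall h, is_Cpseries c h (em_rem N (s0 + h) (INR k + w)))) as [c Hc].
    { intros k. destruct (entire_em_rem N (INR k + w) s0) as [c [_ [H1 H2]]].
      exists c. split; assumption. }
    destruct (Weierstrass_series (fun k h => em_rem N (s0 + h) (INR k + w)) c 1 A
      Rlt_0_1 (fun k => proj2 (Hc k)) Hb HA) as [d [Hd1 Hd]].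
    destruct (entire_em_sum N w s0) as [e [_ [He1 He]]].
    exists (fun j => d j + e j). split.
    - intros h Hh.
      assert (Hre := re_le_Cmod h). apply Rabs_le_between in Hre.
      assert (HV := HZ (s0 + h) N ltac:(rewrite Re_plus; lra)).
      refine (is_Cpseries_ext _ _ _ _ _ (fun j => eq_refl) _
        (is_Cpseries_plus _ _ _ _ _ (Hd h _ Hh HV) (He h))). ring.
    - refine (is_series_Cext _ _ _ _ _ _ (Hd1 1%nat)).
      + intros k. apply (proj1 (Hc k)).
      + rewrite He1. ring. }
  destruct (exists_em_order s0) as [N0 [HN2 HN0]].
  destruct (Hone N0 HN2 HN0) as [c [Hc _]].
  exists c. split; [ exact Hc | ]. intros N HN HN3.
  destruct (Hone N HN HN3) as [c' [Hc' Hs]].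
  (* Different orders expand the same function [Z], so their coefficients agree. *)
  rewrite (is_Cpseries_coeffs_unique c c' (fun h => Z (s0 + h)) 1 Rlt_0_1); [ exact Hs | ].
  intros h Hh _. split; auto.
Qed.

(** * Analytic continuation and its uniqueness *)

(** Agreement is asked on a punctured neighbourhood, because the value at a pole is
    unconstrained. *)
Definition eventually_eq (f g : C -> C) (p : C) : Prop := locally' p (fun s => f s = g s).

(** A common power (s-p)^M clears both poles; the difference is then a power series with zeros
    accumulating at p, so all its coefficients vanish. *)
Lemma meromorphic_accumulation (f g : C -> C) (p : C) :
  meromorphic f -> meromorphic g ->
  (forall e, (0 < e)%R -> exists q, (Cmod (q - p) < e)%R /\ q <> p /\ f q = g q) ->
  eventually_eq f g p.
Proof.
  intros Hf Hg Hacc.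
  destruct (Hf p) as [a [Ha _]]. destruct (Hg p) as [b [Hb _]].
  destruct (laurent_Cpseries _ _ _ Ha) as [N [_ [d [Hd Hsa]]]].
  destruct (laurent_Cpseries _ _ _ Hb) as [N' [_ [d' [Hd' Hsb]]]].
  set (M := (N + N')%nat). set (r := Rmin d d').
  assert (Hr : (0 < r)%R) by (apply Rmin_glb_lt; assumption).
  set (c := fun j => a (Z.of_nat j - Z.of_nat M)%Z - b (Z.of_nat j - Z.of_nat M)%Z).
  assert (Hs : forall h, (Cmod h < r)%R -> h <> 0 ->
    is_Cpseries c h (h ^ M * f (p + h) - h ^ M * g (p + h))).
  { intros h Hh Hh0. apply is_Cpseries_minus.
    - apply Hsa; [ unfold M; lia | | exact Hh0 ]. eapply Rlt_le_trans; [ exact Hh | apply Rmin_l ].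
    - apply Hsb; [ unfold M; lia | | exact Hh0 ]. eapply Rlt_le_trans; [ exact Hh | apply Rmin_r ]. }
  assert (Hc : forall j, c j = 0).
  { refine (is_Cpseries_coeffs_zero c _ r Hr Hs _).
    intros e He. destruct (Hacc e He) as [q [Hq [Hqp E]]].
    exists (q - p). split; [ exact Hq | ]. split; [ exact (Cminus_neq_0 _ _ Hqp) | ].
    replace (p + (q - p)) with q by ring. rewrite E. ring. }
  apply locally'_Cmod. exists r. split; [ exact Hr | ]. intros s Hsr Hsp.
  assert (Hh0 := Cminus_neq_0 _ _ Hsp).
  assert (E : (s - p) ^ M * f (p + (s - p)) = (s - p) ^ M * g (p + (s - p))).
  { apply Cminus_eq_0, (is_series_C_unique _ _ _ (Hs _ Hsr Hh0)).
    apply (is_series_finite _ 0). intros k _. rewrite Hc. ring. }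
  replace (p + (s - p)) with s in E by ring.
  assert (Hp := Cpow_nz _ M Hh0).
  replace (f s) with ((s - p) ^ M * f s / (s - p) ^ M) by (field; exact Hp).
  rewrite E. field. exact Hp.
Qed.

(** Of the two candidates q + d/2 and q + d/3 at most one equals p. *)
Lemma exists_close_avoiding (p q : C) (d : R) : (0 < d)%R ->
  exists s, (Cmod (s - q) < d)%R /\ s <> q /\ s <> p.
Proof.
  intros Hd.
  assert (Hc : forall y, (0 < y < d)%R -> q + RtoC y <> p ->
    exists s, (Cmod (s - q) < d)%R /\ s <> q /\ s <> p).
  { intros y Hy Hyp. exists (q + RtoC y). assert (Ey : q + RtoC y - q = RtoC y) by ring.
    repeat split; [ rewrite Ey, Cmod_RtoC_pos; lra | | exact Hyp ].
    intros E. rewrite E in Ey. apply (RtoC_neq_0 y (proj1 Hy)). rewrite <- Ey. ring. }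
  destruct (classic (q + RtoC (d / 2) = p)) as [E | E]; [ | exact (Hc (d / 2)%R ltac:(lra) E) ].
  apply (Hc (d / 3)%R ltac:(lra)). intros E2. rewrite <- E in E2.
  assert (E3 : RtoC (d / 3) = RtoC (d / 2)).
  { replace (RtoC (d / 3)) with (q + RtoC (d / 3) - q) by ring. rewrite E2. ring. }
  apply RtoC_inj in E3. lra.
Qed.

Lemma eventually_eq_points (f g : C -> C) (p q : C) (e : R) :
  eventually_eq f g q -> (Cmod (q - p) < e)%R ->
  exists s, (Cmod (s - p) < e)%R /\ s <> p /\ f s = g s.
Proof.
  intros Hq Hqe. apply locally'_Cmod in Hq. destruct Hq as [d [Hd Hs]].
  assert (Hx1 := Rmin_l d (e - Cmod (q - p))). assert (Hx2 := Rmin_r d (e - Cmod (q - p))).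
  destruct (exists_close_avoiding p q (Rmin d (e - Cmod (q - p)))) as [s [Hsq [Hsnq Hsp]]].
  { apply Rmin_glb_lt; lra. }
  exists s. repeat split; [ | exact Hsp | apply Hs; [ lra | exact Hsnq ] ].
  replace (s - p) with ((s - q) + (q - p)) by ring.
  eapply Rle_lt_trans; [ apply Cmod_triangle | ]. lra.
Qed.

(* The points of a segment up to which the two functions agree form a closed and open set. *)
Lemma meromorphic_identity (f g : C -> C) (p0 p1 : C) :
  meromorphic f -> meromorphic g -> eventually_eq f g p0 -> eventually_eq f g p1.
Proof.
  intros Hf Hg H0.
  set (p := fun t : R => p0 + RtoC t * (p1 - p0)).
  (* The added 1 keeps this Lipschitz constant positive when p0 = p1. *)
  set (L := (Cmod (p1 - p0) + 1)%R).
  assert (HL : (0 < L)%R) by (unfold L; assert (P := Cmod_ge_0 (p1 - p0)); lra).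
  assert (Hdist : forall t u, (Cmod (p t - p u) <= Rabs (t - u) * L)%R).
  { intros t u. replace (p t - p u) with (RtoC (t - u) * (p1 - p0))
      by (unfold p; rewrite RtoC_minus; ring).
    rewrite Cmod_mult, Cmod_R. apply Rmult_le_compat_l; [ apply Rabs_pos | unfold L; lra ]. }
  set (E := fun t => (0 <= t <= 1)%R /\ forall u, (0 <= u <= t)%R -> eventually_eq f g (p u)).
  assert (E0 : E 0%R).
  { split; [ lra | ]. intros u Hu. replace u with 0%R by lra.
    replace (p 0%R) with p0 by (unfold p; ring). exact H0. }
  destruct (completeness E) as [T [HT1 HT2]].
  { exists 1%R. intros t [Ht _]. lra. }
  { exists 0%R. exact E0. }
  assert (HT0 : (0 <= T)%R) by (apply HT1; exact E0).
  assert (HT : (T <= 1)%R) by (apply HT2; intros t [Ht _]; lra).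
  assert (Hbelow : forall u, (0 <= u < T)%R -> eventually_eq f g (p u)).
  { intros u Hu. destruct (classic (exists t, E t /\ (u < t)%R)) as [[t [[_ Ht] Hut]] | Hn].
    - apply Ht. lra.
    - exfalso. assert (H : (T <= u)%R); [ | lra ].
      apply HT2. intros t Ht. apply Rnot_lt_le. intros Hut. apply Hn. exists t. split; assumption. }
  (* Closedness: the points p u with u < T come arbitrarily close to p T, and each has points of
     agreement beside it. *)
  assert (HpT : eventually_eq f g (p T)).
  { destruct (Req_dec T 0) as [ -> | HTn ].
    { replace (p 0%R) with p0 by (unfold p; ring). exact H0. }
    apply meromorphic_accumulation; [ exact Hf | exact Hg | ].
    intros e He. set (u := Rmax 0 (T - e / (2 * L))).
    assert (HeL : (0 < e / (2 * L))%R) by (apply Rdiv_lt_0_compat; lra).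
    assert (Hu : (0 <= u < T)%R).
    { split; [ apply Rmax_l | ]. apply Rmax_lub_lt; lra. }
    apply (eventually_eq_points f g (p T) (p u) e (Hbelow u Hu)).
    eapply Rle_lt_trans; [ apply Hdist | ].
    assert (Hu2 : (T - e / (2 * L) <= u)%R) by apply Rmax_r.
    assert (Ha : (Rabs (u - T) <= e / (2 * L))%R) by (apply Rabs_le; lra).
    apply Rle_lt_trans with (e / (2 * L) * L)%R; [ apply Rmult_le_compat_r; lra | ].
    replace (e / (2 * L) * L)%R with (e / 2)%R by (field; lra). lra. }
  destruct (Req_dec T 1) as [HT1' | HT1'].
  { rewrite HT1' in HpT. replace p1 with (p 1%R) by (unfold p; ring). exact HpT. }
  exfalso.
  assert (HpT' := HpT). apply locally'_Cmod in HpT. destruct HpT as [d [Hd Hs]].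
  (* Openness: points p u slightly beyond T still lie in the punctured disc of agreement around p T,
     so agreement accumulates at each of them. *)
  set (T' := Rmin 1 (T + d / (2 * L))).
  assert (HdL : (0 < d / (2 * L))%R) by (apply Rdiv_lt_0_compat; lra).
  assert (HTT' : (T < T')%R) by (apply Rmin_glb_lt; lra).
  assert (HT'1 : (T' <= 1)%R) by apply Rmin_l.
  assert (HT'2 : (T' <= T + d / (2 * L))%R) by apply Rmin_r.
  assert (HE : E T').
  { split; [ lra | ]. intros u Hu.
    destruct (Rlt_le_dec u T) as [Hlt | Hge]; [ apply Hbelow; lra | ].
    destruct (Req_dec u T) as [ -> | Hne ]; [ exact HpT' | ].
    apply meromorphic_accumulation; [ exact Hf | exact Hg | ].
    intros e He.
    assert (Hclose : (Cmod (p u - p T) < d)%R).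
    { eapply Rle_lt_trans; [ apply Hdist | ].
      apply Rle_lt_trans with (d / (2 * L) * L)%R.
      - apply Rmult_le_compat_r; [ lra | ]. rewrite Rabs_pos_eq; lra.
      - replace (d / (2 * L) * L)%R with (d / 2)%R by (field; lra). lra. }
    assert (Hy1 := Rmin_l e (d - Cmod (p u - p T))). assert (Hy2 := Rmin_r e (d - Cmod (p u - p T))).
    destruct (exists_close_avoiding (p T) (p u) (Rmin e (d - Cmod (p u - p T)))) as [s [Hsu [Hsnu HsT]]].
    { apply Rmin_glb_lt; lra. }
    exists s. repeat split; [ lra | exact Hsnu | apply Hs; [ | exact HsT ] ].
    replace (s - p T) with ((s - p u) + (p u - p T)) by ring.
    eapply Rle_lt_trans; [ apply Cmod_triangle | ]. lra. }
  specialize (HT1 T' HE). lra.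
Qed.

(** Both functions have the same Laurent expansion at p; the second clause of [meromorphic] then
    fixes the value of f at p itself. *)
Lemma meromorphic_regular_value (f g : C -> C) (p : C) (b : Z -> C) :
  meromorphic f -> laurent_expansion g p b -> (forall k, (k < 0)%Z -> b k = 0) ->
  eventually_eq f g p -> f p = b 0%Z.
Proof.
  intros Hf Hb Hreg He. destruct (Hf p) as [a [Ha Hval]].
  assert (Hab : forall k, a k = b k).
  { apply (laurent_expansion_unique f p); [ exact Ha | ].
    destruct Hb as [N [Hz Hl]]. exists N. split; [ exact Hz | ].
    unfold eventually_eq in He.
    generalize (filter_and _ _ He Hl). apply filter_imp. intros s [E Hs]. rewrite E. exact Hs. }
  rewrite <- Hab. apply Hval. intros k Hk. rewrite Hab. apply Hreg, Hk.
Qed.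

Lemma inv_Cpseries (a h : C) : a <> 0 -> (Cmod h < Cmod a)%R ->
  is_Cpseries (fun j => RtoC (-1) ^ j / a ^ S j) h (/ (a + h)).
Proof.
  intros Ha Hh.
  assert (Hap : (0 < Cmod a)%R) by (apply Cmod_gt_0; exact Ha).
  assert (Hah : a + h <> 0).
  { intros E. replace h with (- (0 - h)) in Hh by ring. rewrite <- E in Hh.
    replace (- (a + h - h)) with (- a) in Hh by ring. rewrite Cmod_opp in Hh. lra. }
  set (q := - h / a).
  assert (Hq : (Cmod q < 1)%R).
  { unfold q. rewrite Cmod_div, Cmod_opp by exact Ha.
    apply Rlt_div_l; lra. }
  assert (Hq1 : q <> 1).
  { intros E. rewrite E, Cmod_1 in Hq. lra. }
  assert (Hg : is_series (fun j => q ^ j) (/ (1 - q))).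
  { apply is_series_Cmod. intros eps Heps.
    assert (Hd := Cminus_neq_0 _ _ (not_eq_sym Hq1)).
    assert (Hdp : (0 < Cmod (1 - q))%R) by (apply Cmod_gt_0; exact Hd).
    assert (Hq0 := Cmod_ge_0 q).
    destruct (pow_lt_1_zero (Cmod q) ltac:(rewrite Rabs_pos_eq; lra) (eps * Cmod (1 - q))%R) as [N HN].
    { apply Rmult_lt_0_compat; assumption. }
    exists N. intros n Hn. specialize (HN n Hn). rewrite Rabs_pos_eq in HN by (apply pow_le; lra).
    rewrite csum_geom by exact Hq1.
    replace ((1 - q ^ n) / (1 - q) - / (1 - q)) with (- q ^ n / (1 - q)) by (field; exact Hd).
    rewrite Cmod_div, Cmod_opp, Cmod_pow by exact Hd.
    apply Rlt_div_l; lra. }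
  refine (is_series_Cext _ _ _ _ _ _ (is_series_Cscal (/ a) _ _ Hg)).
  - intros j. cbv beta. unfold q. replace (- h / a) with (RtoC (-1) * h * / a) by (field; exact Ha).
    rewrite !Cpow_mult_l, Cpow_inv by exact Ha. rewrite Cpow_S. field.
    split; [ apply Cpow_nz, Ha | exact Ha ].
  - unfold q. field. split; [ | exact Ha ]. intros E. apply Hah. rewrite <- E. ring.
Qed.

(** Cauchy product with the geometric series of 1/(a+h). The first two coefficients are the value
    and the quotient rule; the radius at most |a| keeps a + h away from 0. *)
Lemma div_Cpseries (c : nat -> C) (f : C -> C) (a : C) (r : R) :
  a <> 0 -> (0 < r)%R -> (forall h, (Cmod h < r)%R -> is_Cpseries c h (f h)) ->
  exists d r', (0 < r' <= Cmod a)%R /\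
    (forall h, (Cmod h < r')%R -> is_Cpseries d h (f h / (a + h))) /\
    d 0%nat = c 0%nat / a /\ d 1%nat = c 1%nat / a - c 0%nat / (a * a).
Proof.
  intros Ha Hr Hc.
  assert (Hap : (0 < Cmod a)%R) by (apply Cmod_gt_0; exact Ha).
  set (e := fun j => RtoC (-1) ^ j / a ^ S j).
  exists (fun n => csum (fun k => c k * e (n - k)%nat) (S n)), (Rmin r (Cmod a) / 2)%R.
  assert (Hm : (0 < Rmin r (Cmod a))%R) by (apply Rmin_glb_lt; assumption).
  assert (Hm1 := Rmin_l r (Cmod a)). assert (Hm2 := Rmin_r r (Cmod a)).
  set (m := Rmin r (Cmod a)) in *.
  assert (Hmm : Cmod (RtoC (m / 2)) = (m / 2)%R) by (apply Cmod_RtoC_pos; lra).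
  split; [ lra | ]. split.
  - intros h Hh.
    destruct (is_Cpseries_bounded _ _ _ (Hc (RtoC (m / 2)) ltac:(lra))) as [B1 [HB1 HB1']].
    destruct (is_Cpseries_bounded _ _ _ (inv_Cpseries a (RtoC (m / 2)) Ha ltac:(lra))) as [B2 [HB2 HB2']].
    rewrite Hmm in HB1', HB2'.
    refine (is_Cpseries_mult c e (m / 2) (B1 + B2) h _ _ _ _ Hh (Hc h ltac:(lra))
      (inv_Cpseries a h Ha ltac:(lra))).
    + intros j. specialize (HB1' j). lra.
    + intros j. specialize (HB2' j). fold e in HB2'. unfold e. lra.
  - unfold e. split; simpl; field; exact Ha.
Qed.

(** At s = 0 the order 1 suffices: H_1(0, x) is constantly 1 and every remainder vanishes. This
    value is the residue of zeta at 1. *)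
Lemma em_value_0 (w : C) (Z : C -> C) :
  (forall s N, (0 < Re s + INR N)%R -> em_value w N s (Z s)) -> Z 0 = 1.
Proof.
  intros HZ. assert (H := HZ 0 1%nat ltac:(simpl; lra)). unfold em_value in H.
  assert (E : forall x, em_sum 1 0 x = 1).
  { intros x. unfold em_sum, em_term. simpl. rewrite beta_0.
    replace (- 0 - 0) with (RtoC 0) by ring. rewrite Cpower_0. ring. }
  rewrite E in H.
  apply Cminus_eq_0, (is_series_C_unique _ _ _ H), (is_series_finite _ 0).
  intros k _. unfold em_rem. rewrite !E. ring.
Qed.

(** Expansion away from the pole of the quotient that will be shown to be zeta. Here [z1] is the
    derivative of [Z] at s0 - 1, delivered together with the series that computes it. *)
Lemma hurwitz_regular (w : C) (Z : C -> C) (s0 : C) :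
  (0 < Re w)%R -> (forall s N, (0 < Re s + INR N)%R -> em_value w N s (Z s)) -> s0 <> 1 ->
  exists d r, (0 < r <= Cmod (s0 - 1))%R /\
    (forall h, (Cmod h < r)%R -> is_Cpseries d h (Z (s0 + h - 1) / (s0 + h - 1))) /\
    exists z1, d 1%nat = z1 / (s0 - 1) - Z (s0 - 1) / ((s0 - 1) * (s0 - 1)) /\
      forall N, (2 <= N)%nat -> (3 <= Re (s0 - 1) + INR N)%R ->
        is_series (fun k => em_rem' N (s0 - 1) (INR k + w)) (z1 - em_sum' N (s0 - 1) w).
Proof.
  intros Hw HZ Hs0.
  assert (Ha := Cminus_neq_0 _ _ Hs0).
  destruct (em_value_analytic w Z Hw HZ (s0 - 1)) as [c [Hc Hc1]].
  destruct (div_Cpseries c (fun h => Z (s0 - 1 + h)) (s0 - 1) 1 Ha Rlt_0_1 Hc)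
    as [d [r [Hr [Hd [Hd0 Hd1]]]]].
  assert (Hc0 : Z (s0 - 1) = c O).
  { apply is_Cpseries_0. replace (Z (s0 - 1)) with (Z (s0 - 1 + 0)) by (f_equal; ring).
    apply Hc. rewrite Cmod_0. lra. }
  exists d, r. split; [ exact Hr | ]. split.
  - intros h Hh. replace (s0 + h - 1) with (s0 - 1 + h) by ring. apply Hd, Hh.
  - exists (c 1%nat). split; [ rewrite Hc0; exact Hd1 | exact Hc1 ].
Qed.

Lemma laurent_expansion_regular (f : C -> C) (s0 : C) (d : nat -> C) (r : R) :
  (0 < r)%R -> (forall h, (Cmod h < r)%R -> is_Cpseries d h (f (s0 + h))) ->
  laurent_expansion f s0 (laurent_of_Cpseries d 0) /\
  (forall k, (k < 0)%Z -> laurent_of_Cpseries d 0 k = 0) /\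
  f s0 = laurent_of_Cpseries d 0 0%Z.
Proof.
  intros Hr H. split; [ | split ].
  - apply laurent_expansion_of_Cpseries with (d := r); [ exact Hr | ].
    intros h Hh _. simpl. rewrite Cmult_1_l. apply H, Hh.
  - intros k Hk. unfold laurent_of_Cpseries. simpl. apply Z.ltb_lt in Hk. rewrite Hk. reflexivity.
  - change (laurent_of_Cpseries d 0 0%Z) with (d O).
    apply is_Cpseries_0. replace (f s0) with (f (s0 + 0)) by (f_equal; ring).
    apply H. rewrite Cmod_0. exact Hr.
Qed.

Lemma hurwitz_continuation_em (w : C) (Z : C -> C) :
  (0 < Re w)%R -> (forall s N, (0 < Re s + INR N)%R -> em_value w N s (Z s)) ->
  hurwitz_continuation w (fun s => Z (s - 1) / (s - 1)).
Proof.
  intros Hw HZ. split.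
  - intros s0. destruct (classic (s0 = 1)) as [ -> | Hs0 ].
    + destruct (em_value_analytic w Z Hw HZ 0) as [c [Hc _]].
      assert (Hc0 : c O = 1).
      { rewrite <- (em_value_0 w Z HZ). symmetry. apply is_Cpseries_0.
        replace (Z 0) with (Z (0 + 0)) by (f_equal; ring). apply Hc. rewrite Cmod_0. lra. }
      exists (laurent_of_Cpseries c 1). split.
      * apply laurent_expansion_of_Cpseries with (d := 1%R); [ lra | ]. intros h Hh Hh0.
        refine (is_Cpseries_ext _ _ _ _ _ (fun j => eq_refl) _ (Hc h Hh)).
        replace (1 + h - 1) with h by ring. replace (0 + h) with h by ring.
        simpl. field. exact Hh0.
      (* The residue is 1, so s = 1 is a genuine pole and the condition on regular values is vacuous
         there. *)
      * intros Hneg. exfalso. apply C1_nz. rewrite <- Hc0.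
        change (c O) with (laurent_of_Cpseries c 1 (-1)%Z). apply Hneg. lia.
    + destruct (hurwitz_regular w Z s0 Hw HZ Hs0) as [d [r [Hr [Hd _]]]].
      destruct (laurent_expansion_regular (fun s => Z (s - 1) / (s - 1)) s0 d r (proj1 Hr) Hd)
        as [H1 [H2 H3]].
      exists (laurent_of_Cpseries d 0). split; [ exact H1 | intros _; exact H3 ].
  - intros s Hs.
    assert (Hs1 : s - 1 <> 0).
    { apply neq_0_of_Re. rewrite Re_minus, re_RtoC. lra. }
    (* For Re s > 1 the order 0 is admissible; nothing is subtracted, and the remainders are the
       terms of the defining series times s - 1. *)
    assert (H := HZ (s - 1) 0%nat ltac:(rewrite Re_minus, re_RtoC; simpl; lra)).
    unfold em_value, em_rem, em_sum in H. simpl csum in H.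
    refine (is_series_Cext _ _ _ _ _ _ (is_series_Cscal (/ (s - 1)) _ _ H)).
    + intros k. cbv beta. replace (- (s - 1) - 1) with (- s) by ring. field. exact Hs1.
    + field. exact Hs1.
Qed.

(** The constructed continuation shows that the [epsilon] choice meets its specification; the
    identity theorem then shows that the two agree off the pole. *)
Lemma hurwitz_zeta_eq (w : C) (Z : C -> C) (s0 : C) :
  (0 < Re w)%R -> (forall s N, (0 < Re s + INR N)%R -> em_value w N s (Z s)) -> s0 <> 1 ->
  hurwitz_zeta s0 w = Z (s0 - 1) / (s0 - 1).
Proof.
  intros Hw HZ Hs0.
  assert (Hcont := hurwitz_continuation_em w Z Hw HZ).
  assert (Hz : hurwitz_continuation w (fun s => hurwitz_zeta s w)).
  { unfold hurwitz_zeta. apply epsilon_spec. exists (fun s => Z (s - 1) / (s - 1)). exact Hcont. }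
  destruct (hurwitz_regular w Z s0 Hw HZ Hs0) as [d [r [Hr [Hd _]]]].
  destruct (laurent_expansion_regular (fun s => Z (s - 1) / (s - 1)) s0 d r (proj1 Hr) Hd)
    as [H1 [H2 H3]].
  rewrite H3.
  apply (meromorphic_regular_value (fun s => hurwitz_zeta s w) _ s0 _ (proj1 Hz) H1 H2).
  (* The unit disc around 3 lies in Re s > 1, where both functions are the sum of the same
     series. *)
  apply (meromorphic_identity _ _ 3 s0 (proj1 Hz) (proj1 Hcont)).
  apply locally'_Cmod. exists 1%R. split; [ lra | ]. intros s Hs _.
  assert (Hre := re_le_Cmod (s - 3)). apply Rabs_le_between in Hre.
  rewrite Re_minus, re_RtoC in Hre.
  apply (is_series_C_unique _ _ _ (proj2 Hz s ltac:(lra)) (proj2 Hcont s ltac:(lra))).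
Qed.

Lemma hurwitz_zeta_derive (w s0 : C) :
  (0 < Re w)%R -> s0 <> 1 ->
  exists z0 z1,
    is_derive (V := C_NormedModule) (fun s => hurwitz_zeta s w) s0
      (z1 / (s0 - 1) - z0 / ((s0 - 1) * (s0 - 1))) /\
    (forall N, (0 < Re (s0 - 1) + INR N)%R -> em_value w N (s0 - 1) z0) /\
    (forall N, (2 <= N)%nat -> (3 <= Re (s0 - 1) + INR N)%R ->
      is_series (fun k => em_rem' N (s0 - 1) (INR k + w)) (z1 - em_sum' N (s0 - 1) w)).
Proof.
  intros Hw Hs0. destruct (em_value_exists w Hw) as [Z HZ].
  destruct (hurwitz_regular w Z s0 Hw HZ Hs0) as [d [r [Hr [Hd [z1 [Hd1 Hz1]]]]]].
  exists (Z (s0 - 1)), z1. split; [ | split ].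
  - rewrite <- Hd1. apply is_Cpseries_is_derive with (r := r); [ apply Hr | ].
    intros h Hh. rewrite (hurwitz_zeta_eq w Z (s0 + h) Hw HZ); [ apply Hd, Hh | ].
    intros E. assert (E2 : s0 - 1 = - h) by (rewrite <- E; ring).
    rewrite E2, Cmod_opp in Hr. lra.
  - intros N HN. apply HZ, HN.
  - exact Hz1.
Qed.

(** * Improper integrals of complex functions *)

Definition is_CRInt (f : R -> C) (a b : R) (z : C) : Prop :=
  is_RInt (V := C_R_CompleteNormedModule) f a b z.

Lemma is_CRInt_components (f : R -> C) (a b : R) (z : C) :
  is_CRInt f a b z <->
  is_RInt (fun t => Re (f t)) a b (Re z) /\ is_RInt (fun t => Im (f t)) a b (Im z).
Proof.
  split.
  - intros H. split.
    + exact (is_RInt_fct_extend_fst (U := R_NormedModule) (V := R_NormedModule) f a b z H).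
    + exact (is_RInt_fct_extend_snd (U := R_NormedModule) (V := R_NormedModule) f a b z H).
  - intros [H1 H2]. destruct z as [x y].
    exact (is_RInt_fct_extend_pair (U := R_NormedModule) (V := R_NormedModule) f a b x y H1 H2).
Qed.

(** The integral takes values in C as a module over R, so multiplication by a complex constant is
    carried out on components. *)
Lemma is_CRInt_scal (c : C) (f : R -> C) (a b : R) (z : C) :
  is_CRInt f a b z -> is_CRInt (fun t => c * f t) a b (c * z).
Proof.
  rewrite !is_CRInt_components. intros [H1 H2]. split.
  - exact (is_RInt_minus (V := R_NormedModule) _ _ a b _ _
      (is_RInt_scal (V := R_NormedModule) _ a b (Re c) _ H1)
      (is_RInt_scal (V := R_NormedModule) _ a b (Im c) _ H2)).
  - exact (is_RInt_plus (V := R_NormedModule) _ _ a b _ _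
      (is_RInt_scal (V := R_NormedModule) _ a b (Re c) _ H2)
      (is_RInt_scal (V := R_NormedModule) _ a b (Im c) _ H1)).
Qed.

Lemma is_CRInt_unique (f : R -> C) (a b : R) (y z : C) :
  is_CRInt f a b y -> is_CRInt f a b z -> y = z.
Proof.
  intros H1 H2. apply (is_RInt_unique (V := C_R_CompleteNormedModule)) in H1, H2.
  rewrite <- H1. exact H2.
Qed.

Lemma is_CRInt_ext (f g : R -> C) (a b : R) (z : C) :
  (0 < a)%R -> (0 < b)%R -> (forall t, (0 < t)%R -> f t = g t) ->
  is_CRInt f a b z -> is_CRInt g a b z.
Proof.
  intros Ha Hb H. apply (is_RInt_ext (V := C_R_CompleteNormedModule)).
  intros t Ht. apply H. assert (P := Rmin_glb_lt a b 0 Ha Hb). lra.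
Qed.

(** Differentiability serves as a condition for continuity, hence integrability, that is stable
    under all the operations building the integrands. *)
Definition ex_Rderive (f : R -> C) (t : R) : Prop := exists l, is_Rderive f t l.

Lemma ex_Rderive_continuous (f : R -> C) (t : R) : ex_Rderive f t ->
  continuous (fun t => Re (f t)) t /\ continuous (fun t => Im (f t)) t.
Proof.
  intros [l [H1 H2]].
  split; apply (ex_derive_continuous (K := R_AbsRing) (V := R_NormedModule));
    [ exists (Re l); exact H1 | exists (Im l); exact H2 ].
Qed.

Lemma is_CRInt_derive (F f : R -> C) (a b : R) :
  (0 < a)%R -> (0 < b)%R ->
  (forall t, (0 < t)%R -> is_Rderive F t (f t)) -> (forall t, (0 < t)%R -> ex_Rderive f t) ->
  is_CRInt f a b (F b - F a).
Proof.
  intros Ha Hb HF Hf. assert (P := Rmin_glb_lt a b 0 Ha Hb).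
  apply is_CRInt_components. split.
  - apply (is_RInt_derive (V := R_CompleteNormedModule) (fun t => Re (F t)) (fun t => Re (f t))).
    + intros t Ht. apply HF. lra.
    + intros t Ht. apply ex_Rderive_continuous, Hf. lra.
  - apply (is_RInt_derive (V := R_CompleteNormedModule) (fun t => Im (F t)) (fun t => Im (f t))).
    + intros t Ht. apply HF. lra.
    + intros t Ht. apply ex_Rderive_continuous, Hf. lra.
Qed.

Lemma ex_CRInt (f : R -> C) (a b : R) :
  (0 < a)%R -> (0 < b)%R -> (forall t, (0 < t)%R -> ex_Rderive f t) -> exists z, is_CRInt f a b z.
Proof.
  intros Ha Hb Hf. assert (P := Rmin_glb_lt a b 0 Ha Hb).
  destruct (ex_RInt_continuous (V := R_CompleteNormedModule) (fun t => Re (f t)) a b) as [x Hx].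
  { intros t Ht. apply ex_Rderive_continuous, Hf. lra. }
  destruct (ex_RInt_continuous (V := R_CompleteNormedModule) (fun t => Im (f t)) a b) as [y Hy].
  { intros t Ht. apply ex_Rderive_continuous, Hf. lra. }
  exists (x, y). apply is_CRInt_components. split; assumption.
Qed.

Lemma near_0_infty (P : R * R -> Prop) :
  filter_prod (at_right 0) (Rbar_locally p_infty) P <->
  exists d T, (0 < d)%R /\ forall a b, (0 < a < d)%R -> (T < b)%R -> P (a, b).
Proof.
  split.
  - intros [Q S [d Hd] [T HT] HQS]. exists d, T. split; [ apply cond_pos | ]. intros a b Ha Hb.
    apply HQS; [ apply Hd; [ | lra ] | apply HT, Hb ].
    change (Rabs (a - 0) < d)%R. rewrite Rabs_pos_eq; lra.
  - intros [d [T [Hd H]]].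
    apply Filter_prod with (Q := fun a => (0 < a < d)%R) (R := fun b => (T < b)%R);
      [ | exists T; auto | auto ].
    exists (mkposreal d Hd). intros a Ha Ha0.
    change (Rabs (a - 0) < d)%R in Ha. apply Rabs_def2 in Ha. lra.
Qed.

Lemma is_Cint_iff (f : R -> C) (z : C) :
  is_Cint_0_infty f z <->
  forall eps, (0 < eps)%R -> exists d T, (0 < d)%R /\
    forall a b, (0 < a < d)%R -> (T < b)%R ->
      exists y, is_CRInt f a b y /\ (Cmod (y - z) < eps)%R.
Proof.
  split.
  - intros H eps Heps. apply (near_0_infty (fun ab => exists y, is_CRInt f (fst ab) (snd ab) y /\ _)).
    apply (H (fun y => Cmod (y - z) < eps)%R).
    apply (proj2 (locally_Cmod z _)). exists eps. auto.
  - intros H P HP. destruct (proj1 (locally_Cmod z P) HP) as [eps [Heps HPe]].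
    destruct (H eps Heps) as [d [T [Hd HT]]].
    apply near_0_infty. exists d, T. split; [ exact Hd | ]. intros a b Ha Hb.
    destruct (HT a b Ha Hb) as [y [Hy Hyz]]. exists y. auto.
Qed.

(** A rate linear in a at 0 and in 1/b at infinity; the explicitly evaluated integrals below all
    converge this fast. *)
Lemma is_Cint_of_bound (f : R -> C) (z : C) (K : R) :
  (forall a b, (0 < a <= 1)%R -> (1 <= b)%R ->
    exists y, is_CRInt f a b y /\ (Cmod (y - z) <= K * (a + / b))%R) ->
  is_Cint_0_infty f z.
Proof.
  intros H. apply is_Cint_iff. intros eps Heps.
  assert (HK := Rabs_pos K).
  set (d := Rmin 1 (eps / (2 * (Rabs K + 1)))).
  assert (He : (0 < eps / (2 * (Rabs K + 1)))%R) by (apply Rdiv_lt_0_compat; lra).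
  assert (Hd : (0 < d)%R) by (apply Rmin_glb_lt; lra).
  assert (Hd1 : (d <= 1)%R) by apply Rmin_l.
  assert (Hd2 : (d <= eps / (2 * (Rabs K + 1)))%R) by apply Rmin_r.
  assert (Hid : (1 <= / d)%R) by (rewrite <- Rinv_1; apply Rinv_le_contravar; lra).
  exists d, (/ d)%R. split; [ exact Hd | ]. intros a b Ha Hb.
  destruct (H a b ltac:(lra) ltac:(lra)) as [y [Hy Hyz]]. exists y. split; [ exact Hy | ].
  assert (Hib : (/ b < d)%R) by (rewrite <- (Rinv_inv d); apply Rinv_0_lt_contravar; lra).
  assert (Hb0 : (0 < / b)%R) by (apply Rinv_0_lt_compat; lra).
  assert (HKa := Rle_abs K).
  apply Rle_lt_trans with (Rabs K * (a + / b))%R; [ nra | ].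
  apply Rlt_le_trans with ((Rabs K + 1) * (2 * d))%R; [ nra | ].
  apply Rle_trans with ((Rabs K + 1) * (2 * (eps / (2 * (Rabs K + 1)))))%R; [ nra | ].
  right. field. lra.
Qed.

Lemma Cint_eq (f : R -> C) (z : C) : is_Cint_0_infty f z -> Cint_0_infty f = z.
Proof.
  exact (is_RInt_gen_unique (V := C_R_CompleteNormedModule)
    (Fa := at_right 0) (Fb := Rbar_locally p_infty) f z).
Qed.

Lemma is_Cint_unique (f : R -> C) (y z : C) :
  is_Cint_0_infty f y -> is_Cint_0_infty f z -> y = z.
Proof. intros Hy Hz. rewrite <- (Cint_eq f y Hy). apply Cint_eq, Hz. Qed.

Lemma is_Cint_ext (f g : R -> C) (z : C) :
  (forall t, (0 < t)%R -> f t = g t) -> is_Cint_0_infty f z -> is_Cint_0_infty g z.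
Proof.
  intros E. rewrite !is_Cint_iff. intros H eps Heps.
  destruct (H eps Heps) as [d [T [Hd HT]]]. exists d, (Rmax T 0). split; [ exact Hd | ].
  intros a b Ha Hb. assert (P1 := Rmax_l T 0). assert (P2 := Rmax_r T 0).
  destruct (HT a b Ha ltac:(lra)) as [y [Hy Hyz]].
  exists y. split; [ | exact Hyz ]. apply (is_CRInt_ext f); [ lra | lra | exact E | exact Hy ].
Qed.

Lemma is_Cint_plus (f g : R -> C) (x y : C) :
  is_Cint_0_infty f x -> is_Cint_0_infty g y -> is_Cint_0_infty (fun t => f t + g t) (x + y).
Proof.
  exact (is_RInt_gen_plus (V := C_R_CompleteNormedModule)
    (Fa := at_right 0) (Fb := Rbar_locally p_infty) f g x y).
Qed.

Lemma is_Cint_scal (c : C) (f : R -> C) (z : C) :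
  is_Cint_0_infty f z -> is_Cint_0_infty (fun t => c * f t) (c * z).
Proof.
  rewrite !is_Cint_iff. intros Hf eps Heps.
  assert (Hc := Cmod_ge_0 c).
  destruct (Hf (eps / (Cmod c + 1))%R) as [d [T [Hd HT]]].
  { apply Rdiv_lt_0_compat; lra. }
  exists d, T. split; [ exact Hd | ]. intros a b Ha Hb.
  destruct (HT a b Ha Hb) as [y [Hy Hyz]].
  exists (c * y). split; [ apply is_CRInt_scal, Hy | ].
  replace (c * y - c * z) with (c * (y - z)) by ring. rewrite Cmod_mult.
  apply Rle_lt_trans with (Cmod c * (eps / (Cmod c + 1)))%R.
  - apply Rmult_le_compat_l; lra.
  - replace (Cmod c * (eps / (Cmod c + 1)))%R with (eps - eps / (Cmod c + 1))%R by (field; lra).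
    assert (P : (0 < eps / (Cmod c + 1))%R) by (apply Rdiv_lt_0_compat; lra). lra.
Qed.

Lemma is_Cint_minus (f g : R -> C) (x y : C) :
  is_Cint_0_infty f x -> is_Cint_0_infty g y -> is_Cint_0_infty (fun t => f t - g t) (x - y).
Proof.
  intros Hf Hg. apply (is_Cint_ext (fun t => f t + - (1) * g t)).
  { intros t _. ring. }
  replace (x - y) with (x + - (1) * y) by ring.
  apply is_Cint_plus; [ exact Hf | apply is_Cint_scal, Hg ].
Qed.

Lemma is_CRInt_zero (a b : R) : (0 < a)%R -> (0 < b)%R -> is_CRInt (fun _ => 0) a b 0.
Proof.
  intros Ha Hb. assert (H : is_CRInt (fun _ => 0) a b (0 - 0)).
  { apply (is_CRInt_derive (fun _ => 0) (fun _ => 0)); [ exact Ha | exact Hb | | ]; intros t _;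
      [ | exists 0 ]; apply is_Rderive_const. }
  replace (0 - 0) with (RtoC 0) in H by ring. exact H.
Qed.

Lemma is_Cint_zero : is_Cint_0_infty (fun _ => 0) 0.
Proof.
  apply (is_Cint_of_bound _ _ 0). intros a b Ha Hb. exists 0.
  split; [ apply is_CRInt_zero; lra | ]. replace (0 - 0) with (RtoC 0) by ring. rewrite Cmod_0. lra.
Qed.

Lemma is_Cint_csum (f : nat -> R -> C) (z : nat -> C) (n : nat) :
  (forall k, (k < n)%nat -> is_Cint_0_infty (f k) (z k)) ->
  is_Cint_0_infty (fun t => csum (fun k => f k t) n) (csum z n).
Proof.
  induction n as [ | n IH ]; intros H; simpl; [ apply is_Cint_zero | ].
  apply is_Cint_plus; [ apply IH; intros; apply H; lia | apply H; lia ].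
Qed.

Lemma is_Cint_derive (F f : R -> C) (l0 l1 : C) (B0 B1 : R) :
  (forall t, (0 < t)%R -> is_Rderive F t (f t)) -> (forall t, (0 < t)%R -> ex_Rderive f t) ->
  (forall t, (0 < t <= 1)%R -> (Cmod (F t - l0) <= B0 * t)%R) ->
  (forall t, (1 <= t)%R -> (Cmod (F t - l1) <= B1 * / t)%R) ->
  is_Cint_0_infty f (l1 - l0).
Proof.
  intros HF Hf H0 H1. apply (is_Cint_of_bound _ _ (B0 + B1)). intros a b Ha Hb.
  exists (F b - F a). split; [ apply is_CRInt_derive; [ lra | lra | exact HF | exact Hf ] | ].
  assert (P0 := H0 1%R ltac:(lra)). assert (P1 := H1 1%R ltac:(lra)).
  assert (Q0 := Cmod_ge_0 (F 1%R - l0)). assert (Q1 := Cmod_ge_0 (F 1%R - l1)).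
  rewrite Rinv_1 in P1. assert (Hib : (0 < / b)%R) by (apply Rinv_0_lt_compat; lra).
  specialize (H0 a Ha). specialize (H1 b Hb).
  replace (F b - F a - (l1 - l0)) with ((F b - l1) - (F a - l0)) by ring.
  eapply Rle_trans; [ apply Cmod_minus_le | ]. nra.
Qed.

Lemma CRInt_bound_exp (f : R -> C) (B c a b : R) (z : C) :
  (0 < c)%R -> (0 < a <= b)%R ->
  (forall t, (0 < t)%R -> (Cmod (f t) <= B * exp (- (c * t)))%R) -> is_CRInt f a b z ->
  (Cmod z <= B / c * (exp (- (c * a)) - exp (- (c * b))))%R.
Proof.
  intros Hc Hab Hf Hz. rewrite Cmod_norm.
  refine (norm_RInt_le (V := prod_NormedModule R_AbsRing R_NormedModule R_NormedModule)
    f (fun t => B * exp (- (c * t)))%R a b z _ (proj2 Hab) _ Hz _).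
  - intros t Ht. rewrite <- Cmod_norm. apply Hf. lra.
  - replace (B / c * (exp (- (c * a)) - exp (- (c * b))))%R
      with (minus (- (B / c) * exp (- (c * b))) (- (B / c) * exp (- (c * a))))%R
      by (unfold minus, plus, opp; simpl; field; lra).
    apply (is_RInt_derive (V := R_CompleteNormedModule) (fun t => - (B / c) * exp (- (c * t)))%R).
    + intros t _. auto_derive; [ trivial | field; lra ].
    + intros t _. apply (ex_derive_continuous (K := R_AbsRing) (V := R_NormedModule)).
      auto_derive. trivial.
Qed.

(* Cauchy criterion, with the primitive of the dominating exponential. *)
Lemma is_Cint_dominated (f : R -> C) (B c : R) :
  (0 < c)%R -> (0 <= B)%R -> (forall t, (0 < t)%R -> ex_Rderive f t) ->
  (forall t, (0 < t)%R -> (Cmod (f t) <= B * exp (- (c * t)))%R) ->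
  exists z, is_Cint_0_infty f z /\ (Cmod z <= B / c)%R.
Proof.
  intros Hc HB Hf Hb.
  assert (HBc : (0 <= B / c)%R) by (apply Rdiv_le_0_compat; assumption).
  (* F chooses the integral over each interval with positive endpoints; elsewhere its value is
     arbitrary. *)
  destruct (functional_choice (fun (ab : R * R) z =>
    (0 < fst ab)%R -> (0 < snd ab)%R -> is_CRInt f (fst ab) (snd ab) z)) as [F HF].
  { intros [a b]. cbn [fst snd].
    destruct (Rlt_le_dec 0 a) as [Ha | Ha]; [ | exists 0; lra ].
    destruct (Rlt_le_dec 0 b) as [Hb0 | Hb0]; [ | exists 0; lra ].
    destruct (ex_CRInt f a b Ha Hb0 Hf) as [z Hz]. exists z. auto. }
  set (G := fun x y => (B / c * Rabs (exp (- (c * x)) - exp (- (c * y))))%R).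
  assert (HFG : forall a b, (0 < a)%R -> (0 < b)%R -> (Cmod (F (a, b)) <= G a b)%R).
  { assert (Hle : forall a b z, (0 < a <= b)%R -> is_CRInt f a b z -> (Cmod z <= G a b)%R).
    { intros a b z Hab Hz. eapply Rle_trans; [ apply (CRInt_bound_exp f B c a b z Hc Hab Hb Hz) | ].
      apply Rmult_le_compat_l; [ exact HBc | apply Rle_abs ]. }
    intros a b Ha Hb0. assert (H := HF (a, b) Ha Hb0). cbn [fst snd] in H.
    destruct (Rle_lt_dec a b) as [Hab | Hab]; [ apply Hle; [ lra | exact H ] | ].
    assert (H' : is_CRInt f b a (- F (a, b))).
    { exact (is_RInt_swap (V := C_R_CompleteNormedModule) f b a _ H). }
    apply Hle in H'; [ | lra ]. rewrite Cmod_opp in H'. unfold G in *.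
    rewrite Rabs_minus_sym. exact H'. }
  (* The difference of two truncated integrals reduces to the two end pieces, which the dominating
     exponential controls. *)
  assert (Hchasles : forall a b a' b', (0 < a)%R -> (0 < b)%R -> (0 < a')%R -> (0 < b')%R ->
    F (a, b) - F (a', b') = F (a, a') + F (b', b)).
  { intros a b a' b' Ha Hb0 Ha' Hb'.
    assert (H : is_CRInt f a b (F (a, a') + F (a', b') + F (b', b))).
    { apply (is_RInt_Chasles (V := C_R_CompleteNormedModule) f a b' b).
      - apply (is_RInt_Chasles (V := C_R_CompleteNormedModule) f a a' b');
          [ apply (HF (a, a')) | apply (HF (a', b')) ]; assumption.
      - apply (HF (b', b)); assumption. }
    rewrite (is_CRInt_unique _ _ _ _ _ (HF (a, b) Ha Hb0) H). ring. }
  assert (Hexp1 : forall t, (0 < t)%R -> (1 - c * t <= exp (- (c * t)) <= 1)%R).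
  { intros t Ht. assert (P := exp_ineq1_le (- (c * t))). assert (Q := Rmult_lt_0_compat _ _ Hc Ht).
    split; [ lra | ]. rewrite <- exp_0. apply exp_le_compat. lra. }
  assert (Hexp2 : forall t, (0 < t)%R -> (0 < exp (- (c * t)) <= / c * / t)%R).
  { intros t Ht. split; [ apply exp_pos | ]. rewrite <- Rinv_mult.
    apply exp_opp_le_inv, Rmult_lt_0_compat; assumption. }
  (* The end pieces near 0 and near infinity add up to at most 2 (K-1) d, below [eps] = 4 K d. *)
  set (K := (B / c * (c + / c) + 1)%R).
  assert (Hic := Rinv_0_lt_compat _ Hc).
  assert (HK : (1 <= K)%R) by (unfold K; assert (P := Rmult_le_pos _ _ HBc (Rlt_le _ _ (Rplus_lt_0_compat _ _ Hc Hic))); lra).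
  assert (Hpf : ProperFilter (filter_prod (at_right 0) (Rbar_locally p_infty))).
  { apply filter_prod_proper. }
  destruct (proj1 (filterlim_locally_cauchy (U := C_R_CompleteNormedModule)
    (F := filter_prod (at_right 0) (Rbar_locally p_infty)) F)) as [z Hz].
  { intros eps. set (d := (eps / (4 * K))%R).
    assert (Hd : (0 < d)%R) by (apply Rdiv_lt_0_compat; [ apply cond_pos | lra ]).
    assert (Hid := Rinv_0_lt_compat _ Hd).
    exists (fun ab => (0 < fst ab < d)%R /\ (/ d < snd ab)%R). split.
    - apply near_0_infty. exists d, (/ d)%R. auto.
    - intros [a b] [a' b'] [Ha Hb0] [Ha' Hb']. cbn [fst snd] in *.
      apply C_NormedModule_mixin_compat1.
      change (Cmod (F (a', b') - F (a, b)) < eps)%R.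
      rewrite Hchasles by lra.
      assert (G1 : (G a' a <= B / c * (2 * (c * d)))%R).
      { apply Rmult_le_compat_l; [ exact HBc | ].
        assert (H1 := Hexp1 a (proj1 Ha)). assert (H2 := Hexp1 a' (proj1 Ha')). apply Rabs_le. nra. }
      assert (G2 : (G b b' <= B / c * (2 * (/ c * d)))%R).
      { apply Rmult_le_compat_l; [ exact HBc | ].
        assert (Hinv : forall x, (/ d < x)%R -> (/ x < d)%R).
        { intros x Hx. rewrite <- (Rinv_inv d). apply Rinv_0_lt_contravar; assumption. }
        assert (H1 := Hexp2 b ltac:(lra)). assert (H2 := Hexp2 b' ltac:(lra)).
        assert (H3 := Hinv b Hb0). assert (H4 := Hinv b' Hb'). apply Rabs_le. nra. }
      eapply Rle_lt_trans; [ apply Cmod_triangle | ].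
      assert (P1 := HFG a' a ltac:(lra) ltac:(lra)). assert (P2 := HFG b b' ltac:(lra) ltac:(lra)).
      assert (E : (pos eps = 4 * K * d)%R) by (unfold d; field; lra).
      assert (E' : (B / c * (2 * (c * d)) + B / c * (2 * (/ c * d)) = 2 * (K - 1) * d)%R)
        by (unfold K; ring).
      rewrite E. assert (P3 := Rmult_lt_0_compat K d ltac:(lra) Hd). lra. }
  exists z.
  assert (Hzi : is_Cint_0_infty f z).
  { apply is_Cint_iff. intros eps Heps.
    assert (H : filter_prod (at_right 0) (Rbar_locally p_infty) (fun ab => Cmod (F ab - z) < eps)%R).
    { apply (Hz (fun y => Cmod (y - z) < eps)%R), (proj2 (locally_Cmod z _)). exists eps. auto. }
    apply near_0_infty in H. destruct H as [d [T [Hd HT]]].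
    exists d, (Rmax T 0). split; [ exact Hd | ]. intros a b Ha Hb0.
    assert (P1 := Rmax_l T 0). assert (P2 := Rmax_r T 0).
    exists (F (a, b)). split; [ apply (HF (a, b)); cbn [fst snd]; lra | apply HT; lra ]. }
  split; [ exact Hzi | ].
  (* The bound B/c passes to the limit; its decay in c later makes the integrals at k + w tend to
     0. *)
  apply Rnot_lt_le. intros Hlt. rewrite is_Cint_iff in Hzi.
  destruct (Hzi (Cmod z - B / c)%R ltac:(lra)) as [d [T [Hd HT]]].
  assert (P0 := Rmax_l T d). assert (P := Rmax_r T d).
  destruct (HT (d / 2)%R (Rmax T d + 1)%R ltac:(lra) ltac:(lra)) as [y [Hy Hyz]].
  assert (Hyb := CRInt_bound_exp f B c (d / 2) (Rmax T d + 1) y Hc ltac:(lra) Hb Hy).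
  assert (E1 := Hexp1 (d / 2)%R ltac:(lra)). assert (E2 := exp_pos (- (c * (Rmax T d + 1)))).
  assert (E3 : (Cmod y <= B / c)%R).
  { eapply Rle_trans; [ exact Hyb | ].
    rewrite <- (Rmult_1_r (B / c)) at 2. apply Rmult_le_compat_l; lra. }
  assert (E4 := Cmod_triangle_minus z y). rewrite Cmod_minus_sym in E4. lra.
Qed.

(** * Frullani's integral *)

Lemma is_Rderive_Cexp_lin (a : C) (t : R) :
  is_Rderive (fun t => Cexp (- (a * RtoC t))) t (- a * Cexp (- (a * RtoC t))).
Proof.
  apply is_Rderive_Cexp.
  apply (is_Rderive_ext (fun t => - a * RtoC t)); [ intros; ring | ].
  refine (is_Rderive_eq _ _ _ _ _ (is_Rderive_scal (- a) _ _ _ (is_Rderive_id t))). ring.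
Qed.

Lemma Cexp_opp_derive (t : R) : is_Rderive (fun t => Cexp (- RtoC t)) t (- Cexp (- RtoC t)).
Proof.
  apply (is_Rderive_ext (fun t => Cexp (- (1 * RtoC t)))).
  { intros x. f_equal. ring. }
  refine (is_Rderive_eq _ _ _ _ _ (is_Rderive_Cexp_lin 1 t)).
  replace (1 * RtoC t) with (RtoC t) by ring. ring.
Qed.

(** Differentiation under the integral sign. For g the derivative is required only at t > 0, because
    of its factor 1/t; in [dg] that factor has cancelled, so joint continuity everywhere is
    available. *)
Lemma is_derive_RInt_of_continuous (g dg : R -> R -> R) (a b u l : R) (D : R -> R) :
  (0 < a <= b)%R ->
  (forall x t, (0 < t)%R -> is_derive (fun x => g x t) x (dg x t)) ->
  (forall x t, continuity_2d_pt dg x t) ->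
  (forall x, is_RInt (g x) a b (D x)) -> is_RInt (dg u) a b l -> is_derive D u l.
Proof.
  intros Hab Hg Hc HD Hl. rewrite <- (is_RInt_unique _ _ _ _ Hl).
  assert (Hm : Rmin a b = a) by (apply Rmin_left; lra).
  apply is_derive_ext with (f := fun x => RInt (g x) a b).
  { intros x. apply is_RInt_unique, HD. }
  rewrite <- (RInt_ext (fun t => Derive (fun x => g x t) u)).
  2: { intros t Ht. rewrite Hm in Ht. apply is_derive_unique, Hg. lra. }
  apply (is_derive_RInt_param g a b u).
  - apply filter_forall. intros x t Ht. rewrite Hm in Ht. exists (dg x t). apply Hg. lra.
  - intros t Ht. rewrite Hm in Ht. apply continuity_2d_pt_ext_loc with (f := dg); [ | apply Hc ].
    assert (Ht0 : (0 < t)%R) by lra. exists (mkposreal t Ht0). intros u' v' _ Hv. simpl in Hv.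
    symmetry. apply is_derive_unique, Hg. apply Rabs_def2 in Hv. lra.
  - apply filter_forall. intros x. exists (D x). apply HD.
Qed.

(* D(u) = int_eps^T (e^(-t) - e^(-b(u) t)) / t dt along the segment b(u) = 1 + u (a - 1) *)
Lemma Frullani_param_derive (a : C) (eps T : R) :
  (0 < eps <= T)%R -> (0 < Re a)%R ->
  exists D : R -> C,
    (forall u, (0 <= u <= 1)%R ->
      is_CRInt (fun t => (Cexp (- RtoC t) - Cexp (- ((1 + RtoC u * (a - 1)) * RtoC t))) / RtoC t)
        eps T (D u)) /\
    forall u, (0 <= u <= 1)%R -> is_Rderive D u
      ((a - 1) / (1 + RtoC u * (a - 1)) *
        (Cexp (- ((1 + RtoC u * (a - 1)) * RtoC eps)) - Cexp (- ((1 + RtoC u * (a - 1)) * RtoC T)))).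
Proof.
  intros Heps Ha.
  set (g := fun u t => (Cexp (- RtoC t) - Cexp (- ((1 + RtoC u * (a - 1)) * RtoC t))) / RtoC t).
  set (dg := fun u t : R => (a - 1) * Cexp (- ((1 + RtoC u * (a - 1)) * RtoC t))).
  assert (Hgu : forall u t, (0 < t)%R -> is_Rderive (fun u => g u t) u (dg u t)).
  { intros u t Ht. unfold g, dg. assert (Hp := RtoC_neq_0 t Ht).
    apply (is_Rderive_ext (fun u => / RtoC t * (Cexp (- RtoC t) - Cexp (- RtoC t + RtoC u * (- (a - 1) * RtoC t))))).
    { intros x. unfold Cdiv. rewrite Cmult_comm. f_equal. f_equal. f_equal. f_equal. ring. }
    refine (is_Rderive_eq _ _ _ _ _ (is_Rderive_scal _ _ _ _ (is_Rderive_minus _ _ _ _ _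
      (is_Rderive_const _ u) (is_Rderive_Cexp _ _ _ (is_Rderive_plus _ _ _ _ _
        (is_Rderive_const (- RtoC t) u) (is_Rderive_mult _ _ _ _ _ (is_Rderive_id u)
          (is_Rderive_const (- (a - 1) * RtoC t) u))))))).
    cbv beta. replace (- RtoC t + RtoC u * (- (a - 1) * RtoC t))
      with (- ((1 + RtoC u * (a - 1)) * RtoC t)) by ring. field. exact Hp. }
  assert (Hgt : forall u t, (0 < t)%R -> ex_Rderive (g u) t).
  { intros u t Ht. eexists. unfold g.
    apply is_Rderive_mult; [ | apply is_Rderive_inv; [ apply is_Rderive_id | apply RtoC_neq_0, Ht ] ].
    apply is_Rderive_minus; [ apply Cexp_opp_derive | apply is_Rderive_Cexp_lin ]. }
  assert (HDe : forall u, exists z, is_CRInt (g u) eps T z).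
  { intros u. apply ex_CRInt; [ lra | lra | apply Hgt ]. }
  destruct (functional_choice _ HDe) as [D HD]. exists D. split; [ intros u _; apply HD | ].
  intros u Hu. set (b := 1 + RtoC u * (a - 1)).
  assert (Hb : b <> 0).
  { apply neq_0_of_Re. unfold b. replace (Re (1 + RtoC u * (a - 1))) with (1 - u + u * Re a)%R
      by (unfold Re; simpl; ring).
    destruct (Req_dec u 0) as [ -> | Hu0 ]; [ lra | ].
    assert (0 < u * Re a)%R by (apply Rmult_lt_0_compat; lra). lra. }
  set (l := (a - 1) / b * (Cexp (- (b * RtoC eps)) - Cexp (- (b * RtoC T)))).
  (* The parameter derivative has lost the factor 1/t, so it has an elementary primitive. *)
  assert (Hint : is_CRInt (dg u) eps T l).
  { replace l with (- (a - 1) / b * Cexp (- (b * RtoC T)) - - (a - 1) / b * Cexp (- (b * RtoC eps)))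
      by (unfold l; field; exact Hb).
    apply (is_CRInt_derive (fun t => - (a - 1) / b * Cexp (- (b * RtoC t)))); [ lra | lra | | ].
    - intros t _. refine (is_Rderive_eq _ _ _ _ _ (is_Rderive_scal _ _ _ _ (is_Rderive_Cexp_lin b t))).
      unfold dg. fold b. field. exact Hb.
    - intros t _. eexists. unfold dg. apply is_Rderive_scal, is_Rderive_Cexp_lin. }
  (* A complex multiplier k lets one argument treat both components: k = 1 gives the real part and k
     = -i the imaginary part. *)
  assert (Hk : forall k, is_derive (fun u => Re (k * D u)) u (Re (k * l))).
  { intros k.
    apply (is_derive_RInt_of_continuous (fun u t => Re (k * g u t)) (fun u t => Re (k * dg u t)) eps T).
    - lra.
    - intros x t Ht. apply (is_Rderive_scal k), Hgu, Ht.
    - set (c := k * (a - 1)). intros x t.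
      apply continuity_2d_pt_ext with (f := fun u t => (exp (- ((1 + u * (Re a - 1)) * t)) *
        (Re c * cos (u * Im a * t) + Im c * sin (u * Im a * t)))%R).
      + intros x' y'. unfold dg. rewrite Cmult_assoc. fold c. unfold Cexp.
        replace (Re (- ((1 + RtoC x' * (a - 1)) * RtoC y'))) with (- ((1 + x' * (Re a - 1)) * y'))%R
          by (unfold Re; simpl; ring).
        replace (Im (- ((1 + RtoC x' * (a - 1)) * RtoC y'))) with (- (x' * Im a * y'))%R
          by (unfold Im; simpl; ring).
        rewrite cos_neg, sin_neg. unfold Re, Im. simpl. ring.
      + repeat first [ apply continuity_2d_pt_plus | apply continuity_2d_pt_mult
          | apply continuity_2d_pt_opp | apply continuity_2d_pt_const
          | apply continuity_2d_pt_id1 | apply continuity_2d_pt_id2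
          | apply (continuity_1d_2d_pt_comp exp _ _ _ (derivable_continuous_pt _ _ (derivable_pt_exp _)))
          | apply (continuity_1d_2d_pt_comp cos _ _ _ (continuity_cos _))
          | apply (continuity_1d_2d_pt_comp sin _ _ _ (continuity_sin _)) ].
    - intros x. apply (proj1 (is_CRInt_components _ _ _ _) (is_CRInt_scal k _ _ _ _ (HD x))).
    - apply (proj1 (is_CRInt_components _ _ _ _) (is_CRInt_scal k _ _ _ _ Hint)). }
  split.
  - refine (is_derive_ext _ _ _ _ _ (eq_rect _ (is_derive _ u) (Hk 1) _ _)).
    + intros x. rewrite Cmult_1_l. reflexivity.
    + rewrite Cmult_1_l. reflexivity.
  - assert (Him : forall z, Re (- Ci * z) = Im z) by (intros z; unfold Re, Im; simpl; ring).
    refine (is_derive_ext _ _ _ _ _ (eq_rect _ (is_derive _ u) (Hk (- Ci)) _ (Him l))).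
    intros x. apply Him.
Qed.

Lemma Cmod_Cexp_opp_minus_1 (z : C) : (0 <= Re z)%R -> (Cmod (Cexp (- z) - 1) <= 2 * Cmod z)%R.
Proof.
  intros Hz.
  assert (B := is_Rderive_bound _ _ 0 1 (Cmod z) Rle_0_1 (fun t _ => is_Rderive_Cexp_lin z t)).
  cbv beta in B. replace (z * 1) with z in B by ring.
  replace (- (z * 0)) with (RtoC 0) in B by ring. rewrite Cexp_0 in B.
  eapply Rle_trans; [ apply B | right; ring ].
  intros t Ht. rewrite Cmod_mult, Cmod_opp, Cmod_Cexp_lin.
  rewrite <- (Rmult_1_r (Cmod z)) at 2. apply Rmult_le_compat_l; [ apply Cmod_ge_0 | ].
  rewrite <- exp_0. apply exp_le_compat. nra.
Qed.

(** Along b(u) = 1 + u (a-1), the derivative of D(u) - Log b(u) is (a-1)/b times (e^(-b eps) - 1) -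
    e^(-b T), which is small for small eps and large T. The difference vanishes at u = 0, so it is
    small at u = 1. *)
Lemma Frullani (a : C) : (0 < Re a)%R ->
  is_Cint_0_infty (fun t => (Cexp (- RtoC t) - Cexp (- (a * RtoC t))) / RtoC t) (Clog a).
Proof.
  intros Ha.
  (* m bounds Re b(u) from below on the segment, so L/m bounds |(a-1)/b|; Q eps bounds the error at
     the lower limit and 1/(m T) the one at the upper. *)
  set (m := Rmin 1 (Re a)). assert (Hm : (0 < m)%R) by (apply Rmin_glb_lt; lra).
  assert (Hm1 := Rmin_l 1 (Re a)). assert (Hm2 := Rmin_r 1 (Re a)). fold m in Hm1, Hm2.
  assert (Him := Rinv_0_lt_compat _ Hm).
  set (L := (Cmod (a - 1) + 1)%R).
  assert (HL : (1 <= L)%R) by (unfold L; assert (P := Cmod_ge_0 (a - 1)); lra).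
  assert (HLm : (0 < L / m)%R) by (apply Rdiv_lt_0_compat; lra).
  set (Q := (2 * (1 + L))%R).
  apply (is_Cint_of_bound _ _ (2 * (L / m) * (Q + / m))). intros eps T Heps HT.
  destruct (Frullani_param_derive a eps T ltac:(lra) Ha) as [D [HD HdD]].
  exists (D 1%R). split.
  { specialize (HD 1%R ltac:(lra)). replace (1 + RtoC 1 * (a - 1)) with a in HD by ring. exact HD. }
  set (b := fun u : R => 1 + RtoC u * (a - 1)).
  assert (Hbre : forall u, (0 <= u <= 1)%R -> (m <= Re (b u))%R).
  { intros u Hu. unfold b. replace (Re (1 + RtoC u * (a - 1))) with (1 - u + u * Re a)%R
      by (unfold Re; simpl; ring). nra. }
  assert (Hbn : forall u, (0 <= u <= 1)%R -> b u <> 0).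
  { intros u Hu. apply neq_0_of_Re. specialize (Hbre u Hu). lra. }
  assert (HDer : forall u, (0 <= u <= 1)%R -> is_Rderive (fun u => D u - Clog (b u)) u
    ((a - 1) / b u * (Cexp (- (b u * RtoC eps)) - Cexp (- (b u * RtoC T))) - (a - 1) / b u)).
  { intros u Hu. apply is_Rderive_minus; [ apply HdD, Hu | ].
    apply is_Rderive_Clog; [ | specialize (Hbre u Hu); lra ].
    unfold b. refine (is_Rderive_eq _ _ _ _ _ (is_Rderive_plus _ _ _ _ _ (is_Rderive_const 1 u)
      (is_Rderive_mult _ _ _ _ _ (is_Rderive_id u) (is_Rderive_const (a - 1) u)))).
    cbv beta. ring. }
  assert (HTp : (0 < / T)%R) by (apply Rinv_0_lt_compat; lra).
  assert (Bd := is_Rderive_bound _ _ 0 1 (L / m * (Q * eps + / m * / T))%R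
    Rle_0_1 HDer).
  assert (D0 : D 0%R = 0).
  { specialize (HD 0%R ltac:(lra)).
    refine (is_CRInt_unique _ _ _ _ _ HD _).
    apply (is_CRInt_ext (fun _ => 0)); [ lra | lra | | ].
    - intros t Ht. replace (- ((1 + 0 * (a - 1)) * RtoC t)) with (- RtoC t) by ring.
      field. apply RtoC_neq_0, Ht.
    - apply is_CRInt_zero; lra. }
  cbv beta in Bd. rewrite D0 in Bd. replace (b 0%R) with (RtoC 1) in Bd by (unfold b; ring).
  replace (b 1%R) with a in Bd by (unfold b; ring). rewrite Clog_1 in Bd.
  replace (D 1%R - Clog a - (0 - 0)) with (D 1%R - Clog a) in Bd by ring.
  eapply Rle_trans; [ apply Bd | ].
  - intros u Hu. specialize (Hbre u Hu). specialize (Hbn u Hu).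
    assert (Hbm : (Cmod (b u) <= 1 + L)%R).
    { unfold b, L. eapply Rle_trans; [ apply Cmod_triangle | ].
      rewrite Cmod_mult, Cmod_1, Cmod_R, Rabs_pos_eq by lra.
      assert (P := Cmod_ge_0 (a - 1)). nra. }
    replace ((a - 1) / b u * (Cexp (- (b u * RtoC eps)) - Cexp (- (b u * RtoC T))) - (a - 1) / b u)
      with ((a - 1) / b u * ((Cexp (- (b u * RtoC eps)) - 1) - Cexp (- (b u * RtoC T))))
      by (field; exact Hbn).
    rewrite Cmod_mult, Cmod_div by exact Hbn.
    assert (Hbc : (m <= Cmod (b u))%R).
    { eapply Rle_trans; [ exact Hbre | ]. eapply Rle_trans; [ apply Rle_abs | apply re_le_Cmod ]. }
    apply Rmult_le_compat; [ | apply Cmod_ge_0 | | ].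
    + apply Rdiv_le_0_compat; [ apply Cmod_ge_0 | lra ].
    + unfold Rdiv. apply Rmult_le_compat; [ apply Cmod_ge_0 | | unfold L; lra | ].
      * left. apply Rinv_0_lt_compat. lra.
      * apply Rinv_le_contravar; lra.
    + eapply Rle_trans; [ apply Cmod_minus_le | ]. apply Rplus_le_compat.
      * eapply Rle_trans; [ apply Cmod_Cexp_opp_minus_1 | ].
        -- replace (Re (b u * RtoC eps)) with (Re (b u) * eps)%R by (unfold Re; simpl; ring). nra.
        -- rewrite Cmod_mult, (Cmod_RtoC_pos eps) by lra. unfold Q. nra.
      * rewrite Cmod_Cexp_lin.
        assert (HmT : (0 < m * T)%R) by (apply Rmult_lt_0_compat; lra).
        apply Rle_trans with (exp (- (m * T))).
        -- apply exp_le_compat. assert (P : (m * T <= Re (b u) * T)%R) by (apply Rmult_le_compat_r; lra). lra.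
        -- eapply Rle_trans; [ apply exp_opp_le_inv, HmT | ]. right. field. lra.
  - replace (2 * (L / m * (Q * eps + / m * / T)) * (1 - 0))%R
      with (2 * (L / m) * (Q * eps + / m * / T))%R by ring.
    rewrite (Rmult_assoc (2 * (L / m)) (Q + / m)).
    apply Rmult_le_compat_l; [ lra | ]. assert (HQ : (0 < Q)%R) by (unfold Q; lra). nra.
Qed.

(** * Regularized integrals *)

Lemma ex_Rderive_const (a : C) (t : R) : ex_Rderive (fun _ => a) t.
Proof. exists 0. apply is_Rderive_const. Qed.

Lemma ex_Rderive_plus (f g : R -> C) (t : R) :
  ex_Rderive f t -> ex_Rderive g t -> ex_Rderive (fun t => f t + g t) t.
Proof. intros [a Ha] [b Hb]. exists (a + b). apply is_Rderive_plus; assumption. Qed.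

Lemma ex_Rderive_minus (f g : R -> C) (t : R) :
  ex_Rderive f t -> ex_Rderive g t -> ex_Rderive (fun t => f t - g t) t.
Proof. intros [a Ha] [b Hb]. exists (a - b). apply is_Rderive_minus; assumption. Qed.

Lemma ex_Rderive_mult (f g : R -> C) (t : R) :
  ex_Rderive f t -> ex_Rderive g t -> ex_Rderive (fun t => f t * g t) t.
Proof.
  intros [a Ha] [b Hb]. exists (a * g t + f t * b). apply is_Rderive_mult; assumption.
Qed.

Lemma ex_Rderive_pow (f : R -> C) (t : R) (n : nat) :
  ex_Rderive f t -> ex_Rderive (fun t => f t ^ n) t.
Proof.
  intros H. induction n as [ | n IH ]; [ apply (ex_Rderive_const 1) | ].
  apply (ex_Rderive_mult f (fun t => f t ^ n) t H IH).
Qed.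

Lemma ex_Rderive_inv (f : R -> C) (t : R) :
  ex_Rderive f t -> f t <> 0 -> ex_Rderive (fun t => / f t) t.
Proof. intros [a Ha] H. eexists. exact (is_Rderive_inv f t a Ha H). Qed.

Lemma ex_Rderive_id (t : R) : ex_Rderive (fun t => RtoC t) t.
Proof. eexists. apply is_Rderive_id. Qed.

Lemma ex_Rderive_Cexp_lin (a : C) (t : R) : ex_Rderive (fun t => Cexp (- (a * RtoC t))) t.
Proof. eexists. apply is_Rderive_Cexp_lin. Qed.

Lemma ex_Rderive_Cexp_opp (t : R) : ex_Rderive (fun t => Cexp (- RtoC t)) t.
Proof. eexists. apply Cexp_opp_derive. Qed.

Lemma ex_Rderive_csum (f : nat -> R -> C) (t : R) (n : nat) :
  (forall k, ex_Rderive (f k) t) -> ex_Rderive (fun t => csum (fun k => f k t) n) t.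
Proof.
  intros H. induction n as [ | n IH ]; [ apply (ex_Rderive_const 0) | ].
  apply (ex_Rderive_plus (fun t => csum (fun k => f k t) n) (f n)); auto.
Qed.

(** Taylor coefficients of e^(-at) in t. *)
Definition exp_coeff (a : C) (l : nat) : C := / INR (fact l) * (- a) ^ l.

Lemma exp_coeff_S (a : C) (l : nat) : INR (S l) * exp_coeff a (S l) = - a * exp_coeff a l.
Proof.
  unfold exp_coeff. rewrite RtoC_INR_fact_S, Cpow_S. field.
  split; [ apply INR_fact_C_neq_0 | apply INR_S_C_neq_0 ].
Qed.

(* [reg_num l a t / t^(l+1)] is e^(-at) / t^(l+1) minus its polar part at 0, the residue being
   carried by e^(-t) / t so that the result is integrable at infinity too. *)
Definition reg_num (l : nat) (a : C) (t : R) : C :=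
  Cexp (- (a * RtoC t)) - csum (fun m => exp_coeff a m * RtoC t ^ m) l
  - exp_coeff a l * RtoC t ^ l * Cexp (- RtoC t).

Definition reg_value (l : nat) (a : C) : C := exp_coeff a l * (harmonic l - Clog a).

(** Differentiation lowers the level and multiplies by -a, as for e^(-at) itself; the additional
    term comes from the factor e^(-t) attached to the residue. *)
Lemma is_Rderive_reg_num (l : nat) (a : C) (t : R) :
  is_Rderive (reg_num (S l) a) t
    (- a * reg_num l a t + exp_coeff a (S l) * RtoC t ^ S l * Cexp (- RtoC t)).
Proof.
  unfold reg_num.
  apply (is_Rderive_ext (fun t => Cexp (- (a * RtoC t))
    - (exp_coeff a 0 + csum (fun m => exp_coeff a (S m) * RtoC t ^ S m) l)
    - (exp_coeff a (S l) * RtoC t ^ S l) * Cexp (- RtoC t))).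
  { intros x. rewrite csum_shift. simpl. ring. }
  eapply is_Rderive_eq; [ | apply is_Rderive_minus; [ apply is_Rderive_minus;
    [ apply is_Rderive_Cexp_lin
    | apply is_Rderive_plus; [ apply is_Rderive_const
      | apply (is_Rderive_csum (fun m t => exp_coeff a (S m) * RtoC t ^ S m) t
          (fun m => exp_coeff a (S m) * (INR (S m) * RtoC t ^ m * 1))) ] ]
    | apply is_Rderive_mult; [ apply is_Rderive_scal, is_Rderive_pow, is_Rderive_id
      | apply Cexp_opp_derive ] ] ].
  - rewrite (csum_ext _ (fun m => - a * (exp_coeff a m * RtoC t ^ m))).
    + rewrite csum_mult_l.
      replace (exp_coeff a (S l) * (INR (S l) * RtoC t ^ l * 1))
        with (INR (S l) * exp_coeff a (S l) * RtoC t ^ l) by ring.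
      rewrite exp_coeff_S. ring.
    + intros k _. replace (exp_coeff a (S k) * (INR (S k) * RtoC t ^ k * 1))
        with (INR (S k) * exp_coeff a (S k) * RtoC t ^ k) by ring.
      rewrite exp_coeff_S. ring.
  - intros k _. apply is_Rderive_scal, is_Rderive_pow, is_Rderive_id.
Qed.

Lemma is_Rderive_reg_kernel (l : nat) (a : C) (t : R) : (0 < t)%R ->
  is_Rderive (fun t => reg_num (S l) a t / RtoC t ^ S l) t
    (- INR (S l) * (reg_num (S l) a t / RtoC t ^ S (S l))
     + (- a * (reg_num l a t / RtoC t ^ S l) + exp_coeff a (S l) * Cexp (- RtoC t))).
Proof.
  intros Ht. assert (Hp := RtoC_neq_0 t Ht).
  eapply is_Rderive_eq;
    [ | apply is_Rderive_mult; [ apply is_Rderive_reg_num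
      | apply is_Rderive_inv; [ apply is_Rderive_pow, is_Rderive_id | apply Cpow_nz, Hp ] ] ].
  rewrite !Cpow_S. field. split; [ apply Cpow_nz, Hp | exact Hp ].
Qed.

Lemma ex_Rderive_reg_kernel (l n : nat) (a : C) (t : R) : (0 < t)%R ->
  ex_Rderive (fun t => reg_num l a t / RtoC t ^ n) t.
Proof.
  intros Ht. apply ex_Rderive_mult.
  - unfold reg_num. apply ex_Rderive_minus; [ apply ex_Rderive_minus | ].
    + apply ex_Rderive_Cexp_lin.
    + apply (ex_Rderive_csum (fun m t => exp_coeff a m * RtoC t ^ m)). intros k.
      apply ex_Rderive_mult; [ apply ex_Rderive_const | apply ex_Rderive_pow, ex_Rderive_id ].
    + apply ex_Rderive_mult; [ | apply ex_Rderive_Cexp_opp ].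
      apply ex_Rderive_mult; [ apply ex_Rderive_const | apply ex_Rderive_pow, ex_Rderive_id ].
  - apply ex_Rderive_inv; [ apply ex_Rderive_pow, ex_Rderive_id | apply Cpow_nz, RtoC_neq_0, Ht ].
Qed.

Lemma exp_Cpseries (a : C) (t : C) : is_Cpseries (exp_coeff a) t (Cexp (- (a * t))).
Proof.
  replace (- (a * t)) with (- a * t) by ring.
  refine (is_series_Cext _ _ _ _ _ eq_refl (Cexp_series (- a * t))).
  intros n. unfold exp_coeff. rewrite Cpow_mult_l. ring.
Qed.

Lemma exp_remainder (a : C) (J : nat) : exists B, forall t, (0 < t <= 1)%R ->
  (Cmod (Cexp (- (a * RtoC t)) - csum (fun m => exp_coeff a m * RtoC t ^ m)%C J) <= B * t ^ J)%R.
Proof.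
  destruct (entire_bounds (exp_coeff a) (fun t => Cexp (- (a * t))) 2 ltac:(lra) (exp_Cpseries a))
    as [B [HB HBj]].
  exists (2 * B)%R. intros t Ht.
  assert (Hm : Cmod (RtoC t) = t) by (apply Cmod_RtoC_pos; lra).
  eapply Rle_trans; [ apply (is_Cpseries_remainder (exp_coeff a) 2 B (RtoC t) _ J);
    [ lra | exact HBj | lra | apply exp_Cpseries ] | ].
  rewrite Hm. apply Rmult_le_compat_l; [ lra | ]. apply pow_incr. lra.
Qed.

(** Adding and subtracting the term of degree l+1 leaves a Taylor remainder and a multiple of
    t^(l+1) (e^(-t) - 1), both of order t^(l+2). *)
Lemma reg_boundary_0 (l : nat) (a : C) : exists B, forall t, (0 < t <= 1)%R ->
  (Cmod (reg_num (S l) a t / RtoC t ^ S l) <= B * t)%R.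
Proof.
  destruct (exp_remainder a (S (S l))) as [B Hrem].
  set (c := Cmod (exp_coeff a (S l))). assert (Hc := Cmod_ge_0 (exp_coeff a (S l))). fold c in Hc.
  exists (B + c * 2)%R. intros t Ht. specialize (Hrem t Ht).
  assert (Hp := RtoC_neq_0 t (proj1 Ht)). assert (HpS := Cpow_nz _ (S l) Hp).
  assert (Hm : Cmod (RtoC t) = t) by (apply Cmod_RtoC_pos; lra).
  assert (HtS := pow_lt t (S l) (proj1 Ht)).
  replace (reg_num (S l) a t / RtoC t ^ S l) with
    ((Cexp (- (a * RtoC t)) - csum (fun m => exp_coeff a m * RtoC t ^ m) (S (S l))) / RtoC t ^ S l
      - exp_coeff a (S l) * (Cexp (- RtoC t) - 1)).
  - eapply Rle_trans; [ apply Cmod_minus_le | ]. rewrite Rmult_plus_distr_r.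
    apply Rplus_le_compat.
    + rewrite Cmod_div by exact HpS. rewrite Cmod_pow, Hm.
      apply Rle_div_l; [ exact HtS | ].
      replace (B * t * t ^ S l)%R with (B * t ^ S (S l))%R by (simpl; ring). exact Hrem.
    + rewrite Cmod_mult. fold c. rewrite Rmult_assoc. apply Rmult_le_compat_l; [ exact Hc | ].
      rewrite <- Hm at 2. apply Cmod_Cexp_opp_minus_1. rewrite re_RtoC. lra.
  - unfold reg_num.
    change (csum (fun m => exp_coeff a m * RtoC t ^ m) (S (S l)))
      with (csum (fun m => exp_coeff a m * RtoC t ^ m) (S l) + exp_coeff a (S l) * RtoC t ^ S l).
    field. exact HpS.
Qed.

Lemma poly_bound_far (c : nat -> C) (d : R) (l : nat) : (0 < d)%R -> exists B, (0 <= B)%R /\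
  forall t, (d <= t)%R -> (Cmod (csum (fun m => c m * RtoC t ^ m)%C (S l)) <= B * t ^ l)%R.
Proof.
  intros Hd. assert (Hid := Rinv_0_lt_compat _ Hd). induction l as [ | l [B [HB IH]] ].
  - exists (Cmod (c O)). split; [ apply Cmod_ge_0 | ]. intros t Ht. simpl.
    replace (0 + c O * 1) with (c O) by ring. lra.
  - exists (B * / d + Cmod (c (S l)))%R.
    split; [ assert (P := Cmod_ge_0 (c (S l))); assert (Q := Rmult_le_pos B (/ d) HB); lra | ].
    intros t Ht. assert (Ht0 : (0 < t)%R) by lra. assert (Htl := pow_lt t l Ht0).
    change (csum (fun m => c m * RtoC t ^ m)%C (S (S l)))
      with (csum (fun m => c m * RtoC t ^ m)%C (S l) + c (S l) * RtoC t ^ S l).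
    eapply Rle_trans; [ apply Cmod_triangle | ]. rewrite Rmult_plus_distr_r.
    apply Rplus_le_compat.
    + eapply Rle_trans; [ apply IH, Ht | ]. rewrite Rmult_assoc. apply Rmult_le_compat_l; [ exact HB | ].
      replace (t ^ l)%R with (/ d * d * t ^ l)%R by (field; lra).
      rewrite Rmult_assoc. apply Rmult_le_compat_l; [ lra | ]. simpl. apply Rmult_le_compat_r; lra.
    + rewrite Cmod_mult, Cmod_pow, Cmod_RtoC_pos by lra. lra.
Qed.

(** The subtracted polynomial has degree at most l, one less than the denominator; the exponentials
    decay. *)
Lemma reg_boundary_infty (l : nat) (a : C) : (0 < Re a)%R -> exists B,
  forall t, (1 <= t)%R -> (Cmod (reg_num (S l) a t / RtoC t ^ S l) <= B * / t)%R.
Proof.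
  intros Ha.
  destruct (poly_bound_far (exp_coeff a) 1 l Rlt_0_1) as [B [HB Hpoly]].
  exists (1 + B + Cmod (exp_coeff a (S l)))%R. intros t Ht. specialize (Hpoly t Ht).
  assert (Ht0 : (0 < t)%R) by lra. assert (HpS := Cpow_nz _ (S l) (RtoC_neq_0 t Ht0)).
  assert (Htl := pow_lt t l Ht0). assert (Htl1 := pow_R1_Rle t l Ht).
  replace (reg_num (S l) a t / RtoC t ^ S l)
    with ((Cexp (- (a * RtoC t)) - csum (fun m => exp_coeff a m * RtoC t ^ m) (S l)) / RtoC t ^ S l
      - exp_coeff a (S l) * Cexp (- RtoC t)) by (unfold reg_num; field; exact HpS).
  eapply Rle_trans; [ apply Cmod_minus_le | ]. rewrite (Rmult_plus_distr_r (1 + B)).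
  apply Rplus_le_compat.
  - rewrite Cmod_div by exact HpS. rewrite Cmod_pow, (Cmod_RtoC_pos t) by lra.
    apply Rle_div_l; [ apply pow_lt, Ht0 | ].
    replace ((1 + B) * / t * t ^ S l)%R with ((1 + B) * t ^ l)%R by (simpl; field; lra).
    eapply Rle_trans; [ apply Cmod_minus_le | ]. rewrite Cmod_Cexp_lin.
    assert (H1 := exp_opp_lt_1 (Re a * t) (Rmult_lt_0_compat _ _ Ha Ht0)). lra.
  - rewrite Cmod_mult, Cmod_Cexp, Re_opp, re_RtoC.
    apply Rmult_le_compat_l; [ apply Cmod_ge_0 | apply exp_opp_le_inv, Ht0 ].
Qed.

Lemma is_Cint_exp_opp : is_Cint_0_infty (fun t => Cexp (- RtoC t)) 1.
Proof.
  replace (RtoC 1) with (0 - - (1)) by ring.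
  apply (is_Cint_derive (fun t => - (1) * Cexp (- RtoC t)) _ _ _ 2 1).
  - intros t _. refine (is_Rderive_eq _ _ _ _ _ (is_Rderive_scal _ _ _ _ (Cexp_opp_derive t))). ring.
  - intros t _. apply ex_Rderive_Cexp_opp.
  - intros t Ht. replace (- (1) * Cexp (- RtoC t) - - (1)) with (- (Cexp (- RtoC t) - 1)) by ring.
    rewrite Cmod_opp. rewrite <- (Cmod_RtoC_pos t) at 2 by lra.
    apply Cmod_Cexp_opp_minus_1. rewrite re_RtoC. lra.
  - intros t Ht. replace (- (1) * Cexp (- RtoC t) - 0) with (- Cexp (- RtoC t)) by ring.
    rewrite Cmod_opp, Cmod_Cexp, Re_opp, re_RtoC, Rmult_1_l. apply exp_opp_le_inv. lra.
Qed.

Lemma harmonic_0 : harmonic 0 = 0%R.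
Proof. unfold harmonic. rewrite sum_n_m_zero by lia. reflexivity. Qed.

Lemma harmonic_S (l : nat) : harmonic (S l) = (harmonic l + / INR (S l))%R.
Proof. unfold harmonic. rewrite sum_n_Sm by lia. reflexivity. Qed.

(** Integration by parts with vanishing boundary terms gives (l+1) V_(l+1) = -a V_l + c_(l+1), where
    c denotes [exp_coeff a] and V the integrals. As (l+1) c_(l+1) = -a c_l, each step adds 1/(l+1)
    to the harmonic number; the start l = 0 is Frullani's integral with the opposite sign. *)
Lemma reg_kernel_integral (l : nat) (a : C) : (0 < Re a)%R ->
  is_Cint_0_infty (fun t => reg_num l a t / RtoC t ^ S l) (reg_value l a).
Proof.
  intros Ha. induction l as [ | l IH ].
  - apply (is_Cint_ext (fun t => - (1) * ((Cexp (- RtoC t) - Cexp (- (a * RtoC t))) / RtoC t))).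
    + intros t Ht. unfold reg_num, exp_coeff. simpl. field. apply RtoC_neq_0, Ht.
    + replace (reg_value 0 a) with (- (1) * Clog a).
      * apply is_Cint_scal, Frullani, Ha.
      * unfold reg_value, exp_coeff. rewrite harmonic_0. simpl. field.
  - assert (HW : is_Cint_0_infty (fun t => - INR (S l) * (reg_num (S l) a t / RtoC t ^ S (S l))
      + (- a * (reg_num l a t / RtoC t ^ S l) + exp_coeff a (S l) * Cexp (- RtoC t))) (0 - 0)).
    { destruct (reg_boundary_0 l a) as [B0 HB0]. destruct (reg_boundary_infty l a Ha) as [B1 HB1].
      apply (is_Cint_derive (fun t => reg_num (S l) a t / RtoC t ^ S l) _ _ _ B0 B1).
      - intros t Ht. apply is_Rderive_reg_kernel, Ht.
      - intros t Ht. apply ex_Rderive_plus.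
        + apply ex_Rderive_mult; [ apply ex_Rderive_const | apply ex_Rderive_reg_kernel, Ht ].
        + apply ex_Rderive_plus; apply ex_Rderive_mult;
            [ apply ex_Rderive_const | apply ex_Rderive_reg_kernel, Ht
            | apply ex_Rderive_const | apply ex_Rderive_Cexp_opp ].
      - intros t Ht. unfold Cminus. rewrite Copp_0, Cplus_0_r. apply HB0, Ht.
      - intros t Ht. unfold Cminus. rewrite Copp_0, Cplus_0_r. apply HB1, Ht. }
    assert (HS := INR_S_C_neq_0 l).
    assert (HR := is_Cint_scal (/ INR (S l)) _ _ (is_Cint_minus _ _ _ _
      (is_Cint_plus _ _ _ _ (is_Cint_scal (- a) _ _ IH)
        (is_Cint_scal (exp_coeff a (S l)) _ _ is_Cint_exp_opp)) HW)).
    replace (reg_value (S l) a)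
      with (/ INR (S l) * (- a * reg_value l a + exp_coeff a (S l) * 1 - (0 - 0))).
    + refine (is_Cint_ext _ _ _ _ HR). intros t Ht. cbv beta.
      assert (Hp := Cpow_nz _ l (RtoC_neq_0 t Ht)). assert (Hp0 := RtoC_neq_0 t Ht).
      field. repeat split; first [ exact HS | apply Cpow_nz, Hp0 ].
    + unfold reg_value. rewrite harmonic_S, RtoC_plus, RtoC_inv by (apply not_0_INR; lia).
      replace (- a * (exp_coeff a l * (harmonic l - Clog a)))
        with ((- a * exp_coeff a l) * (harmonic l - Clog a)) by ring.
      rewrite <- exp_coeff_S. field. exact HS.
Qed.

Lemma bern_exp_coeff (m : nat) (w : C) :
  bern m w = csum (fun l => exp_coeff w l * beta (m - l)) (S m).
Proof. reflexivity. Qed.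

Lemma bern_exp_coeff_difference (n : nat) (w : C) :
  csum (fun l => beta (S n - l) * (exp_coeff w l - exp_coeff (w + 1) l)) (S (S n)) = exp_coeff w n.
Proof.
  change (exp_coeff w n) with (/ INR (fact n) * (- w) ^ n).
  rewrite <- bern_difference, !bern_exp_coeff, <- csum_minus.
  apply csum_ext. intros k _. ring.
Qed.

(* [polar c x l = sum_(m<l) c m x^(l-m)], in the Horner form that makes the next lemma an
   induction. *)
Fixpoint polar (c : nat -> C) (x : C) (l : nat) : C :=
  match l with O => 0 | S k => x * (polar c x k + c k) end.

Lemma polar_csum (c : nat -> C) (t : C) (l : nat) : t <> 0 ->
  polar c (/ t) l = csum (fun m => c m * t ^ m) l / t ^ l.
Proof.
  intros Ht. induction l as [ | l IH ]; simpl; [ field | ].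
  rewrite IH. field. split; [ apply Cpow_nz, Ht | exact Ht ].
Qed.

(* The polar parts on both sides of the difference equation of the integrand agree. *)
Lemma polar_difference (n : nat) (w x : C) :
  csum (fun l => beta (S n - l) * (polar (exp_coeff w) x l - polar (exp_coeff (w + 1)) x l)) (S (S n))
  = polar (exp_coeff w) x n.
Proof.
  (* The Horner step of [polar] factors out x and lowers the order by one, at the price of the
     residue sum evaluated by [bern_exp_coeff_difference]. *)
  assert (Hstep : forall K, csum (fun l => beta (S K - l) *
      (polar (exp_coeff w) x l - polar (exp_coeff (w + 1)) x l)) (S (S K)) =
    x * (csum (fun l => beta (K - l) *
      (polar (exp_coeff w) x l - polar (exp_coeff (w + 1)) x l)) (S K) +
      csum (fun l => beta (K - l) * (exp_coeff w l - exp_coeff (w + 1) l)) (S K))).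
  { intros K. rewrite csum_shift, <- csum_plus, <- csum_mult_l.
    replace (beta (S K - 0) * (polar (exp_coeff w) x 0 - polar (exp_coeff (w + 1)) x 0))
      with (RtoC 0) by (simpl; ring).
    rewrite Cplus_0_l. apply csum_ext. intros k _.
    replace (S K - S k)%nat with (K - k)%nat by lia. simpl polar. ring. }
  induction n as [ | n IH ].
  - rewrite Hstep. unfold exp_coeff. simpl. ring.
  - rewrite Hstep, IH, bern_exp_coeff_difference. reflexivity.
Qed.

Lemma reg_kernel_polar (l : nat) (a : C) (t : R) : (0 < t)%R ->
  reg_num l a t / RtoC t ^ S l = / RtoC t * (Cexp (- (a * RtoC t)) / RtoC t ^ l
    - polar (exp_coeff a) (/ RtoC t) l - exp_coeff a l * Cexp (- RtoC t)).
Proof.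
  intros Ht. assert (Hp := RtoC_neq_0 t Ht). rewrite polar_csum by exact Hp.
  unfold reg_num. rewrite Cpow_S. field. split; [ apply Cpow_nz, Hp | exact Hp ].
Qed.

Lemma one_minus_exp_neq_0 (t : R) : (0 < t)%R -> 1 - Cexp (- RtoC t) <> 0.
Proof.
  intros Ht. rewrite <- RtoC_opp, Cexp_RtoC, <- RtoC_minus. intros E. apply RtoC_inj in E.
  assert (H := exp_opp_lt_1 t Ht). lra.
Qed.

(** The factor 1 - e^(-t) in e^(-wt) - e^(-(w+1)t) cancels the denominator, leaving negative powers
    of t times exponentials. Their integrals diverge singly; in the regularized form the added polar
    parts cancel by [polar_difference] and the added multiples of e^(-t)/t by
    [bern_exp_coeff_difference]. *)
Lemma integrand_difference (n : nat) (w : C) (t : R) : (0 < t)%R ->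
  integrand n w t - integrand n (w + 1) t =
  reg_num n w t / RtoC t ^ S n - csum (fun l => beta (S n - l) *
    (reg_num l w t / RtoC t ^ S l - reg_num l (w + 1) t / RtoC t ^ S l)) (S (S n)).
Proof.
  intros Ht. assert (Hp := RtoC_neq_0 t Ht). assert (Hd := one_minus_exp_neq_0 t Ht).
  set (x := / RtoC t). set (e := Cexp (- (w * RtoC t))).
  assert (E1 : Cexp (- ((w + 1) * RtoC t)) = e * Cexp (- RtoC t)).
  { unfold e. rewrite <- Cexp_plus. f_equal. ring. }
  rewrite (csum_ext _ (fun l =>
    x * (e * (1 - Cexp (- RtoC t)) * (beta (S n - l) * / RtoC t ^ l))
    - (x * (beta (S n - l) * (polar (exp_coeff w) x l - polar (exp_coeff (w + 1)) x l))
    + x * Cexp (- RtoC t) * (beta (S n - l) * (exp_coeff w l - exp_coeff (w + 1) l))))).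
  2: { intros k _. rewrite !reg_kernel_polar by exact Ht. rewrite E1. fold e x.
       unfold Cdiv. ring. }
  rewrite csum_minus, csum_plus, !csum_mult_l, polar_difference, bern_exp_coeff_difference.
  rewrite reg_kernel_polar by exact Ht. fold e x.
  (* Reversing the order of summation turns negative powers into the Laurent polynomial divided by
     t^n. *)
  assert (E2 : csum (fun l => beta (S n - l) * / RtoC t ^ l) (S (S n)) =
    b_partial_sum n (RtoC t) / RtoC t ^ n).
  { rewrite b_partial_sum_eq, csum_rev. unfold Cdiv at 1. rewrite <- csum_mult_r.
    apply csum_ext. intros k Hk.
    replace (S n - (S (S n) - 1 - k))%nat with k by lia.
    replace (S (S n) - 1 - k)%nat with (S n - k)%nat by lia.
    assert (Hk2 : RtoC t ^ k * RtoC t ^ (S n - k) = RtoC t ^ n * RtoC t).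
    { rewrite <- Cpow_add_r. replace (k + (S n - k))%nat with (S n) by lia. rewrite Cpow_S. ring. }
    assert (P1 := Cpow_nz _ (S n - k) Hp). assert (P2 := Cpow_nz _ n Hp).
    replace (/ RtoC t ^ (S n - k)) with (RtoC t ^ k / (RtoC t ^ n * RtoC t)).
    - field. split; assumption.
    - rewrite <- Hk2. field. split; [ exact P1 | apply Cpow_nz, Hp ]. }
  rewrite E2. unfold integrand. rewrite E1. fold e. unfold x.
  assert (P2 := Cpow_nz _ n Hp). field. repeat split; assumption.
Qed.

(** * The derivative at the negative integers *)

(** The integrand without e^(-wt): it is bounded on the half-line and independent of w, so one bound
    serves all shifts k + w. *)
Definition integrand_factor (n : nat) (t : R) : C :=
  (RtoC t / (1 - Cexp (- RtoC t)) - csum (fun j => beta j * RtoC t ^ j) (S (S n))) / RtoC t ^ S (S n).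

Lemma integrand_eq (n : nat) (w : C) (t : R) : (0 < t)%R ->
  integrand n w t = integrand_factor n t * Cexp (- (w * RtoC t)).
Proof.
  intros Ht. assert (Hp := RtoC_neq_0 t Ht). assert (Hd := one_minus_exp_neq_0 t Ht).
  assert (Hpn := Cpow_nz _ n Hp). unfold integrand, integrand_factor. rewrite b_partial_sum_eq.
  replace (csum (fun j => beta j * (RtoC t ^ j / RtoC t)) (S (S n)))
    with (csum (fun j => beta j * RtoC t ^ j) (S (S n)) * / RtoC t).
  - rewrite !Cpow_S. field. repeat split; assumption.
  - rewrite <- csum_mult_r. apply csum_ext. intros k _. field. exact Hp.
Qed.

(** The numerator is the remainder of order n + 2 of the [beta] series; 1/4 is half of the radius
    1/2 for which the coefficient bound is available. *)
Lemma integrand_factor_near_0 (n : nat) (t : R) : (0 < t < / 4)%R ->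
  (Cmod (integrand_factor n t) <= 2 * 2 ^ S (S n))%R.
Proof.
  intros Ht. assert (Hp := RtoC_neq_0 t (proj1 Ht)).
  assert (Hm : Cmod (RtoC t) = t) by (apply Cmod_RtoC_pos; lra).
  destruct (beta_Cpseries (RtoC t) Hp ltac:(lra)) as [Hd Hs].
  assert (Hb := half_disc_bound beta Cmod_beta).
  assert (T := is_Cpseries_remainder beta (/ 2) 1 (RtoC t) _ (S (S n)) ltac:(lra) Hb ltac:(lra) Hs).
  rewrite Hm in T. assert (HtS := pow_lt t (S (S n)) (proj1 Ht)).
  unfold integrand_factor. rewrite Cmod_div by (apply Cpow_nz, Hp). rewrite Cmod_pow, Hm.
  apply Rle_div_l; [ exact HtS | ].
  eapply Rle_trans; [ exact T | ]. right.
  unfold Rdiv. rewrite Rinv_inv, Rpow_mult_distr. ring.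
Qed.

Lemma integrand_factor_far (n : nat) : exists B, (0 <= B)%R /\ forall t, (/ 4 <= t)%R ->
  (Cmod (integrand_factor n t) <= B)%R.
Proof.
  set (q := (1 - exp (- / 4))%R).
  assert (Hq : (0 < q)%R) by (assert (H := exp_opp_lt_1 (/ 4) ltac:(lra)); unfold q; lra).
  assert (Hqp := Rinv_0_lt_compat _ Hq).
  destruct (poly_bound_far beta (/ 4) (S n) ltac:(lra)) as [B [HB Hpoly]].
  assert (P4 := pow_lt 4 (S n) ltac:(lra)).
  exists (/ q * 4 ^ S n + B * 4)%R.
  split; [ assert (H1 := Rmult_lt_0_compat _ _ Hqp P4); lra | ].
  intros t Ht. assert (Ht0 : (0 < t)%R) by lra. assert (Hp := RtoC_neq_0 t Ht0).
  assert (Hd := one_minus_exp_neq_0 t Ht0). assert (Hpn := Cpow_nz _ n Hp).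
  assert (Hm : Cmod (RtoC t) = t) by (apply Cmod_RtoC_pos; lra).
  assert (HtS := pow_lt t (S n) Ht0).
  assert (Hit : (0 < / t <= 4)%R).
  { split; [ apply Rinv_0_lt_compat, Ht0 | ].
    rewrite <- (Rinv_inv 4). apply Rinv_le_contravar; lra. }
  replace (integrand_factor n t) with (/ (1 - Cexp (- RtoC t)) * / RtoC t ^ S n
     - csum (fun j => beta j * RtoC t ^ j) (S (S n)) * / (RtoC t ^ S n * RtoC t))
    by (unfold integrand_factor; rewrite !Cpow_S; field; repeat split; assumption).
  assert (HpS := Cpow_nz _ (S n) Hp).
  eapply Rle_trans; [ apply Cmod_minus_le | ].
  rewrite !Cmod_mult, !Cmod_inv by (first [ exact Hd | exact HpS | apply Cmult_neq_0; assumption ]).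
  rewrite Cmod_mult, Cmod_pow, Hm. apply Rplus_le_compat.
  - rewrite <- pow_inv. apply Rmult_le_compat.
    + left. apply Rinv_0_lt_compat, Cmod_gt_0, Hd.
    + apply pow_le. lra.
    + apply Rinv_le_contravar; [ exact Hq | ].
      rewrite <- RtoC_opp, Cexp_RtoC, <- RtoC_minus, Cmod_R. eapply Rle_trans; [ | apply Rle_abs ].
      assert (H : (exp (- t) <= exp (- / 4))%R) by (apply exp_le_compat; lra). unfold q. lra.
    + apply pow_incr. lra.
  - apply Rle_trans with (B * t ^ S n * / (t ^ S n * t))%R.
    + apply Rmult_le_compat_r; [ | apply Hpoly, Ht ].
      left. apply Rinv_0_lt_compat, Rmult_lt_0_compat; assumption.
    + replace (B * t ^ S n * / (t ^ S n * t))%R with (B * / t)%R by (field; lra).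
      apply Rmult_le_compat_l; [ exact HB | apply Hit ].
Qed.

Lemma integrand_bound (n : nat) : exists B, (0 <= B)%R /\ forall w t, (0 < t)%R ->
  (Cmod (integrand n w t) <= B * exp (- (Re w * t)))%R.
Proof.
  destruct (integrand_factor_far n) as [B [HB Hfar]].
  assert (P2 : (0 < 2 ^ S (S n))%R) by (apply pow_lt; lra).
  exists (2 * 2 ^ S (S n) + B)%R. split; [ lra | ]. intros w t Ht.
  rewrite integrand_eq, Cmod_mult, Cmod_Cexp_lin by exact Ht.
  apply Rmult_le_compat_r; [ left; apply exp_pos | ].
  destruct (Rlt_le_dec t (/ 4)) as [H | H].
  - assert (H' := integrand_factor_near_0 n t (conj Ht H)). lra.
  - specialize (Hfar t H). lra.
Qed.

Lemma ex_Rderive_integrand (n : nat) (w : C) (t : R) : (0 < t)%R ->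
  ex_Rderive (fun t => integrand n w t) t.
Proof.
  intros Ht.
  assert (Hp := RtoC_neq_0 t Ht). assert (Hid := ex_Rderive_id t).
  assert (Hc := fun z => ex_Rderive_const z t). assert (Hinv := ex_Rderive_inv _ t Hid Hp).
  unfold integrand, Cdiv. apply ex_Rderive_mult;
    [ apply ex_Rderive_mult; [ apply ex_Rderive_mult | ] | apply ex_Rderive_mult; [ | exact Hinv ] ].
  - exact (Hc 1).
  - exact (ex_Rderive_inv _ t (ex_Rderive_pow _ t n Hid) (Cpow_nz _ n Hp)).
  - apply ex_Rderive_minus.
    + apply ex_Rderive_mult; [ exact (Hc 1) | ]. apply ex_Rderive_inv; [ | apply one_minus_exp_neq_0, Ht ].
      exact (ex_Rderive_minus _ _ t (Hc 1) (ex_Rderive_Cexp_opp t)).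
    + destruct (ex_Rderive_csum (fun j t => beta j * (RtoC t ^ j * / RtoC t)) t (S (S n))) as [l Hl].
      { intros k. apply ex_Rderive_mult; [ exact (Hc (beta k)) | ].
        exact (ex_Rderive_mult _ _ t (ex_Rderive_pow _ t k Hid) Hinv). }
      exists l. refine (is_Rderive_ext _ _ _ _ _ Hl). intros x. rewrite b_partial_sum_eq. reflexivity.
  - apply ex_Rderive_Cexp_lin.
Qed.

Lemma integrand_integrable (n : nat) (w : C) : (0 < Re w)%R ->
  is_Cint_0_infty (integrand n w) (Cint_0_infty (integrand n w)).
Proof.
  intros Hw. destruct (integrand_bound n) as [B [HB Hb]].
  destruct (is_Cint_dominated (integrand n w) B (Re w) Hw HB) as [z [Hz _]].
  - intros t Ht. apply ex_Rderive_integrand, Ht.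
  - intros t Ht. apply Hb, Ht.
  - rewrite (Cint_eq _ _ Hz). exact Hz.
Qed.

(** The integral is at most B / Re(k+w), with B independent of k. *)
Lemma integral_vanishes (n : nat) (w : C) : (0 < Re w)%R ->
  forall eps, (0 < eps)%R -> exists N, forall k, (N <= k)%nat ->
    (Cmod (Cint_0_infty (integrand n (INR k + w))) < eps)%R.
Proof.
  intros Hw eps Heps. destruct (integrand_bound n) as [B [HB Hb]].
  destruct (INR_unbounded (B / eps)) as [N HN]. exists N. intros k Hk.
  assert (Hre : Re (INR k + w) = (INR k + Re w)%R) by (rewrite Re_plus, re_RtoC; reflexivity).
  assert (HNk : (INR N <= INR k)%R) by (apply le_INR; exact Hk).
  assert (Hk0 := pos_INR k).
  destruct (is_Cint_dominated (integrand n (INR k + w)) B (Re (INR k + w))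
    ltac:(lra) HB) as [z [Hz Hzb]].
  - intros t Ht. apply ex_Rderive_integrand, Ht.
  - intros t Ht. apply Hb, Ht.
  - rewrite (Cint_eq _ _ Hz). eapply Rle_lt_trans; [ exact Hzb | ].
    assert (Hkp : (B / eps < Re (INR k + w))%R) by lra.
    apply Rlt_div_l; [ lra | ].
    apply Rle_lt_trans with (eps * (B / eps))%R; [ right; field; lra | ].
    apply Rmult_lt_compat_l; assumption.
Qed.

(** The value of the regularized integrals weighted by [beta]; at K = n + 1 it is the [r_hat] of the
    statement. *)
Definition reg_sum (K : nat) (x : C) : C := csum (fun l => beta (K - l) * reg_value l x) (S K).

(** Every regularized kernel converges by itself, so the pointwise identity can be integrated term
    by term. *)
Lemma integral_difference (n : nat) (w : C) : (0 < Re w)%R ->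
  Cint_0_infty (integrand n w) - Cint_0_infty (integrand n (w + 1)) =
  reg_value n w - (reg_sum (S n) w - reg_sum (S n) (w + 1)).
Proof.
  intros Hw. assert (Hw1 : (0 < Re (w + 1))%R) by (rewrite Re_plus, re_RtoC; lra).
  assert (H1 := is_Cint_minus _ _ _ _ (integrand_integrable n w Hw)
    (integrand_integrable n (w + 1) Hw1)).
  refine (is_Cint_unique _ _ _ H1 _).
  apply (is_Cint_ext _ _ _ (fun t Ht => eq_sym (integrand_difference n w t Ht))).
  apply is_Cint_minus; [ apply reg_kernel_integral, Hw | ].
  unfold reg_sum. rewrite <- csum_minus.
  rewrite (csum_ext _ (fun l => beta (S n - l) * (reg_value l w - reg_value l (w + 1))))
    by (intros; ring).
  apply (is_Cint_csum (fun l t => beta (S n - l) *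
    (reg_num l w t / RtoC t ^ S l - reg_num l (w + 1) t / RtoC t ^ S l))).
  intros k _. apply is_Cint_scal, is_Cint_minus; apply reg_kernel_integral; assumption.
Qed.

Definition sign_fact (K : nat) : C := RtoC (-1) ^ K * INR (fact K).

Lemma sign_sqr (l : nat) : RtoC (-1) ^ l * RtoC (-1) ^ l = 1.
Proof.
  rewrite <- Cpow_mult_l. replace (RtoC (-1) * RtoC (-1)) with (RtoC 1) by ring. apply Cpow_1_l.
Qed.

(** The factors of (s)_j at s = -(j+l) run from -(j+l) to -(l+1), so its logarithmic derivative is
    -(1/(l+1) + ... + 1/(j+l)). The induction on j lets l vary so that s stays fixed. *)
Lemma rising_neg (j l : nat) :
  rising (- INR (j + l)) j * INR (fact l) = RtoC (-1) ^ j * INR (fact (j + l)) /\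
  rising' (- INR (j + l)) j = rising (- INR (j + l)) j * (harmonic l - harmonic (j + l)).
Proof.
  revert l. induction j as [ | j IH ]; intros l.
  - simpl. split; ring.
  - destruct (IH (S l)) as [H1 H2]. replace (j + S l)%nat with (S j + l)%nat in H1, H2 by lia.
    set (s := - INR (S j + l)) in *.
    assert (Es : s + INR j = - INR (S l)).
    { unfold s. replace (INR (S j + l)) with (INR j + INR (S l))%R by (rewrite <- plus_INR; f_equal; lia).
      rewrite RtoC_plus. ring. }
    assert (HS := INR_S_C_neq_0 l).
    simpl rising. simpl rising'. rewrite Es, H2. split.
    + rewrite RtoC_INR_fact_S in H1. rewrite Cpow_S.
      replace (RtoC (-1) * RtoC (-1) ^ j * INR (fact (S j + l)))
        with (RtoC (-1) * (RtoC (-1) ^ j * INR (fact (S j + l)))) by ring.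
      rewrite <- H1. ring.
    + rewrite (harmonic_S l), RtoC_plus, RtoC_inv by (apply not_0_INR; lia). field. exact HS.
Qed.

(** The factor s + K vanishes; for these indices the logarithm disappears from [em_term']. *)
Lemma rising_neg_zero (K d : nat) : rising (- INR K) (S K + d) = 0.
Proof.
  induction d as [ | d IH ].
  - rewrite Nat.add_0_r. simpl. ring.
  - rewrite Nat.add_succ_r.
    change (rising (- INR K) (S (S K + d))) with (rising (- INR K) (S K + d) * (- INR K + INR (S K + d))).
    rewrite IH. ring.
Qed.

Lemma em_term_neg (K l : nat) (x : C) : (0 < Re x)%R -> (l <= K)%nat ->
  em_term (- INR K) x (K - l) = sign_fact K * (beta (K - l) * exp_coeff x l) /\
  em_term' (- INR K) x (K - l) =
    sign_fact K * (beta (K - l) * (reg_value l x - harmonic K * exp_coeff x l)).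
Proof.
  intros Hx Hl. destruct (rising_neg (K - l) l) as [H1 H2].
  replace (K - l + l)%nat with K in H1, H2 by lia.
  assert (HP : Cpower x (- - INR K - INR (K - l)) = x ^ l).
  { rewrite <- (Cpower_INR x l Hx). f_equal. rewrite minus_INR, RtoC_minus by exact Hl. ring. }
  assert (Hf := INR_fact_C_neq_0 l).
  assert (HR : rising (- INR K) (K - l) = RtoC (-1) ^ K * RtoC (-1) ^ l * INR (fact K) / INR (fact l)).
  { replace (RtoC (-1) ^ K) with (RtoC (-1) ^ (K - l) * RtoC (-1) ^ l)
      by (rewrite <- Cpow_add_r; f_equal; lia).
    replace (RtoC (-1) ^ (K - l) * RtoC (-1) ^ l * RtoC (-1) ^ l * INR (fact K) / INR (fact l))
      with ((RtoC (-1) ^ l * RtoC (-1) ^ l) * (RtoC (-1) ^ (K - l) * INR (fact K)) / INR (fact l))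
      by (field; exact Hf).
    rewrite <- H1, sign_sqr. field. exact Hf. }
  assert (HE : exp_coeff x l = RtoC (-1) ^ l * x ^ l / INR (fact l)).
  { unfold exp_coeff. replace (- x) with (RtoC (-1) * x) by ring. rewrite Cpow_mult_l. field. exact Hf. }
  unfold em_term, em_term', reg_value, sign_fact.
  rewrite H2, HP, HR, HE. split; field; exact Hf.
Qed.

Lemma em_sum_neg (K : nat) (x : C) : (0 < Re x)%R ->
  em_sum (S K) (- INR K) x = sign_fact K * bern K x /\
  em_sum' (S K) (- INR K) x = sign_fact K * (reg_sum K x - harmonic K * bern K x).
Proof.
  intros Hx. unfold em_sum, em_sum'. rewrite bern_exp_coeff. unfold reg_sum.
  rewrite (csum_rev (em_term _ _)), (csum_rev (em_term' _ _)). split.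
  - rewrite <- csum_mult_l. apply csum_ext. intros l Hl.
    replace (S K - 1 - l)%nat with (K - l)%nat by lia.
    rewrite (proj1 (em_term_neg K l x Hx ltac:(lia))). ring.
  - rewrite <- csum_mult_l, <- csum_minus, <- csum_mult_l. apply csum_ext. intros l Hl.
    replace (S K - 1 - l)%nat with (K - l)%nat by lia.
    rewrite (proj2 (em_term_neg K l x Hx ltac:(lia))). ring.
Qed.

Lemma sign_fact_exp_coeff (n : nat) (x : C) :
  sign_fact (S n) * exp_coeff x n = - INR (S n) * x ^ n.
Proof.
  unfold sign_fact, exp_coeff. rewrite RtoC_INR_fact_S, Cpow_S.
  replace (- x) with (RtoC (-1) * x) by ring. rewrite Cpow_mult_l.
  assert (Hf := INR_fact_C_neq_0 n).
  replace (RtoC (-1) * RtoC (-1) ^ n * (INR (S n) * INR (fact n)) *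
    (/ INR (fact n) * (RtoC (-1) ^ n * x ^ n)))
    with (- INR (S n) * (RtoC (-1) ^ n * RtoC (-1) ^ n) * x ^ n) by (field; exact Hf).
  rewrite sign_sqr. ring.
Qed.

(** The first claim is the difference equation of [bern]. In the second, the x^n obtained by
    differentiating the factor s cancels against the summand 1/(n+1) of H_(n+1), leaving H_n - log x
    as in the difference of integrals. *)
Lemma em_rem_neg (n : nat) (x : C) : (0 < Re x)%R ->
  em_rem (S (S n)) (- INR (S n)) x = 0 /\
  em_rem' (S (S n)) (- INR (S n)) x =
    sign_fact (S n) * (Cint_0_infty (integrand n x) - Cint_0_infty (integrand n (x + 1))).
Proof.
  intros Hx. assert (Hx1 : (0 < Re (x + 1))%R) by (rewrite Re_plus, re_RtoC; lra).
  destruct (em_sum_neg (S n) x Hx) as [E1 E2]. destruct (em_sum_neg (S n) (x + 1) Hx1) as [E3 E4].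
  assert (HP : Cpower x (- - INR (S n) - 1) = x ^ n).
  { rewrite <- (Cpower_INR x n Hx). f_equal. rewrite S_INR, RtoC_plus. ring. }
  assert (Hb := bern_difference n x). assert (Hc := sign_fact_exp_coeff n x).
  assert (Hd := integral_difference n x Hx).
  change (/ INR (fact n) * (- x) ^ n) with (exp_coeff x n) in Hb.
  unfold em_rem, em_rem'. rewrite E1, E2, E3, E4, HP. split.
  - replace (- INR (S n) * x ^ n - sign_fact (S n) * bern (S n) x + sign_fact (S n) * bern (S n) (x + 1))
      with (- INR (S n) * x ^ n - sign_fact (S n) * (bern (S n) x - bern (S n) (x + 1))) by ring.
    rewrite Hb, Hc. ring.
  - rewrite Hd. unfold reg_value. rewrite harmonic_S, RtoC_plus, RtoC_inv by (apply not_0_INR; lia).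
    set (H := harmonic n). set (L := Clog x). set (c := sign_fact (S n)) in *.
    set (k := INR (S n)) in *.
    replace (c * (exp_coeff x n * (H - L) - (reg_sum (S n) x - reg_sum (S n) (x + 1))))
      with (c * exp_coeff x n * (H - L) - c * (reg_sum (S n) x - reg_sum (S n) (x + 1))) by ring.
    replace ((1 - - k * L) * x ^ n - c * (reg_sum (S n) x - (H + / k) * bern (S n) x)
      + c * (reg_sum (S n) (x + 1) - (H + / k) * bern (S n) (x + 1)))
      with ((1 + k * L) * x ^ n - c * (reg_sum (S n) x - reg_sum (S n) (x + 1))
        + (H + / k) * (c * (bern (S n) x - bern (S n) (x + 1)))) by ring.
    rewrite Hb, Hc. field. exact (INR_S_C_neq_0 n).
Qed.

(** With the logarithm gone, what remains is a constant times the power -(d+1) of n + w. *)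
Lemma em_term'_vanishes (w : C) (K d : nat) : (0 < Re w)%R ->
  forall eps, (0 < eps)%R -> exists N, forall n, (N <= n)%nat ->
    (Cmod (em_term' (- INR K) (INR n + w) (S K + d)) < eps)%R.
Proof.
  intros Hw eps Heps.
  destruct (Cpower_vanishes w (- INR K + INR (S K + d)) (beta (S K + d) * rising' (- INR K) (S K + d)) Hw)
    with (eps := eps) as [N HN].
  - rewrite Re_plus, Re_opp, !re_RtoC, plus_INR, S_INR. assert (P := pos_INR d). lra.
  - exact Heps.
  - exists N. intros n Hn. unfold em_term'. rewrite rising_neg_zero.
    replace (rising' (- INR K) (S K + d) - 0 * Clog (INR n + w)) with (rising' (- INR K) (S K + d)) by ring.
    replace (- - INR K - INR (S K + d)) with (- (- INR K + INR (S K + d))) by ring. apply HN, Hn.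
Qed.

(** Lowers the order from one where termwise differentiation is justified to K + 1, where the
    remainder has its closed form. *)
Lemma em_rem'_descent (w z : C) (K d : nat) : (0 < Re w)%R ->
  is_series (fun k => em_rem' (S K + d) (- INR K) (INR k + w)) (z - em_sum' (S K + d) (- INR K) w) ->
  is_series (fun k => em_rem' (S K) (- INR K) (INR k + w)) (z - em_sum' (S K) (- INR K) w).
Proof.
  intros Hw. induction d as [ | d IH ]; intros H; [ rewrite Nat.add_0_r in H; exact H | ].
  apply IH. rewrite Nat.add_succ_r in H.
  assert (G := is_series_telescope (fun k => em_term' (- INR K) (INR k + w) (S K + d))
    (em_term'_vanishes w K d Hw)).
  cbv beta in G. rewrite INR_0_plus in G.
  clear IH. set (M := (S K + d)%nat) in *. clearbody M.
  refine (is_series_Cext _ _ _ _ _ _ (is_series_Cplus _ _ _ _ H G)).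
  - intros k. rewrite INR_S_plus. unfold em_rem', em_sum'. simpl csum. ring.
  - unfold em_sum'. simpl csum. ring.
Qed.

Lemma hurwitz_zeta_derive_neg (n : nat) (w : C) : (0 < Re w)%R ->
  is_derive (V := C_NormedModule) (fun s => hurwitz_zeta s w) (- INR n)
    (sign_fact n * (Cint_0_infty (integrand n w) + reg_sum (S n) w - bern (S n) w * harmonic n)).
Proof.
  intros Hw.
  assert (HS := INR_S_C_neq_0 n).
  assert (Es : - INR n - 1 = - INR (S n)) by (rewrite S_INR, RtoC_plus; ring).
  assert (Hs1 : RtoC (- INR n) <> 1).
  { intros E. apply RtoC_inj in E. assert (P := pos_INR n). lra. }
  rewrite RtoC_opp in Hs1.
  destruct (hurwitz_zeta_derive w (- INR n) Hw Hs1) as [z0 [z1 [Hd [H0 H1]]]].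
  rewrite Es in Hd, H0, H1.
  assert (HRe : Re (- INR (S n)) = (- INR (S n))%R) by (rewrite Re_opp, re_RtoC; reflexivity).
  assert (Hpos : forall k, (0 < Re (INR k + w))%R).
  { intros k. assert (P := Re_shift_lower w k Hw). lra. }
  destruct (em_sum_neg (S n) w Hw) as [E0 E1].
  assert (Hz0 : z0 = sign_fact (S n) * bern (S n) w).
  { specialize (H0 (S (S n)) ltac:(rewrite HRe, (S_INR (S n)); lra)). unfold em_value in H0.
    rewrite E0 in H0.
    apply Cminus_eq_0, (is_series_C_unique _ _ _ H0), (is_series_finite _ 0). intros k _.
    apply em_rem_neg, Hpos. }
  assert (Hz1 : z1 = sign_fact (S n) * (reg_sum (S n) w - harmonic (S n) * bern (S n) w)
    + sign_fact (S n) * Cint_0_infty (integrand n w)).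
  (* Re s + N >= 3 at s = -(n+1) requires N = n + 4; the descent then removes the two additional
     orders. *)
  { specialize (H1 (S (S n) + 2)%nat ltac:(lia)
      ltac:(rewrite HRe, plus_INR, (S_INR (S n)); simpl (INR 2); lra)).
    apply em_rem'_descent in H1; [ | exact Hw ]. rewrite E1 in H1.
    assert (G := is_series_telescope (fun k => Cint_0_infty (integrand n (INR k + w)))
      (integral_vanishes n w Hw)).
    rewrite <- (is_series_C_unique _ _ (sign_fact (S n) * Cint_0_infty (integrand n w)) H1); [ ring | ].
    refine (is_series_Cext _ _ _ _ _ _ (is_series_Cscal (sign_fact (S n)) _ _ G)).
    - intros k. cbv beta. rewrite (proj2 (em_rem_neg n (INR k + w) (Hpos k))), INR_S_plus. reflexivity.
    - rewrite INR_0_plus. reflexivity. }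
  (* Quotient rule with s0 - 1 = -(n+1): the term with z0 contributes 1/(n+1), which turns H_(n+1)
     into H_n. *)
  replace (sign_fact n * (Cint_0_infty (integrand n w) + reg_sum (S n) w - bern (S n) w * harmonic n))
    with (z1 / - INR (S n) - z0 / (- INR (S n) * - INR (S n))); [ exact Hd | ].
  rewrite Hz0, Hz1, harmonic_S, RtoC_plus, RtoC_inv by (apply not_0_INR; lia).
  replace (sign_fact (S n)) with (- INR (S n) * sign_fact n).
  - field. exact HS.
  - unfold sign_fact. rewrite RtoC_INR_fact_S, Cpow_S. ring.
Qed.

(** * Identification of [r_hat], membership in the generated field and the period representation *)

Lemma b_coeff_sub (n l : nat) : (l <= S n)%nat ->
  b_coeff (Z.of_nat n - Z.of_nat l) = beta (S n - l).
Proof. intros Hl. rewrite <- b_coeff_eq. f_equal. lia. Qed.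

(** The harmonic sum may start at 0 because H_0 = 0, and the coefficient of log w is recognized as
    -b_n(w). *)
Lemma r_hat_csum (n : nat) (w : C) :
  r_hat n w = csum (fun l => beta (S n - l) * exp_coeff w l * harmonic l) (S (S n))
    - bern (S n) w * Clog w.
Proof.
  assert (HE : forall l, RtoC (-1) ^ l / INR (fact l) * w ^ l = exp_coeff w l).
  { intros l. unfold exp_coeff. replace (- w) with (RtoC (-1) * w) by ring.
    rewrite Cpow_mult_l. unfold Cdiv. ring. }
  unfold r_hat. rewrite Nat.add_1_r. unfold Cminus. f_equal.
  - rewrite <- sum_n_m_S.
    change (sum_n (fun l => b_coeff (Z.of_nat n - Z.of_nat (S l))
      * (RtoC (-1) ^ S l / INR (fact (S l))) * w ^ S l * harmonic (S l)) n =
      csum (fun l => beta (S n - l) * exp_coeff w l * harmonic l) (S (S n))).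
    rewrite csum_sum_n, (csum_shift _ (S n)), harmonic_0.
    replace (beta (S n - 0) * exp_coeff w 0 * 0) with (RtoC 0) by ring. rewrite Cplus_0_l.
    apply csum_ext. intros k Hk. rewrite b_coeff_sub by lia. rewrite <- HE. unfold Cdiv. ring.
  - change (sum_n (fun l => b_coeff (Z.of_nat n - Z.of_nat l)
      * (RtoC (-1) ^ (l + 1) / INR (fact l)) * w ^ l) (S n) * Clog w = - (bern (S n) w * Clog w)).
    rewrite csum_sum_n, bern_exp_coeff.
    replace (csum (fun l => b_coeff (Z.of_nat n - Z.of_nat l)
      * (RtoC (-1) ^ (l + 1) / INR (fact l)) * w ^ l) (S (S n)))
      with (- (1) * csum (fun l => exp_coeff w l * beta (S n - l)) (S (S n))); [ ring | ].
    rewrite <- csum_mult_l. apply csum_ext. intros k Hk. rewrite b_coeff_sub by lia.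
    rewrite Nat.add_1_r, Cpow_S, <- HE. unfold Cdiv. ring.
Qed.

Lemma r_hat_reg_sum (n : nat) (w : C) : r_hat n w = reg_sum (S n) w.
Proof.
  rewrite r_hat_csum, bern_exp_coeff, <- csum_mult_r, <- csum_minus.
  apply csum_ext. intros l _. unfold reg_value. ring.
Qed.

Lemma generated_field_IZR (gens : (C -> C) -> Prop) (k : Z) :
  generated_field gens (fun _ => RtoC (IZR k)).
Proof.
  replace (IZR k) with (Q2R (inject_Z k)); [ apply gen_rat | ].
  unfold Q2R, inject_Z. simpl. field.
Qed.

Lemma generated_field_INR (gens : (C -> C) -> Prop) (k : nat) :
  generated_field gens (fun _ => RtoC (INR k)).
Proof. rewrite INR_IZR_INZ. apply generated_field_IZR. Qed.

Lemma generated_field_minus (gens : (C -> C) -> Prop) (f g : C -> C) :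
  generated_field gens f -> generated_field gens g -> generated_field gens (fun t => f t - g t).
Proof. intros Hf Hg. exact (gen_add gens _ _ Hf (gen_opp gens _ Hg)). Qed.

Lemma generated_field_div (gens : (C -> C) -> Prop) (f g : C -> C) :
  generated_field gens f -> generated_field gens g -> generated_field gens (fun t => f t / g t).
Proof. intros Hf Hg. exact (gen_mul gens _ _ Hf (gen_inv gens _ Hg)). Qed.

Lemma generated_field_pow (gens : (C -> C) -> Prop) (f : C -> C) (n : nat) :
  generated_field gens f -> generated_field gens (fun t => f t ^ n).
Proof.
  intros Hf. induction n as [ | n IH ].
  - apply (generated_field_IZR gens 1).
  - exact (gen_mul gens _ _ Hf IH).
Qed.

Lemma generated_field_csum (gens : (C -> C) -> Prop) (f : nat -> C -> C) (n : nat) :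
  (forall k, (k < n)%nat -> generated_field gens (f k)) ->
  generated_field gens (fun t => csum (fun k => f k t) n).
Proof.
  intros Hf. induction n as [ | n IH ].
  - apply (generated_field_IZR gens 0).
  - exact (gen_add gens _ _ (IH (fun k Hk => Hf k (Nat.lt_lt_succ_r _ _ Hk))) (Hf n (Nat.lt_succ_diag_r n))).
Qed.

(** No explicit rational is exhibited: the recursion builds [beta k] from integers by field
    operations. *)
Lemma generated_field_beta (gens : (C -> C) -> Prop) (k : nat) :
  generated_field gens (fun _ => beta k).
Proof.
  induction k as [ k IH ] using (well_founded_induction lt_wf). rewrite beta_eq.
  apply (generated_field_minus gens (fun _ => if Nat.eqb k 0 then 1 else 0)).
  - destruct (Nat.eqb k 0); [ apply (generated_field_IZR gens 1) | apply (generated_field_IZR gens 0) ].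
  - apply (generated_field_csum gens (fun l _ => expm1_coeff (k - l) * beta l)). intros l Hl.
    exact (gen_mul gens _ _ (generated_field_div gens _ _
      (generated_field_pow gens _ (k - l) (generated_field_IZR gens (-1)))
      (generated_field_INR gens (fact (S (k - l))))) (IH l Hl)).
Qed.

Lemma generated_field_harmonic (gens : (C -> C) -> Prop) (l : nat) :
  generated_field gens (fun _ => RtoC (harmonic l)).
Proof.
  induction l as [ | l IH ].
  - rewrite harmonic_0. apply (generated_field_IZR gens 0).
  - rewrite harmonic_S, RtoC_plus, RtoC_inv by (apply not_0_INR; lia).
    exact (gen_add gens _ _ IH (gen_inv gens _ (generated_field_INR gens (S l)))).
Qed.

Lemma hurwitz_exponential_period (n : nat) (w : C) : (0 < Re w)%R ->
  exponential_period (Q_t_w w)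
    (sign_fact n * (Cint_0_infty (integrand n w) + r_hat n w - bern (S n) w * harmonic n)).
Proof.
  intros Hw.
  (* A collects the contributions without log w; it is a polynomial in w with rational coefficients,
     so A e^(-t) lies in the field and integrates to A. *)
  set (A := csum (fun l => beta (S n - l) * exp_coeff w l * harmonic l) (S (S n)) - bern (S n) w * harmonic n).
  exists (fun t => sign_fact n * (1 / t ^ n * (1 / (1 - Cexp (- t)) - b_partial_sum n t) * (Cexp (- (w * t)) / t)
    + (A * Cexp (- t) - bern (S n) w * ((Cexp (- t) - Cexp (- (w * t))) / t)))).
  split.
  - assert (Gt : Q_t_w w (fun t => t)) by (apply gen_in; simpl; auto).
    assert (Ge : Q_t_w w (fun t => Cexp (- t))) by (apply gen_in; simpl; auto).
    assert (Gw : Q_t_w w (fun _ => w)) by (apply gen_in; simpl; auto).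
    assert (Gwt : Q_t_w w (fun t => Cexp (- (w * t)))) by (apply gen_in; simpl; auto).
    assert (G1 := generated_field_IZR _ 1 : Q_t_w w (fun _ => 1)).
    assert (Gexp : forall l, Q_t_w w (fun _ => exp_coeff w l)).
    { intros l. exact (gen_mul _ _ _ (gen_inv _ _ (generated_field_INR _ (fact l)))
        (generated_field_pow _ _ l (gen_opp _ _ Gw))). }
    assert (Gbern : Q_t_w w (fun _ => bern (S n) w)).
    { apply (generated_field_csum _ (fun l _ => exp_coeff w l * beta (S n - l))). intros l _.
      exact (gen_mul _ _ _ (Gexp l) (generated_field_beta _ _)). }
    assert (GA : Q_t_w w (fun _ => A)).
    { apply (generated_field_minus _ (fun _ => csum _ (S (S n))) (fun _ => bern (S n) w * harmonic n)).
      - apply (generated_field_csum _ (fun l _ => beta (S n - l) * exp_coeff w l * harmonic l)).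
        intros l _. exact (gen_mul _ _ _ (gen_mul _ _ _ (generated_field_beta _ _) (Gexp l))
          (generated_field_harmonic _ l)).
      - exact (gen_mul _ _ _ Gbern (generated_field_harmonic _ n)). }
    assert (Gb : Q_t_w w (fun t => b_partial_sum n t)).
    { replace (fun t => b_partial_sum n t)
        with (fun t => csum (fun j => beta j * (t ^ j / t)) (S (S n)))
        by (apply functional_extensionality; intros t; symmetry; apply b_partial_sum_eq).
      apply (generated_field_csum _ (fun j t => beta j * (t ^ j / t))). intros j _.
      exact (gen_mul _ _ _ (generated_field_beta _ j)
        (generated_field_div _ _ _ (generated_field_pow _ _ j Gt) Gt)). }
    apply (gen_mul _ (fun _ => sign_fact n)).
    { exact (gen_mul _ _ _ (generated_field_pow _ _ n (generated_field_IZR _ (-1)))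
        (generated_field_INR _ (fact n))). }
    refine (gen_add _ _ _ (gen_mul _ _ _ (gen_mul _ _ _ _ _) _) _).
    + exact (generated_field_div _ _ _ G1 (generated_field_pow _ _ n Gt)).
    + apply generated_field_minus; [ | exact Gb ].
      exact (generated_field_div _ _ _ G1 (generated_field_minus _ _ _ G1 Ge)).
    + exact (generated_field_div _ _ _ Gwt Gt).
    + exact (generated_field_minus _ _ _ (gen_mul _ _ _ GA Ge)
        (gen_mul _ _ _ Gbern (generated_field_div _ _ _ (generated_field_minus _ _ _ Ge Gwt) Gt))).
  - replace (Cint_0_infty (integrand n w) + r_hat n w - bern (S n) w * harmonic n)
      with (Cint_0_infty (integrand n w) + (A * 1 - bern (S n) w * Clog w))
      by (rewrite r_hat_csum; unfold A; ring).
    apply is_Cint_scal, is_Cint_plus.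
    + exact (integrand_integrable n w Hw).
    + apply is_Cint_minus; apply is_Cint_scal;
        [ exact is_Cint_exp_opp | apply Frullani, Hw ].
Qed.

Theorem corollary1p6 (n : nat) (w : C) (hw : (0 < Re w)%R) :
  ex_derive (fun s : C => hurwitz_zeta s w) (- INR n) /\
  (exists I : C, is_Cint_0_infty (integrand n w) I) /\
  hurwitz_zeta' (- INR n) w =
    RtoC (-1) ^ n * INR (fact n) *
      (Cint_0_infty (integrand n w) + r_hat n w
       - b_poly (Z.of_nat n) w * harmonic n) /\
  exponential_period (Q_t_w w) (hurwitz_zeta' (- INR n) w).
Proof.
  assert (Hd := hurwitz_zeta_derive_neg n w hw).
  assert (E := is_C_derive_unique _ _ _ Hd).
  rewrite <- r_hat_reg_sum in E. change (C_derive _ _) with (hurwitz_zeta' (- INR n) w) in E.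
  repeat split.
  - eexists. exact Hd.
  - eexists. exact (integrand_integrable n w hw).
  - rewrite E, b_poly_eq. reflexivity.
  - rewrite E. apply hurwitz_exponential_period, hw.
Qed.
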